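(* Let $N$ be a connected complete Riemannian manifold and let $f:N\to\mathbb{R}$ be an isoparametric function. Then the focal varieties $M_{+}$ and $M_{-}$ of $f$ (whenever non-empty) are minimal submanifolds of $N$.
   Context: Let $N$ be a smooth connected Riemannian manifold. A non-constant smooth function $f:N\to\mathbb{R}$ is called transnormal if there is a smooth function $b:J\to\mathbb{R}$, where $J=f(N)\subset\mathbb{R}$, such that $|\nabla f|^2=b(f)$. It is called isoparametric if moreover there is a continuous function $a:J\to\mathbb{R}$ such that $\triangle f=a(f)$, where $\triangle$ is the Laplacian. If $f$ attains its maximum (resp. minimum), the preimage of the maximum (resp. minimum) value is called the focal variety $M_{+}$ (resp. $M_{-}$) of $f$; otherwise the corresponding focal variety is empty. Known structural facts (Q.M. Wang) underlying the definitions: for a transnormal function $f$ on a complete $N$, there are no critical values of $f$ in the interior of $J$, the focal varieties $M_{\pm}$ are smooth submanifolds of $N$, and each regular level hypersurface of $f$ is a tubular hypersurface (at constant distance) over either of $M_{\pm}$ that is non-empty. A submanifold is minimal if its shape operator has zero trace in every normal direction at every point. *)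

(* Defs.v *)
From HB Require Import structures.
From mathcomp Require Import all_boot all_order all_algebra.
From mathcomp Require Import all_classical all_reals all_analysis.
Set Implicit Arguments.
Unset Strict Implicit.
Unset Printing Implicit Defensive.
Import Order.TTheory GRing.Theory Num.Theory.
Import numFieldNormedType.Exports.
Local Open Scope classical_set_scope.
Local Open Scope ring_scope.

(* Tangent vectors at a point, read in a chart, are row vectors 'rV[R]_n, and  *)
(* linear maps act on the right, as in [jacobian].                             *)

Section SmoothFunctions.
Context {R : realType} {n : nat}.

(* [U] is meant to be open. *)
Fixpoint Ck_on (k : nat) (U : set 'rV[R]_n) (F : 'rV[R]_n -> R) : Prop :=
  (forall x, U x -> {for x, continuous F}) /\
  if k is k'.+1 then
    forall i : 'I_n, (forall x, U x -> derivable F x 'e_i) /\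
                     Ck_on k' U ('D_'e_i F)
  else True.

Definition smooth_on (U : set 'rV[R]_n) (F : 'rV[R]_n -> R) : Prop :=
  forall k, Ck_on k U F.

End SmoothFunctions.

(* Smoothness of a function of one variable on an arbitrary subset J of R (an  *)
(* interval with or without its endpoints): it extends smoothly to an open     *)
(* neighbourhood of J.                                                         *)
Definition smooth_on_subset {R : realType} (J : set R) (b : R -> R) : Prop :=
  exists U : set R, exists B : R -> R,
    [/\ open U, J `<=` U,
        forall k x, U x -> derivable (derive1n k B) x 1 &
        forall x, J x -> b x = B x].

Section LocalRiemannianGeometry.
Context {R : realType} {n : nat}.
Variable g : 'rV[R]_n -> 'M[R]_n.
Implicit Types (F : 'rV[R]_n -> R) (x u v : 'rV[R]_n).

Definition inner (G : 'M[R]_n) u v : R := (u *m G *m v^T) 0 0.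

Definition christoffel x (l i j : 'I_n) : R :=
  2^-1 * \sum_m invmx (g x) l m *
    ('D_'e_i (fun y => g y j m) x + 'D_'e_j (fun y => g y i m) x
     - 'D_'e_m (fun y => g y i j) x).

(* nabla_(d_i) d_j, for d_i the i-th coordinate vector field *)
Definition nabla_coord x (i j : 'I_n) : 'rV[R]_n :=
  \row_l christoffel x l i j.

Definition gradient F x : 'rV[R]_n :=
  (\row_i 'D_'e_i F x) *m invmx (g x).

Definition hessian F x : 'M[R]_n :=
  \matrix_(i, j) ('D_'e_i ('D_'e_j F) x
                  - \sum_l christoffel x l i j * 'D_'e_l F x).

Definition laplacian F x : R := \tr (invmx (g x) *m hessian F x).

End LocalRiemannianGeometry.

(* Only the values of [cmap] on [cdom], and of [cinv] on the image of [cdom],  *)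
(* are meaningful.                                                             *)
Record chart (R : realType) (n : nat) (T : topologicalType) := Chart {
  cdom : set T;
  cmap : T -> 'rV[R]_n;
  cinv : 'rV[R]_n -> T }.

Section Charts.
Context {R : realType} {n : nat} {T : topologicalType}.
Implicit Types (c : chart R n T).

Definition cimage c : set 'rV[R]_n := cmap c @` cdom c.

Definition is_chart c : Prop :=
  [/\ open (cdom c), open (cimage c),
      forall p, cdom c p -> cinv c (cmap c p) = p,
      forall p, cdom c p -> {for p, continuous (cmap c)} &
      forall x, cimage c x -> {for x, continuous (cinv c)}].

Definition transition c c' : 'rV[R]_n -> 'rV[R]_n := cmap c' \o cinv c.

Definition compatible c c' : Prop :=
  forall i : 'I_n,
    smooth_on (cmap c @` (cdom c `&` cdom c')) (fun x => transition c c' x 0 i)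
    /\
    smooth_on (cmap c' @` (cdom c `&` cdom c')) (fun x => transition c' c x 0 i).

End Charts.

Record smoothManifold (R : realType) (n : nat) := SmoothManifold {
  manifold_space :> topologicalType;
  manifold_hausdorff : hausdorff_space manifold_space;
  manifold_second_countable : @second_countable manifold_space;
  atlas : set (chart R n manifold_space);
  atlas_is_chart : forall c, atlas c -> is_chart c;
  atlas_cover : forall p, exists2 c, atlas c & cdom c p;
  atlas_compatible : forall c c', atlas c -> atlas c' -> compatible c c';
  atlas_maximal : forall c, is_chart c ->
    (forall c', atlas c' -> compatible c c') -> atlas c }.

(* [metric c x] is the Gram matrix, in the chart c, of the coordinate vector   *)
(* fields at the point of coordinates x.                                       *)
Record riemannianManifold (R : realType) (n : nat) := RiemannianManifold {
  riemannian_manifold :> smoothManifold R n;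
  metric : chart R n riemannian_manifold -> 'rV[R]_n -> 'M[R]_n;
  metric_smooth : forall c, atlas c ->
    forall i j, smooth_on (cimage c) (fun x => metric c x i j);
  metric_sym : forall c, atlas c ->
    forall x, cimage c x -> (metric c x)^T = metric c x;
  metric_posdef : forall c, atlas c ->
    forall x, cimage c x -> forall v, v != 0 -> 0 < inner (metric c x) v v;
  metric_change : forall c c', atlas c -> atlas c' ->
    forall p, cdom c p -> cdom c' p ->
    let J := jacobian (transition c c') (cmap c p) in
    metric c (cmap c p) = J *m metric c' (cmap c' p) *m J^T }.

Section RiemannianManifolds.
Context {R : realType} {n : nat}.
Variable N : riemannianManifold R n.
Implicit Types (c : chart R n N) (f : N -> R) (S : set N).

Definition geodesic (gamma : R -> N) : Prop :=
  continuous gamma /\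
  forall c, atlas c -> forall t, cdom c (gamma t) ->
    let u i := fun s => cmap c (gamma s) 0 i in
    (forall i, derivable (u i) t 1 /\ derivable (derive1 (u i)) t 1) /\
    forall l, derive1n 2 (u l) t
      + \sum_i \sum_j christoffel (metric c) (cmap c (gamma t)) l i j
                      * derive1 (u i) t * derive1 (u j) t = 0.

Definition complete_manifold : Prop :=
  forall c, atlas c -> forall p, cdom c p -> forall v : 'rV[R]_n,
  exists gamma : R -> N,
    [/\ geodesic gamma, gamma 0 = p &
        forall i, derive1 (fun s => cmap c (gamma s) 0 i) 0 = v 0 i].

Definition smooth_function f : Prop :=
  forall c, atlas c -> smooth_on (cimage c) (f \o cinv c).

Definition transnormal f : Prop :=
  [/\ smooth_function f,
      exists p q, f p <> f q &
      exists2 b : R -> R, smooth_on_subset (range f) b &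
        forall c, atlas c -> forall p, cdom c p ->
          let grad := gradient (metric c) (f \o cinv c) (cmap c p) in
          inner (metric c (cmap c p)) grad grad = b (f p)].

Definition isoparametric f : Prop :=
  transnormal f /\
  exists2 a : R -> R, {within range f, continuous a} &
    forall c, atlas c -> forall p, cdom c p ->
      laplacian (metric c) (f \o cinv c) (cmap c p) = a (f p).

(* These are empty when the corresponding extremum is not attained. *)
Definition focal_plus f : set N := [set p | forall q, f q <= f p].
Definition focal_minus f : set N := [set p | forall q, f p <= f q].

Definition slice_chart (k : nat) S c : Prop :=
  atlas c /\
  forall p, cdom c p -> (S p <-> forall i : 'I_n, (k <= i)%N -> cmap c p 0 i = 0).

(* embedded submanifold of dimension k *)
Definition submanifold (k : nat) S : Prop :=
  forall p, S p -> exists2 c, slice_chart k S c & cdom c p.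

(* In a slice chart the tangent space of S has basis d_i, i < k. *)
Section ShapeOperator.
Variables (k : nat) (kn : (k <= n)%N) (c : chart R n N).
Let tgt (i : 'I_k) : 'I_n := widen_ord kn i.
Implicit Types (x xi : 'rV[R]_n).

Definition normal_vector x xi : Prop :=
  forall i : 'I_k, inner (metric c x) 'e_(tgt i) xi = 0.

Definition first_form x : 'M[R]_k := \matrix_(i, j) metric c x (tgt i) (tgt j).

(* <II(d_i, d_j), xi>; II is the normal part of nabla, but its tangential part *)
(* is orthogonal to the normal vector xi.                                      *)
Definition second_form x xi : 'M[R]_k :=
  \matrix_(i, j) inner (metric c x) (nabla_coord (metric c) x (tgt i) (tgt j)) xi.

(* Matrix of the endomorphism A of the tangent space of S determined by        *)
(* <A X, Y> = <II(X, Y), xi>.                                                  *)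
Definition shape_operator x xi : 'M[R]_k :=
  second_form x xi *m invmx (first_form x).

End ShapeOperator.

Definition minimal_submanifold (k : nat) (kn : (k <= n)%N) S : Prop :=
  submanifold k S /\
  forall c, slice_chart k S c -> forall p, cdom c p -> S p ->
  forall xi : 'rV[R]_n, normal_vector kn c (cmap c p) xi ->
    \tr (shape_operator kn c (cmap c p) xi) = 0.

End RiemannianManifolds.

(* Main.v *)
From HB Require Import structures.
Require Import Defs.
From mathcomp Require Import all_boot all_order all_algebra.
From mathcomp Require Import all_classical all_reals all_analysis.
From mathcomp Require Import ring lra zify.
Set Implicit Arguments.
Unset Strict Implicit.
Unset Printing Implicit Defensive.
Import Order.TTheory GRing.Theory Num.Theory.
Import numFieldNormedType.Exports.
Local Open Scope classical_set_scope.
Local Open Scope ring_scope.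

(* Let u >= 0 be the distance of f to the extremal value M, so that           *)
(* |grad u|^2 = beta(u) and Lap u = alpha(u), and put mu = beta'(0) / 2. At a *)
(* zero of u the gradient vanishes; let H be the matrix of second derivatives *)
(* of u there, and G the inverse of the metric.                               *)
(* - If mu <= 0, then |grad u| <= C u near every zero, so {u = 0} is open and *)
(*   closed, and f is constant.                                               *)
(* - Differentiating the eikonal equation twice gives H G H = mu H. Hence     *)
(*   G H / mu is a projection, and rank H = tr(G H) / mu = alpha(0) / mu is   *)
(*   the same at all zeros. Taking grad u for the coordinates transverse to   *)
(*   the kernel of H, the inverse function theorem gives a chart in which     *)
(*   {u = 0} is a linear slice of dimension n - rank H.                       *)
(* - The Laplacian is a function of u. Comparing the two points of the line   *)
(*   through a zero x0 in a normal direction xi where u has the same value    *)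
(*   shows that the derivative of Lap u along xi vanishes at x0. The third    *)
(*   derivatives of u in it are eliminated by differentiating the eikonal     *)
(*   equation three times; what remains is the trace of the shape operator.   *)

(** * Differential calculus in coordinates *)

(** Near its zero set, u is (mu / 2) r^2 up to higher order, where r is the distance to that set.
    For a unit normal xi at a zero x0, this gives Lap u = alpha(0) - mu t tr(A_xi) + O(t^2) at
    distance t along xi, A_xi being the shape operator. To leading order u does not distinguish xi
    from - xi, and Lap u is a function of u, so the linear term must vanish: tr(A_xi) = 0.

    The argument is carried out by coordinate computations at a single zero. [level_set_minimal]
    reduces both focal varieties to the zero set of one function, which [zero_set_minimal] treats.
    [zero_set_derive_gt0] provides mu > 0. The submanifold structure comes from [hess_projection],
    [rank_hess] and [straightening], the last resting on [inverse_function] and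
    [zero_of_degenerate_gradient].

    Minimality is [slice_trace_eq0]. Write G = X + N for the tangential and normal parts of the dual
    metric, T_xi and g_xi for the third derivatives of u and the first derivatives of the metric
    contracted with xi, K for <d_a g (xi, d_b)>, and C for the Christoffel symbols lowered along xi.
    Three facts are combined. The derivative of Lap u along xi is zero ([derive_level_eq0]), which
    reads tr(G T_xi) = mu tr(g_xi N) + mu tr(G C). The Hessian kills tangent vectors along the whole
    slice, so tr(X T_xi) = 0. The eikonal equation differentiated three times ([eikonal_cubic],
    [cubic_contraction]) gives tr(N T_xi) = mu (tr(g_xi N) / 2 + tr(K N)). Hence tr(G C) = tr(K N) -
    tr(g_xi N) / 2 = tr(N C), and tr(X C) = 0 is the trace of the shape operator. *)

Section LineDerivatives.
Context {R : realType} {n : nat}.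
Implicit Types (F H : 'rV[R]_n -> R) (x a v : 'rV[R]_n) (U : set 'rV[R]_n).

Lemma ler_coord_norm x i : `|x 0 i| <= `|x|.
Proof.
rewrite [leRHS]/Num.Def.normr /= mx_normrE.
exact: (le_bigmax _ (fun ij : 'I_1 * 'I_n => `|x ij.1 ij.2|) (0, i)).
Qed.

Lemma rV_norm_le x (e : R) : 0 <= e -> (forall i, `|x 0 i| <= e) -> `|x| <= e.
Proof.
move=> e0 H; rewrite [leLHS]/Num.Def.normr /= mx_normrE.
by apply: bigmax_le => // -[i j] _ /=; rewrite ord1.
Qed.

Lemma is_derive_line F a v (t : R) : derivable F (a + t *: v) v ->
  is_derive t 1 (fun s : R => F (a + s *: v)) ('D_v F (a + t *: v)).
Proof.
have E : (fun h : R => h^-1 *: (((fun s : R => F (a + s *: v)) \o shift t) (h *: 1)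
            - F (a + t *: v))) =
         (fun h : R => h^-1 *: ((F \o shift (a + t *: v)) (h *: v)
            - F (a + t *: v))).
  apply/funext => h /=; congr (_ *: (F _ - _)).
  by rewrite [h *: 1](mulr1 h) scalerDl addrCA.
by move=> dF; split; rewrite /derivable /derive E.
Qed.

Lemma MVT_line F a v (t : R) :
  (forall s : R, `|s| <= `|t| -> derivable F (a + s *: v) v) ->
  exists2 c : R, `|c| <= `|t| & F (a + t *: v) - F a = t * 'D_v F (a + c *: v).
Proof.
move=> dF; pose f (s : R) := F (a + s *: v).
have df (s : R) : `|s| <= `|t| -> is_derive s 1 f ('D_v F (a + s *: v)).
  by move=> st; apply: is_derive_line; exact: dF.
have cf (s : R) : `|s| <= `|t| -> {for s, continuous f}.
  move=> st; apply: differentiable_continuous.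
  by apply/derivable1_diffP; case: (df s st).
have F0 : F a = f 0 by rewrite /f scale0r addr0.
have [t0|t0] := leP 0 t.
  have tE (s : R) : s \in `[0, t] -> `|s| <= `|t|.
    by rewrite in_itv /= => /andP[s0 st]; rewrite !ger0_norm.
  have [||c ct E] := @MVT_segment R f (fun s : R => 'D_v F (a + s *: v)) 0 t t0.
  - by move=> s /subset_itv_oo_cc st; apply: df; exact: tE.
  - apply: continuous_in_subspaceT => s /set_mem /= st.
    by apply: cf; exact: tE.
  exists c; first exact: tE.
  by rewrite F0 -[F (a + t *: v)]/(f t) E subr0 mulrC.
have tE (s : R) : s \in `[t, 0] -> `|s| <= `|t|.
  rewrite in_itv /= => /andP[ts s0].
  by rewrite ler0_norm // (ltr0_norm t0) lerN2.
have [||c ct E] := @MVT_segment R f (fun s : R => 'D_v F (a + s *: v)) t 0 (ltW t0).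
- by move=> s /subset_itv_oo_cc st; apply: df; exact: tE.
- apply: continuous_in_subspaceT => s /set_mem /= st.
  by apply: cf; exact: tE.
exists c; first exact: tE.
by rewrite F0 -[F (a + t *: v)]/(f t) -opprB E sub0r mulrN opprK mulrC.
Qed.

(* Going from [z] to [y] one coordinate at a time stays in a ball of the      *)
(* supremum norm.                                                              *)
Lemma lipschitz_of_partials F (x0 : 'rV[R]_n) (r C : R) : 0 <= C ->
  (forall z : 'rV[R]_n, `|x0 - z| < r ->
     forall i : 'I_n, derivable F z 'e_i /\ `|'D_'e_i F z| <= C) ->
  forall y z : 'rV[R]_n, `|x0 - y| < r -> `|x0 - z| < r ->
    `|F y - F z| <= n%:R * C * `|y - z|.
Proof.
move=> C0 dF y z By Bz.
pose h k : 'rV[R]_n := \row_i (if (i < k)%N then y 0 i else z 0 i).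
have h0 : h 0%N = z by apply/rowP => i; rewrite mxE.
have hn : h n = y by apply/rowP => i; rewrite mxE ltn_ord.
have r0 : 0 < r by apply: le_lt_trans By.
(* A ball of the supremum norm is a box: it contains every point whose coordinates are convex
   combinations of those of [y] and [z], with weights that may change from one coordinate to the
   next. *)
have Bmix (w : 'rV[R]_n) : (forall i, exists t : R, [/\ 0 <= t <= 1 &
     w 0 i = t * y 0 i + (1 - t) * z 0 i]) -> `|x0 - w| < r.
  move=> wP.
  pose m := Num.max `|x0 - y| `|x0 - z|.
  have mr : m < r by rewrite /m gt_max By Bz.
  apply: le_lt_trans mr; apply: rV_norm_le => [|i].
    by rewrite /m le_max normr_ge0.
  have [t [/andP[t0 t1] wi]] := wP i; rewrite !mxE wi.
  have -> : x0 0 i + - (t * y 0 i + (1 - t) * z 0 i) =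
    t * (x0 - y) 0 i + (1 - t) * (x0 - z) 0 i by rewrite !mxE; ring.
  have yi : `|(x0 - y) 0 i| <= m.
    by apply: le_trans (ler_coord_norm _ _) _; rewrite /m le_max lexx.
  have zi : `|(x0 - z) 0 i| <= m.
    by apply: le_trans (ler_coord_norm _ _) _; rewrite /m le_max lexx orbT.
  apply: le_trans (ler_normD _ _) _; have u0 : 0 <= 1 - t by rewrite subr_ge0.
  rewrite !normrM (ger0_norm t0) (ger0_norm u0).
  have := ler_wpM2l t0 yi; have := ler_wpM2l u0 zi; lra.
have step k : (k < n)%N -> `|F (h k.+1) - F (h k)| <= C * `|y - z|.
  move=> kn; pose i := Ordinal kn.
  have hS : h k.+1 = h k + (y 0 i - z 0 i) *: 'e_i.
    apply/rowP => j; rewrite !mxE /=.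
    have [->|ji] := eqVneq j i; first by rewrite /= ltnSn ltnn mulr1 addrC subrK.
    rewrite /= mulr0 addr0 ltnS leq_eqVlt.
    by have -> : (nat_of_ord j == k) = false by apply/negbTE.
  rewrite hS.
  have [d0|d0] := eqVneq (y 0 i - z 0 i) 0.
    by rewrite d0 scale0r addr0 subrr normr0 mulr_ge0.
  suff [c [cP ->]] : exists c, `|'D_'e_i F c| <= C /\
     F (h k + (y 0 i - z 0 i) *: 'e_i) - F (h k) = (y 0 i - z 0 i) * 'D_'e_i F c.
    rewrite normrM mulrC ler_pM //.
    by have := ler_coord_norm (y - z) i; rewrite !mxE.
  have Bc (t : R) : 0 <= t <= 1 -> `|x0 - (h k + (t * (y 0 i - z 0 i)) *: 'e_i)| < r.
    move=> tP; apply: Bmix => j; rewrite !mxE /=.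
    have [->|ji] := eqVneq j i.
      by exists t; split=> //; rewrite ltnn mulr1; ring.
    rewrite /= mulr0 addr0; case: ifP => _.
      by exists 1; rewrite lexx ler01; split=> //; ring.
    by exists 0; rewrite lexx ler01; split=> //; ring.
  have dline (s : R) : 0 <= s <= 1 -> is_derive s 1
     (fun t : R => F (h k + (t * (y 0 i - z 0 i)) *: 'e_i))
     ((y 0 i - z 0 i) * 'D_'e_i F (h k + (s * (y 0 i - z 0 i)) *: 'e_i)).
    move=> sP; pose g (t : R) := F (h k + t *: 'e_i).
    have dg : is_derive (s * (y 0 i - z 0 i)) 1 g
       ('D_'e_i F (h k + (s * (y 0 i - z 0 i)) *: 'e_i)).
      by apply: is_derive_line; have [] := dF _ (Bc _ sP) i.
    have dm : is_derive s 1 (fun t : R => t * (y 0 i - z 0 i)) (y 0 i - z 0 i).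
      have -> : (fun t : R => t * (y 0 i - z 0 i)) = (y 0 i - z 0 i) \*: id.
        by apply/funext => t /=; rewrite mulrC.
      by apply: is_derive_eq; rewrite [_ *: _]mulr1.
    have -> : (fun t : R => F (h k + (t * (y 0 i - z 0 i)) *: 'e_i)) =
      g \o (fun t : R => t * (y 0 i - z 0 i)) by [].
    split.
      apply/derivable1_diffP/differentiable_comp; apply/derivable1_diffP.
        by case: dm.
      by case: dg.
    rewrite -derive1E derive1_comp; last 2 first.
    - by case: dm.
    - by case: dg.
    by rewrite !derive1E; case: dm => _ ->; case: dg => _ ->; rewrite mulrC.
  have sE (s : R) : s \in `[0, 1] -> 0 <= s <= 1 by rewrite in_itv.
  have [||c cP E] := @MVT_segment R
    (fun t : R => F (h k + (t * (y 0 i - z 0 i)) *: 'e_i))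
    (fun s : R => (y 0 i - z 0 i) * 'D_'e_i F (h k + (s * (y 0 i - z 0 i)) *: 'e_i))
    0 1 ler01.
  - by move=> s /subset_itv_oo_cc st; apply: dline; exact: sE.
  - apply: continuous_in_subspaceT => s /set_mem /= /sE sP.
    apply: differentiable_continuous.
    by apply/derivable1_diffP; case: (dline s sP).
  exists (h k + (c * (y 0 i - z 0 i)) *: 'e_i); split.
    by have [] := dF _ (Bc _ (sE _ cP)) i.
  by move: E; rewrite mul1r mul0r scale0r addr0 subr0 mulr1.
have tel k : (k <= n)%N -> `|F (h k) - F (h 0%N)| <= k%:R * (C * `|y - z|).
  elim: k => [_|k IH kn]; first by rewrite subrr normr0 mul0r.
  rewrite -(subrKA (F (h k))) -natr1 mulrDl mul1r [leRHS]addrC.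
  by apply: le_trans (ler_normD _ _) _; rewrite lerD ?step // IH // ltnW.
by have := tel n (leqnn n); rewrite h0 hn mulrA.
Qed.

End LineDerivatives.

(** * Closure properties and differentials of functions of class C^k *)

Section SmoothCalculus.
Context {R : realType} {n : nat}.
Implicit Types (F H : 'rV[R]_n -> R) (x v w : 'rV[R]_n) (U : set 'rV[R]_n).

Lemma open_norm_ball U x : open U -> U x ->
  exists2 r : R, 0 < r & forall z : 'rV[R]_n, `|x - z| < r -> U z.
Proof.
move=> oU Ux; have /nbhs_ballP[r r0 rU] : nbhs x U by apply: open_nbhs_nbhs.
by exists r => // z zr; apply: rU; rewrite -ball_normE.
Qed.

Lemma near_open U x : open U -> U x -> \forall z \near x, U z.
Proof. by move=> oU Ux; apply: open_nbhs_nbhs. Qed.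

Lemma Ck_continuous k U F x : Ck_on k U F -> U x -> {for x, continuous F}.
Proof. by case: k => [|k] [cF _] Ux; apply: cF. Qed.

Lemma Ck_derivable k U F x i : Ck_on k.+1 U F -> U x -> derivable F x 'e_i.
Proof. by case=> _ /(_ i)[dF _] Ux; apply: dF. Qed.

Lemma Ck_derive k U F i : Ck_on k.+1 U F -> Ck_on k U ('D_'e_i F).
Proof. by case=> _ /(_ i)[_]. Qed.

Lemma Ck_ext k U F H : open U -> (forall x, U x -> F x = H x) ->
  Ck_on k U F -> Ck_on k U H.
Proof.
move=> oU; elim: k F H => [|k IH] F H FH [cF dF]; split=> //.
- move=> x Ux; have e : {near x, F =1 H}.
    by near=> z; apply: FH; near: z; exact: near_open.
  rewrite /prop_for /continuous_at -(FH _ Ux).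
  by apply: cvg_trans; [exact: near_eq_cvg e|exact: (cF _ Ux)].
- move=> x Ux; have e : {near x, F =1 H}.
    by near=> z; apply: FH; near: z; exact: near_open.
  rewrite /prop_for /continuous_at -(FH _ Ux).
  by apply: cvg_trans; [exact: near_eq_cvg e|exact: (cF _ Ux)].
- move=> i; have [dFi CFi] := dF i; split=> [x Ux|].
    have e : {near x, F =1 H}.
      by near=> z; apply: FH; near: z; exact: near_open.
    exact: near_eq_derivable (dFi _ Ux).
  apply: IH CFi => x Ux; apply: near_eq_derive.
  by near=> z; apply: FH; near: z; exact: near_open.
Unshelve. all: by end_near. Qed.

Lemma Ck_subset k U U' F : U' `<=` U -> Ck_on k U F -> Ck_on k U' F.
Proof.
move=> sU; elim: k F => [|k IH] F [cF dF]; split=> //.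
- by move=> x /sU; apply: cF.
- by move=> x /sU; apply: cF.
- by move=> i; have [dFi CFi] := dF i; split; [move=> x /sU; apply: dFi|exact: IH].
Qed.

Lemma Ck_pred k U F : Ck_on k.+1 U F -> Ck_on k U F.
Proof.
elim: k F => [|k IH] F [cF dF]; split=> // i; have [dFi CFi] := dF i.
by split=> //; apply: IH.
Qed.

Lemma Ck_cst k U (c : R) : Ck_on k U (fun=> c).
Proof.
elim: k c => [|k IH] c; split=> //; try by move=> x _; exact: cst_continuous.
move=> i; split=> [x _|]; first exact: derivable_cst.
have -> : 'D_'e_i (fun _ : 'rV[R]_n => c) = (fun _ : 'rV[R]_n => 0).
  by apply: boolp.funext => x; rewrite derive_cst.
exact: IH.
Qed.

Lemma CkD k U F H : open U -> Ck_on k U F -> Ck_on k U H ->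
  Ck_on k U (fun x => F x + H x).
Proof.
move=> oU; elim: k F H => [|k IH] F H CF CH; split=> //.
- by move=> x Ux; exact: (cvgD (Ck_continuous CF Ux) (Ck_continuous CH Ux)).
- by move=> x Ux; exact: (cvgD (Ck_continuous CF Ux) (Ck_continuous CH Ux)).
- move=> i; split=> [x Ux|].
    by exact: (derivableD (Ck_derivable CF Ux) (Ck_derivable CH Ux)).
  apply: (Ck_ext oU _ (IH _ _ (Ck_derive i CF) (Ck_derive i CH))) => x Ux /=.
  by rewrite -(deriveD (Ck_derivable CF Ux) (Ck_derivable CH Ux)).
Qed.

Lemma CkM k U F H : open U -> Ck_on k U F -> Ck_on k U H ->
  Ck_on k U (fun x => F x * H x).
Proof.
move=> oU; elim: k F H => [|k IH] F H CF CH; split=> //.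
- by move=> x Ux; exact: (cvgM (Ck_continuous CF Ux) (Ck_continuous CH Ux)).
- by move=> x Ux; exact: (cvgM (Ck_continuous CF Ux) (Ck_continuous CH Ux)).
- move=> i; split=> [x Ux|].
    by exact: (derivableM (Ck_derivable CF Ux) (Ck_derivable CH Ux)).
  have C := CkD oU (IH _ _ (Ck_pred CF) (Ck_derive i CH)) (IH _ _ (Ck_pred CH) (Ck_derive i CF)).
  apply: (Ck_ext oU _ C) => x Ux /=.
  exact: (esym (deriveM (Ck_derivable CF Ux) (Ck_derivable CH Ux))).
Qed.

Lemma CkN k U F : open U -> Ck_on k U F -> Ck_on k U (fun x => - F x).
Proof.
move=> oU CF; apply: (Ck_ext oU _ (CkM oU (Ck_cst k U (-1)) CF)) => x _ /=.
by rewrite mulN1r.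
Qed.

Lemma CkB k U F H : open U -> Ck_on k U F -> Ck_on k U H ->
  Ck_on k U (fun x => F x - H x).
Proof. by move=> oU CF CH; apply: CkD => //; exact: CkN. Qed.

Lemma Ck_sum k U (I : Type) (r : seq I) (P : pred I) (F : I -> 'rV[R]_n -> R) :
  open U -> (forall i, P i -> Ck_on k U (F i)) ->
  Ck_on k U (fun x => \sum_(i <- r | P i) F i x).
Proof.
move=> oU CF; elim: r => [|i r IH].
  by apply: (Ck_ext oU _ (Ck_cst k U 0)) => x _; rewrite big_nil.
have [Pi|Pi] := boolP (P i).
  apply: (Ck_ext oU _ (CkD oU (CF _ Pi) IH)) => x _.
  by rewrite big_cons Pi.
by apply: (Ck_ext oU _ IH) => x _; rewrite big_cons (negbTE Pi).
Qed.

Lemma Ck_prod k U (I : Type) (r : seq I) (P : pred I) (F : I -> 'rV[R]_n -> R) :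
  open U -> (forall i, P i -> Ck_on k U (F i)) ->
  Ck_on k U (fun x => \prod_(i <- r | P i) F i x).
Proof.
move=> oU CF; elim: r => [|i r IH].
  by apply: (Ck_ext oU _ (Ck_cst k U 1)) => x _; rewrite big_nil.
have [Pi|Pi] := boolP (P i).
  apply: (Ck_ext oU _ (CkM oU (CF _ Pi) IH)) => x _.
  by rewrite big_cons Pi.
by apply: (Ck_ext oU _ IH) => x _; rewrite big_cons (negbTE Pi).
Qed.

Lemma is_derive_coord x v j : is_derive x v (fun y : 'rV[R]_n => y 0 j) (v 0 j).
Proof.
have d : derivable (@idfun 'rV[R]_n) x v by exact: derivable_id.
split; first exact: (derivable_mxP _ _ _).1 d 0 j.
by have := derive_mx d; rewrite derive_id => /rowP /(_ j); rewrite mxE.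
Qed.

Lemma Ck_coord k U j : open U -> Ck_on k U (fun x => x 0 j).
Proof.
move=> oU; have cj x : U x -> {for x, continuous (fun x : 'rV[R]_n => x 0 j)}.
  by move=> _; apply: coord_continuous.
case: k => [|k]; split=> // i; split=> [x _|].
  by case: (is_derive_coord x 'e_i j).
apply: (Ck_ext oU _ (Ck_cst k U ('e_i 0 j))) => x _.
by case: (is_derive_coord x 'e_i j) => _ ->.
Qed.

Lemma CkV k U F : open U -> (forall x, U x -> F x != 0) -> Ck_on k U F ->
  Ck_on k U (fun x => (F x)^-1).
Proof.
move=> oU F0; elim: k F F0 => [|k IH] F F0 CF; split=> //.
- by move=> x Ux; exact: (cvgV (F0 _ Ux) (Ck_continuous CF Ux)).
- by move=> x Ux; exact: (cvgV (F0 _ Ux) (Ck_continuous CF Ux)).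
- move=> i; split=> [x Ux|].
    by exact: (derivableV (F0 _ Ux) (Ck_derivable CF Ux)).
  have C := IH _ F0 (Ck_pred CF).
  apply: (Ck_ext oU _ (CkM oU (CkN oU (CkM oU C C)) (Ck_derive i CF))) => x Ux /=.
  rewrite -[RHS]/('D_'e_i (fun y => (F y)^-1) x) deriveV ?F0 //; last first.
    exact: (Ck_derivable CF Ux).
  by rewrite -exprVn expr2.
Qed.

Lemma Ck_det k U m (M : 'rV[R]_n -> 'M[R]_m) : open U ->
  (forall i j, Ck_on k U (fun x => M x i j)) -> Ck_on k U (fun x => \det (M x)).
Proof.
move=> oU CM; apply: Ck_sum => // s _; apply: CkM => //; first exact: Ck_cst.
exact: Ck_prod.
Qed.

Lemma Ck_invmx k U m (M : 'rV[R]_n -> 'M[R]_m) : open U ->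
  (forall x, U x -> M x \in unitmx) ->
  (forall i j, Ck_on k U (fun x => M x i j)) ->
  forall i j, Ck_on k U (fun x => invmx (M x) i j).
Proof.
move=> oU uM CM i j.
have C : Ck_on k U (fun x => (\det (M x))^-1 * ((-1) ^+ (j + i) *
    \det (row' j (col' i (M x))))).
  apply: CkM => //.
    apply: CkV => //; last exact: Ck_det.
    by move=> x /uM; rewrite unitmxE unitfE.
  apply: CkM => //; first exact: Ck_cst.
  apply: Ck_det => // i' j'.
  by apply: Ck_ext (CM (lift j i') (lift i j')) => // x _; rewrite !mxE.
apply: (Ck_ext oU _ C) => x /uM uMx.
by rewrite /invmx uMx !mxE.
Qed.

(** Declared linear below, so that it can serve as the differential in [Ck1_differentiable]. *)
Definition dot (c : 'cV[R]_n) v : R := (v *m c) 0 0.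

Fact dot_is_linear c : linear (dot c).
Proof. by move=> a u v; rewrite /dot mulmxDl -scalemxAl !mxE. Qed.

HB.instance Definition _ c :=
  GRing.isLinear.Build R 'rV[R]_n R _ (dot c) (dot_is_linear c).

Lemma continuous_dot c : continuous (dot c).
Proof.
have -> : dot c = (fun v => \sum_i v 0 i * c i 0).
  by apply/funext => v; rewrite /dot mxE.
move=> x; apply: (@Ck_continuous 0 setT) => //.
apply: Ck_sum => [|i _]; first exact: openT.
by apply: CkM; [exact: openT|apply: Ck_coord; exact: openT|exact: Ck_cst].
Qed.

Lemma is_derive_dot c x v : is_derive x v (dot c) (dot c v).
Proof.
have -> : dot c = fun y => (y *m c) 0 0 by [].
have d : is_derive x v (fun y : 'rV[R]_n => \sum_j y 0 j * c j 0)
   (\sum_j v 0 j * c j 0).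
  have -> : (fun y : 'rV[R]_n => \sum_j y 0 j * c j 0) =
     \sum_j (fun y : 'rV[R]_n => y 0 j * c j 0).
    by apply: funext => y; rewrite fct_sumE.
  apply: is_derive_sum => j.
  have := is_derive_coord x v j => dj.
  have -> : (fun y : 'rV[R]_n => y 0 j * c j 0) = c j 0 \*: (fun y : 'rV[R]_n => y 0 j).
    by apply: funext => y /=; rewrite mulrC.
  by apply: is_derive_eq; rewrite mulrC.
have -> : (fun y : 'rV[R]_n => (y *m c) 0 0) = fun y => \sum_j y 0 j * c j 0.
  by apply: funext => y; rewrite mxE.
by rewrite /dot mxE.
Qed.

Lemma Ck_dot k U c : open U -> Ck_on k U (dot c).
Proof.
move=> oU; have C : Ck_on k U (fun y => \sum_j y 0 j * c j 0).
  by apply: Ck_sum => // j _; apply: CkM => //; [exact: Ck_coord|exact: Ck_cst].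
by apply: Ck_ext C => // x _; rewrite /dot mxE.
Qed.

Lemma near_norm_ball x (P : 'rV[R]_n -> Prop) : (\forall z \near x, P z) <->
  exists2 r : R, 0 < r & forall z : 'rV[R]_n, `|x - z| < r -> P z.
Proof.
split=> [/nbhs_ballP[r r0 rP]|[r r0 rP]].
  by exists r => // z zr; apply: rP; rewrite -ball_normE.
by apply/nbhs_ballP; exists r => // z; rewrite -ball_normE; exact: rP.
Qed.

Lemma open_ball_norm x (r : R) : open [set z : 'rV[R]_n | `|x - z| < r].
Proof.
rewrite openE => z /= zr; apply/near_norm_ball; exists (r - `|x - z|).
  by rewrite subr_gt0.
by move=> w; rewrite ltrBrDl; apply: le_lt_trans; exact: ler_distD.
Qed.

Lemma near_forall_ord m x (P : 'rV[R]_n -> 'I_m -> Prop) :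
  (forall i, \forall z \near x, P z i) -> \forall z \near x, forall i, P z i.
Proof. exact: (@filter_forall _ _ (fun i z => P z i) _ (nbhs_filter x)). Qed.

(** Subtracting the linear form of the partial derivatives at [x] leaves a function [g] whose
    partials vanish at [x] and, being continuous, are small nearby; [lipschitz_of_partials] then
    makes the increment of [g] an o(h). *)
Lemma Ck1_differentiable U F x : open U -> Ck_on 1 U F -> U x ->
  differentiable F x.
Proof.
move=> oU CF Ux; pose c : 'cV[R]_n := \col_i 'D_'e_i F x.
have E : (F : 'rV[R]_n -> R^o) \o shift x =
    cst (F x : R^o) + (dot c : 'rV[R]_n -> R^o) +o_ (0 : 'rV[R]_n) id.
  apply/eqaddoP => e e0; pose g z := F z - dot c z.
  have Cg : Ck_on 1 U g by exact: (CkB oU CF (Ck_dot 1 c oU)).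
  (* Dividing by n + 1 rather than n covers n = 0; only n [e1] <= [e] is needed. *)
  pose e1 := e / n.+1%:R; have e10 : 0 < e1 by rewrite divr_gt0 ?ltr0Sn.
  have [r r0 rP] : exists2 r : R, 0 < r & forall z : 'rV[R]_n, `|x - z| < r ->
      forall i : 'I_n, derivable g z 'e_i /\ `|'D_'e_i g z| <= e1.
    apply/near_norm_ball.
    near=> z => i; split.
      by apply: (Ck_derivable Cg); near: z; exact: near_open.
    move: i; near: z; apply: filter_forall => i.
    have Di0 : 'D_'e_i g x = 0.
      have dd := is_derive_dot c x 'e_i.
      have := deriveB (Ck_derivable CF Ux) (@ex_derive _ _ _ _ _ _ _ dd).
      move=> /= ->; rewrite derive_val /dot -rowE !mxE; exact: subrr.
    have := Ck_continuous (Ck_derive i Cg) Ux.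
    move=> /cvgrPdist_lt /(_ _ e10); apply: filterS => z.
    by rewrite Di0 sub0r normrN => /ltW.
  near=> h; have hr : `|h| < r.
    near: h; apply/near_norm_ball; exists r => // z.
    by rewrite sub0r normrN.
  have := lipschitz_of_partials (ltW e10) rP (_ : `|x - (h + x)| < r) (_ : `|x - x| < r).
  rewrite subrr normr0 opprD addrCA subrr addr0 normrN => /(_ hr r0).
  rewrite addrK /g linearD /= => H.
  apply: le_trans (_ : _ <= n%:R * e1 * `|h|) _.
    apply: le_trans H; rewrite le_eqVlt; apply/orP; left; apply/eqP.
    congr `|_|; rewrite -[LHS]/(F (h + x) - (F x + dot c h)); ring.
  rewrite ler_wpM2r // /e1 mulrCA ger_pMr // ler_pdivrMr ?ltr0Sn // mul1r.
  by rewrite ler_nat.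
apply/diff_locallyP; have D := diff_unique (@continuous_dot c) E.
by rewrite D; split => //; exact: continuous_dot.
Unshelve. all: by end_near. Qed.

Lemma differentiable_derive_sumE F x v : differentiable F x ->
  'D_v F x = \sum_i v 0 i * 'D_'e_i F x.
Proof.
move=> dF; rewrite (deriveE _ dF) [in LHS](row_sum_delta v) linear_sum.
by apply: eq_bigr => i _; rewrite linearZ (deriveE _ dF).
Qed.

Lemma derive_sumE U F x v : open U -> Ck_on 1 U F -> U x ->
  'D_v F x = \sum_i v 0 i * 'D_'e_i F x.
Proof.
by move=> oU CF Ux; apply: differentiable_derive_sumE; exact: Ck1_differentiable CF Ux.
Qed.

Lemma Ck1_derivable U F x v : open U -> Ck_on 1 U F -> U x -> derivable F x v.
Proof. by move=> oU CF Ux; apply: diff_derivable; exact: Ck1_differentiable CF Ux. Qed.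

End SmoothCalculus.

(** * Chain rule for maps *)

Section Composition.
Context {R : realType} {n m : nat}.
Implicit Types (F : 'rV[R]_m -> R) (Phi : 'rV[R]_n -> 'rV[R]_m).
Implicit Types (x v : 'rV[R]_n) (U : set 'rV[R]_n) (W : set 'rV[R]_m).

Lemma derive_along_line (V : normedModType R) (Phi : 'rV[R]_n -> V) x v :
  'D_v Phi x = 'D_1 (fun h : R => Phi (h *: v + x)) 0.
Proof.
have E : (fun h : R => h^-1 *: ((Phi \o shift x) (h *: v) - Phi x)) =
  (fun h : R => h^-1 *: (((fun h : R => Phi (h *: v + x)) \o shift 0) (h *: 1)
     - Phi (0 *: v + x))).
  by apply: funext => h /=; rewrite [h *: 1]mulr1 addr0 scale0r add0r.
by rewrite /derive E.
Qed.

Lemma continuous_rV (T : topologicalType) (Phi : T -> 'rV[R]_m) (x : T) :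
  (forall j, {for x, continuous (fun y => Phi y 0 j)}) ->
  {for x, continuous Phi}.
Proof.
move=> cP; apply/cvgrPdist_le => e e0; near=> y.
apply: rV_norm_le; first exact: ltW.
near: y; apply: filter_forall => j.
have /cvgrPdist_le /(_ _ e0) := cP j.
by apply: filterS => y; rewrite !mxE.
Unshelve. all: by end_near. Qed.

Lemma continuous_norm_ball (u : 'rV[R]_n -> R) x :
  (forall e, 0 < e -> exists2 r : R, 0 < r &
     forall z, `|x - z| < r -> `|u x - u z| <= e) -> {for x, continuous u}.
Proof.
move=> H; have FF : Filter (nbhs x) by exact: nbhs_filter.
have [_ P] := @cvgrPdist_le _ _ _ _ FF u (u x).
by apply: P => e /H rP; apply/near_norm_ball.
Qed.

(** Restricting [Phi] to a line reduces this to the chain rule for a curve, so derivability of [Phi]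
    in the one direction [v] is enough. *)
Lemma is_derive_comp F Phi x v : differentiable F (Phi x) ->
  (forall j, derivable (fun y => Phi y 0 j) x v) ->
  is_derive x v (F \o Phi)
    (\sum_j 'D_v (fun y => Phi y 0 j) x * 'D_'e_j F (Phi x)).
Proof.
move=> dF dPhi.
have dP : derivable Phi x v by apply/derivable_mxP => i j; rewrite ord1.
pose psi (h : R) := Phi (h *: v + x).
have dpsi : differentiable psi 0.
  by apply/derivable1_diffP; exact: (derivable1P _ _ _).1 dP.
have psi0 : psi 0 = Phi x by rewrite /psi scale0r add0r.
have dFpsi : differentiable F (psi 0) by rewrite psi0.
have dc : differentiable (F \o psi) 0 by exact: differentiable_comp.
split; first by apply/derivable1P; apply/derivable1_diffP.
rewrite derive_along_line -[fun h : R => _]/(F \o psi) deriveE // diff_comp //=.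
have -> : 'd psi 0 1 = 'D_v Phi x by rewrite -(deriveE _ dpsi) [RHS]derive_along_line.
rewrite psi0 (derive_mx dP).
set w := (\matrix_(i, j) _).
rewrite [in LHS](row_sum_delta w) linear_sum /=; apply: eq_bigr => j _.
by rewrite linearZ /= -(deriveE _ dF) /w mxE.
Qed.

Lemma Ck_comp k U W F Phi : open U -> open W -> (forall x, U x -> W (Phi x)) ->
  (forall j, Ck_on k U (fun x => Phi x 0 j)) -> Ck_on k W F ->
  Ck_on k U (F \o Phi).
Proof.
move=> oU oW UW; elim: k F => [|k IH] F CPhi CF.
  split=> // x Ux; apply: continuous_comp; last first.
    exact: Ck_continuous CF (UW _ Ux).
  by apply: continuous_rV => j; exact: Ck_continuous (CPhi j) Ux.
split=> [x Ux|i].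
  apply: continuous_comp; last exact: Ck_continuous CF (UW _ Ux).
  by apply: continuous_rV => j; exact: Ck_continuous (CPhi j) Ux.
have CF1 : Ck_on 1 W F.
  by elim: k CF {IH CPhi} => // k IH /Ck_pred.
have D x : U x -> is_derive x 'e_i (F \o Phi)
    (\sum_j 'D_'e_i (fun y => Phi y 0 j) x * 'D_'e_j F (Phi x)).
  move=> Ux; apply: is_derive_comp => [|j].
    exact: Ck1_differentiable (UW _ Ux).
  exact: Ck_derivable (CPhi j) Ux.
split=> [x /D[]//|].
have C : Ck_on k U (fun x =>
    \sum_j 'D_'e_i (fun y => Phi y 0 j) x * ('D_'e_j F \o Phi) x).
  apply: Ck_sum => // j _; apply: CkM => //; first exact: Ck_derive (CPhi j).
  by apply: IH; [move=> l; exact: Ck_pred (CPhi l)|exact: Ck_derive CF].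
by apply: (Ck_ext oU _ C) => x /D[_ ->].
Qed.

End Composition.

(** * Composition with a function of one variable; symmetry of second derivatives *)

Section ScalarComposition.
Context {R : realType} {n : nat}.
Implicit Types (B : R -> R) (u : 'rV[R]_n -> R) (x v : 'rV[R]_n).

Lemma is_derive_comp1 B u x v : derivable B (u x) 1 -> derivable u x v ->
  is_derive x v (B \o u) (derive1 B (u x) * 'D_v u x).
Proof.
move=> dB du; pose psi (h : R) := u (h *: v + x).
have dpsi : derivable psi 0 1 by exact: (derivable1P _ _ _).1 du.
have psi0 : psi 0 = u x by rewrite /psi scale0r add0r.
have dB' : derivable B (psi 0) 1 by rewrite psi0.
have dc : differentiable (B \o psi) 0.
  have [d1 _] := derivable1_diffP psi 0; have [d2 _] := derivable1_diffP B (psi 0).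
  exact: differentiable_comp (d1 dpsi) (d2 dB').
split; first by apply/derivable1P; apply/derivable1_diffP.
have Dpsi : 'D_v u x = 'D_1 psi 0 by exact: derive_along_line.
rewrite (derive_along_line (B \o u)) Dpsi -psi0 -!derive1E.
exact: (derive1_comp dpsi dB').
Qed.

Lemma smooth_comp1 (W : set R) (U : set 'rV[R]_n) B u : open U ->
  (forall k t, W t -> derivable (derive1n k B) t 1) ->
  (forall x, U x -> W (u x)) -> smooth_on U u -> smooth_on U (B \o u).
Proof.
move=> oU dB UW su k.
(* All derivatives of [B] are treated at once, since each differentiation replaces the j-th
   derivative by the next. *)
suff H j : Ck_on k U (derive1n j B \o u) by exact: (H 0%N).
elim: k j => [|k IH] j.
  split=> // x Ux; apply: continuous_comp; first exact: (Ck_continuous (su 0%N) Ux).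
  by apply: differentiable_continuous; apply/derivable1_diffP/dB/UW.
have D x i : U x -> is_derive x 'e_i (derive1n j B \o u)
     (derive1n j.+1 B (u x) * 'D_'e_i u x).
  move=> Ux; rewrite derive1nS; apply: is_derive_comp1; first exact/dB/UW.
  exact: Ck_derivable (su 1%N) Ux.
split=> [x Ux|i].
  apply: continuous_comp; first exact: (Ck_continuous (su 0%N) Ux).
  by apply: differentiable_continuous; apply/derivable1_diffP/dB/UW.
split=> [x /(D _ i)[]//|].
apply: (Ck_ext oU _ (CkM oU (IH j.+1) (Ck_derive i (su k.+1)))) => x /(D _ i)[_ ->] //.
Qed.

Lemma smooth_derive (U : set 'rV[R]_n) u i :
  smooth_on U u -> smooth_on U ('D_'e_i u).
Proof. by move=> su k; exact: Ck_derive (su k.+1). Qed.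

Lemma derive_shiftE u w x v :
  (derivable (fun y => u (y + w)) x v <-> derivable u (x + w) v) /\
  'D_v (fun y => u (y + w)) x = 'D_v u (x + w).
Proof.
have E : (fun h : R => h^-1 *: (((fun y => u (y + w)) \o shift x) (h *: v)
            - u (x + w))) =
         (fun h : R => h^-1 *: ((u \o shift (x + w)) (h *: v) - u (x + w))).
  by apply: funext => h /=; rewrite addrA.
by rewrite /derivable /derive E.
Qed.

Lemma norm_delta_le1 i : `|'e_i : 'rV[R]_n| <= 1.
Proof.
apply: rV_norm_le => // j; rewrite mxE eqxx /=.
by case: (j == i); rewrite ?normr1 ?normr0.
Qed.

(** The mean value theorem, used in direction i and then in direction j, turns the second difference
    into t^2 times the mixed derivative at a point of a small square, where continuity keeps it
    within [e] of its value at [x]. *)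
Lemma second_difference (U : set 'rV[R]_n) u x i j (e : R) :
  open U -> Ck_on 2 U u -> U x -> 0 < e ->
  exists2 r : R, 0 < r & forall t : R, 0 < t -> t < r ->
    `|(u (x + t *: 'e_i + t *: 'e_j) - u (x + t *: 'e_i)) - (u (x + t *: 'e_j) - u x)
      - t * t * 'D_'e_j ('D_'e_i u) x| <= t * t * e.
Proof.
move=> oU Cu Ux e0; set A := 'D_'e_j ('D_'e_i u) x.
have [r0 r00 r0P] : exists2 r : R, 0 < r & forall z : 'rV[R]_n, `|x - z| < r ->
    U z /\ `|'D_'e_j ('D_'e_i u) z - A| <= e.
  apply/near_norm_ball; near=> z; split.
    by near: z; exact: near_open.
  rewrite distrC; near: z.
  have := Ck_continuous (Ck_derive j (Ck_derive i Cu)) Ux.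
  by move=> /cvgrPdist_le /(_ _ e0).
exists (r0 / 2); first by rewrite divr_gt0.
move=> t t0 tr.
have inU a b : `|a| <= t -> `|b| <= t ->
    `|x - (x + a *: 'e_i + b *: 'e_j)| < r0.
  move=> at_ bt; rewrite -addrA opprD addrA subrr add0r normrN.
  apply: le_lt_trans (ler_normD _ _) _; rewrite !normrZ.
  have := ler_pM (normr_ge0 a) (normr_ge0 _) at_ (norm_delta_le1 i).
  have := ler_pM (normr_ge0 b) (normr_ge0 _) bt (norm_delta_le1 j).
  lra.
have tt : `|t| = t by rewrite gtr0_norm.
pose g y := u (y + t *: 'e_j) - u y.
have dg s : `|s| <= t -> is_derive (x + s *: 'e_i) 'e_i g
    ('D_'e_i u (x + s *: 'e_i + t *: 'e_j) - 'D_'e_i u (x + s *: 'e_i)).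
  move=> st.
  have U1 : U (x + s *: 'e_i + t *: 'e_j).
    have tt' : `|t| <= t by rewrite tt.
    by case: (r0P _ (inU _ _ st tt')).
  have U2 : U (x + s *: 'e_i).
    have := inU s 0 st; rewrite normr0 scale0r addr0 => /(_ (ltW t0)).
    by case/r0P.
  have [S1 S2] := derive_shiftE u (t *: 'e_j) (x + s *: 'e_i) 'e_i.
  have d1 := S1.2 (Ck_derivable Cu U1).
  split; first exact: (derivableB d1 (Ck_derivable Cu U2)).
  by rewrite [LHS](deriveB d1 (Ck_derivable Cu U2)) S2.
have [|c ct E1] := @MVT_line R n g x 'e_i t.
  by rewrite tt => s /dg[].
rewrite tt in ct.
have [|c' ct' E2] := @MVT_line R n ('D_'e_i u) (x + c *: 'e_i) 'e_j t.
  rewrite tt => s st; apply: Ck_derivable (Ck_derive i Cu) _.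
  by have [] := r0P _ (inU _ _ ct st).
rewrite tt in ct'.
rewrite -[_ - _ - (_ - _)]/(g (x + t *: 'e_i) - g x) E1.
have [_ ->] := dg _ ct; rewrite E2 mulrA -mulrBr normrM (ger0_norm (mulr_ge0 (ltW t0) (ltW t0))).
rewrite ler_pM2l ?mulr_gt0 //.
by have [] := r0P _ (inU _ _ ct ct').
Unshelve. all: by end_near. Qed.

(* Both mixed partials are limits of the same second difference quotient.     *)
Lemma derive_comm (U : set 'rV[R]_n) u x i j : open U -> Ck_on 2 U u -> U x ->
  'D_'e_i ('D_'e_j u) x = 'D_'e_j ('D_'e_i u) x.
Proof.
move=> oU Cu Ux; set A := LHS; set B := RHS.
apply/eqP; rewrite -subr_eq0 -normr_eq0; apply/negPn/negP => AB.
(* With this tolerance the two estimates add up to |A - B| <= |A - B| / 2. *)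
have e0 : 0 < `|A - B| / 4 by rewrite divr_gt0 // lt_neqAle eq_sym AB /=; exact: normr_ge0.
have [r1 r10 H1] := second_difference i j oU Cu Ux e0.
have [r2 r20 H2] := second_difference j i oU Cu Ux e0.
pose t := Num.min r1 r2 / 2.
have m0 : 0 < Num.min r1 r2 by rewrite lt_min r10 r20.
have t0 : 0 < t by rewrite divr_gt0.
have tm : t < Num.min r1 r2 by rewrite /t ltr_pdivrMr // ltr_pMr // ltr1n.
move: tm; rewrite lt_min => /andP[tr1 tr2].
have {}H1 := H1 _ t0 tr1.
have {}H2 := H2 _ t0 tr2.
rewrite -/A -/B in H1 H2.
have E : x + t *: 'e_i + t *: 'e_j = x + t *: 'e_j + t *: 'e_i by rewrite addrAC.
rewrite E in H1.
have T0 : 0 < t * t by rewrite mulr_gt0.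
have : t * t * `|A - B| <= t * t * (`|A - B| / 4) + t * t * (`|A - B| / 4).
  rewrite -[X in X * `|A - B| <= _](ger0_norm (ltW T0)) -normrM.
  apply: le_trans (lerD H1 H2); apply: le_trans (ler_normB _ _).
  by rewrite le_eqVlt; apply/orP; left; apply/eqP; congr `|_|; ring.
rewrite -mulrDr (ler_pM2l T0) => AB2; clear H1 H2.
by move: e0 AB2; generalize (`|A - B|) => q q0 qq; lra.
Qed.

End ScalarComposition.

(** * The inverse function theorem *)

Section InverseFunction.
Context {R : realType} {n : nat}.
Implicit Types (x y z v : 'rV[R]_n).

Lemma Ck1_approx (U : set 'rV[R]_n) (F : 'rV[R]_n -> R) x (e : R) :
  open U -> Ck_on 1 U F -> U x -> 0 < e ->
  exists2 r : R, 0 < r & forall h : 'rV[R]_n, `|h| < r ->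
    `|F (x + h) - F x - \sum_i h 0 i * 'D_'e_i F x| <= e * `|h|.
Proof.
move=> oU CF Ux e0; have dF := Ck1_differentiable oU CF Ux.
have /eqaddoP /(_ _ e0) := diff_locally dF.
move=> /near_norm_ball[r r0 rP]; exists r => // h hr.
have := rP h; rewrite sub0r normrN => /(_ hr).
apply: le_trans; rewrite le_eqVlt; apply/orP; left; apply/eqP; congr `|_|.
rewrite -[RHS]/(F (h + x) - (F x + 'd F x h)) -(deriveE _ dF).
by rewrite (derive_sumE _ oU CF Ux) [h + x]addrC opprD addrA.
Qed.

Variables (U : set 'rV[R]_n) (psi : 'rV[R]_n -> 'rV[R]_n) (x0 : 'rV[R]_n).
Hypotheses (oU : open U) (Ux0 : U x0).
Hypothesis spsi : forall j, smooth_on U (fun x => psi x 0 j).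

Definition partials_mx x : 'M[R]_n := \matrix_(i, j) 'D_'e_i (fun y => psi y 0 j) x.

Hypothesis dpsi0 : partials_mx x0 = 1%:M.

Let chi x := x - psi x.

(** The partial derivatives of [chi] vanish at [x0], so [chi] contracts by 1/2 on a small ball; the
    Jacobian determinant, continuous and equal to 1 at [x0], stays nonzero there. *)
Lemma inverse_function_ball : exists2 r : R, 0 < r &
  [/\ forall z, `|x0 - z| < r -> U z,
      forall z, `|x0 - z| < r -> partials_mx z \in unitmx &
      forall y z, `|x0 - y| < r -> `|x0 - z| < r ->
        `|chi y - chi z| <= 2^-1 * `|y - z| ].
Proof.
pose e : R := (2 * n.+1%:R)^-1; have e0 : 0 < e by rewrite invr_gt0 mulr_gt0.
pose F j x := x 0 j - psi x 0 j.
have CF j k : Ck_on k U (F j).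
  by apply: (CkB oU) (spsi _ _); exact: Ck_coord.
have C1 j : Ck_on 1 U (fun x => x 0 j) by exact: Ck_coord.
have [r r0 rP] : exists2 r : R, 0 < r & forall z, `|x0 - z| < r ->
    [/\ U z, partials_mx z \in unitmx & forall j i : 'I_n, `|'D_'e_i (F j) z| <= e].
  apply/near_norm_ball; near=> z; split.
  - by near: z; exact: near_open.
  - rewrite unitmxE unitfE; near: z.
    have C : Ck_on 0 U (fun x => \det (partials_mx x)).
      apply: Ck_det => // i j.
      apply: (Ck_ext oU _ (Ck_derive i (spsi j 1%N))) => x _.
      by rewrite mxE.
    have := Ck_continuous C Ux0; rewrite /prop_for /continuous_at dpsi0 det1.
    move=> /cvgrPdist_lt /(_ _ ltr01); apply: filterS => z H.
    by apply: contraTneq H => ->; rewrite subr0 normr1 ltxx.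
  - near: z; apply: near_forall_ord => j.
    have : \forall z \near x0, forall i : 'I_n, `|'D_'e_i (F j) z| <= e.
      apply: near_forall_ord => i.
      have := Ck_continuous (Ck_derive i (CF j 1%N)) Ux0.
      move=> /cvgrPdist_lt /(_ _ e0); apply: filterS => z.
      have -> : 'D_'e_i (F j) x0 = 0.
        have dx := is_derive_coord x0 'e_i j.
        have := deriveB (Ck_derivable (C1 j) Ux0) (Ck_derivable (spsi j 1%N) Ux0).
        move=> /= ->; rewrite derive_val.
        have /matrixP /(_ i j) := dpsi0; rewrite !mxE => ->.
        by rewrite eqxx /= eq_sym subrr.
      by rewrite sub0r normrN => /ltW.
    by [].
exists r => //; split=> [z /rP[]//|z /rP[]//|y z yr zr].
apply: rV_norm_le => [|j]; first by rewrite mulr_ge0 ?invr_ge0.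
have P w : `|x0 - w| < r -> forall i : 'I_n, derivable (F j) w 'e_i /\ `|'D_'e_i (F j) w| <= e.
  move=> /rP[Uw _ Dw] i; split; last exact: Dw.
  exact: Ck_derivable (CF j 1%N) Uw.
have := lipschitz_of_partials (ltW e0) P yr zr.
rewrite !mxE => H; apply: le_trans H _.
rewrite ler_wpM2r // /e invfM mulrCA ger_pMr ?invr_gt0 // ler_pdivrMr // mul1r.
by rewrite ler_nat.
Unshelve. all: by end_near. Qed.

(** Since [chi] contracts, [psi] expands distances by at least 1/2, which gives injectivity.
    Surjectivity onto a ball follows by minimising the residual |psi x - y| over a compact ball. The
    partials of the inverse are the entries of the inverse Jacobian, whence its smoothness. *)
Theorem inverse_function : exists (A W : set 'rV[R]_n) (phi : 'rV[R]_n -> 'rV[R]_n),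
  [/\ [/\ open A, A x0, A `<=` U & open W],
      forall x, A x -> W (psi x) /\ phi (psi x) = x,
      forall y, W y -> A (phi y) /\ psi (phi y) = y &
      forall j, smooth_on W (fun y => phi y 0 j) ].
Proof.
have [r r0 [rU rJ rchi]] := inverse_function_ball.
have expand y z : `|x0 - y| < r -> `|x0 - z| < r ->
    `|y - z| <= 2 * `|psi y - psi z|.
  move=> yr zr; have H := rchi _ _ yr zr.
  have E : y - z = (psi y - psi z) + (chi y - chi z).
    by rewrite /chi; apply/rowP => j; rewrite !mxE; ring.
  have := ler_normD (psi y - psi z) (chi y - chi z); rewrite -E; lra.
have cpsi x : U x -> {for x, continuous psi}.
  by move=> Ux; apply: continuous_rV => j; exact: (Ck_continuous (spsi j 0%N) Ux).
have onto y : `|psi x0 - y| < r / 4 -> exists2 x, `|x0 - x| < r & psi x = y.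
  move=> yr; pose K := [set x | `|x0 - x| <= r / 2].
  have K0 : K x0 by rewrite /K /= subrr normr0 divr_ge0 // ltW.
  have Kr x : K x -> `|x0 - x| < r by rewrite /K /= => Kx; lra.
  have cK : compact K.
    apply: bounded_closed_compact.
      exists (`|x0| + r / 2); split=> [|M /ltW MM x Kx]; first exact: num_real.
      apply: le_trans MM.
      have -> : x = x0 - (x0 - x) by rewrite opprB addrC subrK.
      by apply: le_trans (ler_normB _ _) _; rewrite lerD2l.
    have -> : K = closed_ball_ Num.Def.normr x0 (r / 2) by [].
    exact: closed_closed_ball_.
  pose h x := `|psi x - y|.
  have ch : {within K, continuous h}.
    apply: continuous_in_subspaceT => x /set_mem /Kr /rU Ux.
    apply: (@continuous_comp _ _ _ (fun x => psi x - y) Num.Def.normr).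
      exact: (cvgB (cpsi _ Ux) (cvg_cst y)).
    exact: norm_continuous.
  have [|x xK xmin] := EVT_min_rV _ cK ch; first by exists x0.
  exists x; first by apply: Kr; rewrite inE in xK.
  rewrite inE in xK; have xr := Kr _ xK.
  (* A simplified Newton step: it stays in [K], and its residual chi x - chi x' is at most half that
     of [x]. At a minimum the residual is therefore zero. *)
  pose x' := x + (y - psi x).
  have H0 : `|chi x - chi x0| <= 2^-1 * `|x0 - x|.
    rewrite -(distrC x x0); apply: rchi => //; rewrite subrr normr0 //.
  have Kx' : K x'.
    rewrite /K /=; have -> : x0 - x' = (psi x0 - y) - (chi x - chi x0).
      by rewrite /x' /chi; apply/rowP => j; rewrite !mxE; ring.
    apply: le_trans (ler_normB _ _) _.
    rewrite /K /= in xK; lra.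
  have xm := xmin x' (mem_set Kx').
  have hx' : h x' <= 2^-1 * h x.
    rewrite /h; have -> : psi x' - y = chi x - chi x'.
      by rewrite /x' /chi; apply/rowP => j; rewrite !mxE; ring.
    apply: le_trans (rchi _ _ xr (Kr _ Kx')) _.
    by rewrite /x' opprD addrA subrr add0r normrN distrC.
  have h0 : 0 <= h x by exact: normr_ge0.
  have : h x = 0 by apply/eqP; rewrite eq_le h0 andbT; lra.
  by move/eqP; rewrite normr_eq0 subr_eq0 => /eqP.
pose W := [set y | `|psi x0 - y| < r / 4].
pose A := [set x | `|x0 - x| < r /\ W (psi x)].
have oW : open W by exact: open_ball_norm.
have oA : open A.
  rewrite openE => x [xr Wx]; rewrite /interior; apply: filterI.
    by apply: near_open xr; exact: open_ball_norm.
  exact: (cpsi _ (rU _ xr) W (near_open oW Wx)).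
(* [x0] is only the default value of the choice where there is no preimage. *)
pose phi (y : 'rV[R]_n) : 'rV[R]_n := xget x0 [set x : 'rV[R]_n | `|x0 - x| < r /\ psi x = y].
have phiP y : W y -> `|x0 - phi y| < r /\ psi (phi y) = y.
  move=> /onto[x xr xy]; rewrite /phi; case: xgetP => [z -> //|/(_ x)].
  by case.
have phiK x : `|x0 - x| < r -> W (psi x) -> phi (psi x) = x.
  move=> xr Wx; have [pr pE] := phiP _ Wx.
  have := expand _ _ pr xr; rewrite pE subrr normr0 mulr0 normr_le0 subr_eq0.
  by move/eqP.
have AU : A `<=` U by move=> x [/rU].
have phiA y : W y -> A (phi y).
  by move=> Wy; have [pr pE] := phiP _ Wy; split; rewrite ?pE.
have philip y z : W y -> W z -> `|phi y - phi z| <= 2 * `|y - z|.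
  move=> /phiP[yr yE] /phiP[zr zE]; rewrite -{2}yE -{2}zE; exact: expand.
exists A, W, phi; split=> //.
- split=> //; split; first by rewrite subrr normr0.
  by rewrite /W /= subrr normr0 divr_gt0.
- by move=> x [xr Wx]; split=> //; apply: phiK.
- by move=> y Wy; split; [exact: phiA|case: (phiP _ Wy)].
have cphi y : W y -> {for y, continuous phi}.
  move=> Wy; apply: continuous_rV => j; apply: continuous_norm_ball => e e0.
  have [s s0 sW] := open_norm_ball oW Wy.
  exists (Num.min s (e / 2)).
    by rewrite lt_min s0 divr_gt0.
  move=> z; rewrite lt_min => /andP[/sW Wz ze].
  have -> : phi y 0 j - phi z 0 j = (phi y - phi z) 0 j by rewrite !mxE.
  apply: le_trans (ler_coord_norm _ _) (le_trans (philip _ _ Wy Wz) _).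
  by rewrite -ler_pdivlMl // mulrC ltW.
(* The increment [d] of [phi] is at most 2 |t|. Multiplying the first order expansion of [psi] by
   the inverse Jacobian [K] leaves an error of at most e' |d| S / |t| <= 2 e' S, and [e'] is chosen
   to keep this below [e]. *)
have D y i j : W y -> is_derive y 'e_i (fun y => phi y 0 j)
    (invmx (partials_mx (phi y)) i j).
  move=> Wy; set x := phi y; set K := invmx _.
  have [xr xE] := phiP _ Wy; have Ux := rU _ xr.
  have uJ : partials_mx x \in unitmx by exact: rJ.
  suff : (fun h : R => h^-1 *: (((fun y => phi y 0 j) \o shift y) (h *: 'e_i)
            - (fun y => phi y 0 j) y)) @ 0^' --> K i j.
    by move=> H; split; [apply/cvg_ex; exists (K i j)|exact: cvg_lim H].
  apply/cvgrPdist_le => e e0.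
  pose S := \sum_l `|K l j|; have S0 : 0 <= S by apply: sumr_ge0.
  pose e' := e / (2 * (1 + S)).
  have e'0 : 0 < e' by rewrite divr_gt0 // mulr_gt0 // ltr_pwDl.
  have [s s0 sP] : exists2 s : R, 0 < s & forall d, `|d| < s -> forall l,
      `|psi (x + d) 0 l - psi x 0 l - \sum_m d 0 m * partials_mx x m l| <= e' * `|d|.
    have H : \forall d \near (0 : 'rV[R]_n), forall l : 'I_n,
        `|psi (x + d) 0 l - psi x 0 l - \sum_m d 0 m * partials_mx x m l| <= e' * `|d|.
      apply: near_forall_ord => l.
      have [s s0 sP] := Ck1_approx oU (spsi l 1%N) Ux e'0.
      apply/near_norm_ball; exists s => // d; rewrite sub0r normrN => /sP.
      by apply: le_trans; under eq_bigr do rewrite mxE.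
    have /near_norm_ball[s s0 sP] := H; exists s => // d ds; apply: sP.
    by rewrite sub0r normrN.
  have [s1 s10 s1P] := open_norm_ball oW Wy.
  near=> t.
  have t0 : t != 0 by near: t; exact: nbhs_dnbhs_neq.
  have te : `|t *: 'e_i : 'rV[R]_n| <= `|t|.
    by rewrite normrZ ler_piMr // norm_delta_le1.
  have Wt : W (t *: 'e_i + y).
    apply: s1P; rewrite opprD addrCA subrr addr0 normrN.
    by apply: le_lt_trans te _; near: t; exact: dnbhs0_lt.
  pose d := phi (t *: 'e_i + y) - x.
  have dt : `|d| <= 2 * `|t|.
    apply: le_trans (philip _ _ Wt Wy) _.
    by rewrite addrK ler_pM2l.
  have ds : `|d| < s.
    apply: le_lt_trans dt _; rewrite -ltr_pdivlMl //; near: t.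
    by apply: dnbhs0_lt; rewrite mulr_gt0 // invr_gt0.
  have psid : psi (x + d) = t *: 'e_i + y.
    by rewrite /d addrC subrK; have [] := phiP _ Wt.
  have dE : d 0 j = \sum_l (\sum_m d 0 m * partials_mx x m l) * K l j.
    rewrite -[d in LHS]mulmx1 -(mulmxV uJ) mulmxA mxE.
    by apply: eq_bigr => l _; rewrite !mxE.
  have KE : K i j = \sum_l t^-1 * (psi (x + d) 0 l - psi x 0 l) * K l j.
    rewrite psid xE (bigD1 i) //= !mxE !eqxx addrK mulr1 mulVf // mul1r.
    rewrite big1 ?addr0 // => l /negbTE li; rewrite !mxE li /=.
    by rewrite mulr0 add0r subrr mulr0 mul0r.
  rewrite /= -/x -[phi _ 0 j - x 0 j]/(phi (t *: 'e_i + y) 0 j - x 0 j).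
  have -> : phi (t *: 'e_i + y) 0 j - x 0 j = d 0 j by rewrite !mxE.
  rewrite dE KE scaler_sumr -sumrB.
  apply: le_trans (ler_norm_sum _ _ _) _.
  apply: le_trans (_ : \sum_l `|t|^-1 * (e' * `|d|) * `|K l j| <= _).
    apply: ler_sum => l _.
    have -> : t^-1 * (psi (x + d) 0 l - psi x 0 l) * K l j -
      t^-1 *: ((\sum_m d 0 m * partials_mx x m l) * K l j) =
      t^-1 * (psi (x + d) 0 l - psi x 0 l - \sum_m d 0 m * partials_mx x m l) * K l j.
      by rewrite /GRing.scale /=; ring.
    rewrite !normrM normfV ler_wpM2r // ler_wpM2l ?invr_ge0 //.
    exact: sP.
  rewrite -mulr_sumr -/S.
  apply: le_trans (_ : 2 * e' * S <= _).
    rewrite ler_wpM2r // ler_pdivrMl ?normr_gt0 //.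
    by rewrite mulrA [_ * e']mulrC ler_wpM2l ?(ltW e'0) // mulrC.
  have S1 : 0 < 1 + S by rewrite ltr_pwDl.
  have -> : 2 * e' * S = e * (S / (1 + S)) by rewrite /e'; field; rewrite gt_eqF.
  by rewrite ger_pMr // ler_pdivrMr // mul1r lerDr.
have cphij j y : W y -> {for y, continuous (fun y => phi y 0 j)}.
  move=> Wy.
  have H := @continuous_comp _ _ _ phi (fun v : 'rV[R]_n => v 0 j) y (cphi _ Wy).
  by apply: H; exact: coord_continuous.
(* Bootstrap: if [phi] is C^k, so are the entries of the inverse Jacobian at [phi y], which are its
   partial derivatives. *)
move=> j k; elim: k j => [|k IH] j.
  by split=> // y; exact: cphij.
split; first by move=> y; exact: cphij.
move=> i; split=> [y /(D _ i j)[]//|].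
have C : Ck_on k W (fun y => invmx (partials_mx (phi y)) i j).
  apply: (@Ck_invmx _ _ _ _ _ (fun y => partials_mx (phi y))) => //.
    by move=> y /phiP[/rJ].
  move=> a b.
  have := @Ck_comp _ _ _ k W A ('D_'e_a (fun y => psi y 0 b)) phi oW oA phiA IH _.
  move=> H; apply: (Ck_ext oW _ (H _)) => [y _|]; first by rewrite mxE.
  exact: Ck_subset AU (Ck_derive a (spsi b k.+1)).
by apply: (Ck_ext oW _ C) => y /(D _ i j)[_ ->].
Unshelve. all: by end_near. Qed.

End InverseFunction.

(** * Linear algebra of the tangent and normal spaces *)

Section LinearAlgebra.
Context {R : realFieldType} {n : nat}.

(** In the full-rank factorisation P = C R, the equation P P = P forces R C = 1, and tr P = tr(R C)
    is the size of this identity matrix. *)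
Lemma rank_idempotent (P : 'M[R]_n) : P *m P = P -> (\rank P)%:R = \tr P.
Proof.
move=> PP.
have E : row_base P *m col_base P = 1%:M.
  have H : col_base P *m (row_base P *m col_base P) *m row_base P =
           col_base P *m 1%:M *m row_base P.
      by rewrite mulmx1 mulmxA mulmx_base -mulmxA mulmx_base PP.
  have fr := row_base_free P; have fc := col_base_full P.
  apply: (row_full_inj fc); apply: (row_free_inj fr).
  by rewrite H.
by rewrite -[in RHS](mulmx_base P) mxtrace_mulC E mxtrace1.
Qed.

Lemma bilinear_sym (A : 'M[R]_n) (v w : 'rV[R]_n) : A^T = A ->
  v *m A *m w^T = w *m A *m v^T.
Proof.
move=> AT; have -> : w *m A *m v^T = (v *m A *m w^T)^T.
  by rewrite !trmx_mul trmxK AT mulmxA.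
by apply/matrixP => i j; rewrite !ord1 [RHS]mxE.
Qed.

Lemma mxBE m p (A B : 'M[R]_(m, p)) i j : (A - B) i j = A i j - B i j.
Proof. by rewrite !mxE. Qed.

Lemma sum_const2 (e : R) : \sum_(i < n) \sum_(j < n) e = n%:R ^+ 2 * e.
Proof. by rewrite 2!sumr_const card_ord -mulrnA -[LHS]mulr_natl natrM expr2. Qed.

Lemma quad_formE (A : 'M[R]_n) (z : 'rV[R]_n) :
  (z *m A *m z^T) 0 0 = \sum_j z 0 j * (\sum_i z 0 i * A j i).
Proof.
rewrite -mulmxA mxE; apply: eq_bigr => j _; congr (_ * _); rewrite mxE.
by apply: eq_bigr => i _; rewrite !mxE mulrC.
Qed.

Lemma quad_form_sub (A B : 'M[R]_n) (z : 'rV[R]_n) : z *m B = 0 ->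
  z *m (A - B) *m z^T = z *m A *m z^T.
Proof. by move=> zB; rewrite mulmxBr zB subr0. Qed.

Lemma row_mul_tr_row m p (A : 'M[R]_(m, n)) (B : 'M[R]_(p, n)) a b :
  (row a A *m (row b B)^T) 0 0 = (A *m B^T) a b.
Proof. by rewrite !mxE; apply: eq_bigr => i _; rewrite !mxE. Qed.

(** Bookkeeping for [eikonal_cubic]: the left side is what differentiating products of rows
    produces. [Ga], [Gb], [Gc] stand for derivatives of the dual metric and [Ta], [Tb] for third
    derivatives of u. *)
Lemma third_order_entries (H G Gc Ga Gb Ta Tb : 'M[R]_n) a b c : H^T = H ->
  ((row a H *m Gc + 2 *: (row c Ta *m G + row c H *m Ga)) *m (row b H)^T +
   (row b H *m Gc + 2 *: (row c Tb *m G + row c H *m Gb)) *m (row a H)^T +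
   2 *: (row c H *m G) *m (row b Ta)^T) 0 0 =
  (H *m Gc *m H) a b + (H *m Gc *m H) b a +
  2 * ((H *m Ga *m H) c b + (Ta *m G *m H) c b + (H *m Gb *m H) c a +
       (Tb *m G *m H) c a + \sum_j (H *m G) c j * Ta b j).
Proof.
move=> HT; have addE (A B : 'M[R]_1) : (A + B) 0 0 = A 0 0 + B 0 0 by rewrite mxE.
have scaleE (t : R) (A : 'M[R]_1) : (t *: A) 0 0 = t * A 0 0 by rewrite mxE.
have e3 (A B C : 'M[R]_n) d e :
    (row d A *m B *m (row e C)^T) 0 0 = (A *m B *m C^T) d e.
  by rewrite -row_mul row_mul_tr_row.
rewrite !mulmxDl -!scalemxAl !mulmxDl !addE !scaleE !addE !e3 HT [(H *m G *m Ta^T) c b]mxE.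
by under eq_bigr => j _ do rewrite [Ta^T j b]mxE; ring.
Qed.

(** G H / mu is idempotent and, [G] being invertible, has the rank of [H]; the rank of an idempotent
    is its trace. *)
Lemma rank_projection (g G H : 'M[R]_n) (mu : R) : g *m G = 1%:M -> mu != 0 ->
  H *m G *m H = mu *: H -> (\rank H)%:R * mu = \tr (G *m H).
Proof.
move=> gG mu0 HGH; pose Q := mu^-1 *: (G *m H).
have QQ : Q *m Q = Q.
  rewrite /Q -scalemxAl -scalemxAr -[G *m H *m (G *m H)]mulmxA.
  rewrite [H *m (G *m H)]mulmxA HGH -scalemxAr; congr (_ *: _).
  by rewrite scalerA mulVf // scale1r.
have HQ : H = g *m (mu *: Q).
  by rewrite /Q scalerA mulfV // scale1r mulmxA gG mul1mx.
have -> : \rank H = \rank Q.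
  apply/eqP; rewrite eqn_leq; apply/andP; split.
    by apply: mxrankS; rewrite HQ -scalemxAr; apply: scalemx_sub; exact: submxMl.
  by apply: mxrankS; apply: scalemx_sub; exact: submxMl.
by rewrite rank_idempotent // /Q mxtraceZ mulrAC mulVf // mul1r.
Qed.

(** For v nonzero, [w] is the component orthogonal to [v] of d G, the vector dual to [d]; its
    squared length is nonnegative. *)
Lemma dual_cauchy_schwarz (g G : 'M[R]_n) (d v : 'rV[R]_n) :
  g *m G = 1%:M -> g^T = g -> G^T = G ->
  (forall w : 'rV[R]_n, w != 0 -> 0 < (w *m g *m w^T) 0 0) ->
  (d *m v^T) 0 0 ^+ 2 <= (d *m G *m d^T) 0 0 * (v *m g *m v^T) 0 0.
Proof.
move=> gG gT GT gpos.
have [->|v0] := eqVneq v 0.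
  by rewrite trmx0 !mulmx0 !mxE expr0n /= mulr0.
set p := (d *m v^T) 0 0; set q := (d *m G *m d^T) 0 0; set s := (v *m g *m v^T) 0 0.
have s0 : 0 < s by exact: gpos.
pose w := d *m G - (p / s) *: v.
have w_ge0 : 0 <= (w *m g *m w^T) 0 0.
  have [->|w0] := eqVneq w 0; first by rewrite !mul0mx mxE.
  exact: ltW (gpos _ w0).
have Gg : G *m g = 1%:M by exact: mulmx1C.
have E : (w *m g *m w^T) 0 0 = q - 2 * (p / s) * p + (p / s) ^+ 2 * s.
  have pE : (v *m d^T) 0 0 = p.
    by rewrite /p !mxE; apply: eq_bigr => i _; rewrite !mxE mulrC.
  have wg : w *m g = d - (p / s) *: (v *m g).
    by rewrite /w mulmxBl -scalemxAl -mulmxA Gg mulmx1.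
  have wT : w^T = G *m d^T - (p / s) *: v^T.
    by rewrite /w linearB linearZ /= trmx_mul GT.
  have BE (A B : 'M[R]_1) : (A - B) 0 0 = A 0 0 - B 0 0 by rewrite !mxE.
  have ZE (t : R) (A : 'M[R]_1) : (t *: A) 0 0 = t * A 0 0 by rewrite mxE.
  have vgG : v *m g *m (G *m d^T) = v *m d^T.
    by rewrite -mulmxA [g *m (G *m _)]mulmxA gG mul1mx.
  rewrite wg wT mulmxBl !mulmxBr -!scalemxAl -!scalemxAr vgG !BE !ZE mulmxA.
  rewrite pE -/p -/q -/s; ring.
have {E} : 0 <= q - p ^+ 2 / s.
  rewrite E in w_ge0; apply: le_trans w_ge0 _.
  by rewrite le_eqVlt; apply/orP; left; apply/eqP; field; rewrite gt_eqF.
by rewrite subr_ge0 ler_pdivrMr.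
Qed.

Lemma delta_gram (g : 'M[R]_n) i (e : 'rV[R]_n := delta_mx 0 i) :
  (e *m g *m e^T) 0 0 = g i i.
Proof. by rewrite /e -rowE trmx_delta -colE !mxE. Qed.

Lemma dual_norm_coord (g G : 'M[R]_n) (d : 'rV[R]_n) i :
  g *m G = 1%:M -> g^T = g -> G^T = G ->
  (forall w : 'rV[R]_n, w != 0 -> 0 < (w *m g *m w^T) 0 0) ->
  d 0 i ^+ 2 <= (d *m G *m d^T) 0 0 * g i i.
Proof.
move=> gG gT GT gpos.
have := dual_cauchy_schwarz d (delta_mx 0 i) gG gT GT gpos.
by rewrite delta_gram trmx_delta -colE mxE.
Qed.

Lemma posdef_diag_gt0 (g : 'M[R]_n) i :
  (forall w : 'rV[R]_n, w != 0 -> 0 < (w *m g *m w^T) 0 0) -> 0 < g i i.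
Proof.
move=> gpos; rewrite -delta_gram; apply: gpos.
by apply/eqP => /rowP /(_ i) /eqP; rewrite !mxE !eqxx oner_eq0.
Qed.

(** * Tangential and normal parts of the dual metric *)

Section Tangent.
Variables (k : nat) (g G H : 'M[R]_n) (iota : 'M[R]_(k, n)) (mu : R).
Hypotheses (gG : g *m G = 1%:M) (GT : G^T = G) (HT : H^T = H).
Hypotheses (mu0 : mu != 0) (HGH : H *m G *m H = mu *: H).
Hypotheses (iotaH : iota *m H = 0) (iotaf : row_free iota).
Hypothesis (rankH : (\rank H + k = n)%N).

(** [N] and [X] are the normal and tangential parts of [G]; [F] is the first fundamental form of the
    kernel of [H], which the rows of [iota] span. *)
Let N := mu^-1 *: (G *m H *m G).
Let X := G - N.
Let F := iota *m g *m iota^T.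

(** As X H = 0 and the rows of [iota] span the kernel of [H], X = Y iota for some [Y]. Together with
    iota g X = iota this gives F Y^T = iota, so that [F] is invertible and Y^T = invmx F iota. *)
Lemma tangent_inverse : iota^T *m invmx F *m iota = X.
Proof.
have XT : X^T = X by rewrite /X /N linearB linearZ /= !trmx_mul GT HT mulmxA.
have XH : X *m H = 0.
  have E : G *m H *m G *m H = G *m (H *m G *m H) by rewrite !mulmxA.
  rewrite /X /N mulmxBl -scalemxAl E HGH -scalemxAr scalerA mulVf // scale1r.
  exact: subrr.
have /submxP[Y XE] : (X <= iota)%MS.
  have kH : (iota <= kermx H)%MS by apply/sub_kermxP.
  have : (kermx H <= iota)%MS.
    rewrite -(geq_leqif (mxrank_leqif_sup kH)) mxrank_ker.
    by move: iotaf; rewrite /row_free => /eqP ->; rewrite leq_subLR rankH.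
  by apply: submx_trans; apply/sub_kermxP.
have igX : iota *m g *m X = iota.
  rewrite /X /N mulmxBr -scalemxAr -!mulmxA [g *m (G *m _)]mulmxA gG mul1mx.
  by rewrite [iota *m (H *m _)]mulmxA iotaH mul0mx scaler0 subr0 mulmx1.
have FY : F *m Y^T = iota.
  by rewrite -[in RHS]igX -[in RHS]XT XE trmx_mul /F !mulmxA.
have igY : iota *m g *m Y = 1%:M.
  have E : iota *m g *m (Y *m iota) = iota by rewrite -XE.
  by apply: (row_free_inj iotaf); rewrite /= mul1mx -[RHS]E !mulmxA.
have [uF _] : F \in unitmx /\ Y^T *m g *m Y \in unitmx.
  by apply: mulmx1_unit; rewrite !mulmxA FY.
have YE : invmx F *m iota = Y^T by rewrite -FY mulKmx.
by rewrite -mulmxA YE -[RHS]XT XE trmx_mul.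
Qed.

(** By [tangent_inverse] a normal vector has no tangential part, so the projection H G / mu fixes
    it: relative to the metric, normal vectors are eigenvectors of [H] with eigenvalue [mu]. *)
Lemma normal_covector (xi : 'rV[R]_n) : xi *m g *m iota^T = 0 ->
  xi *m H = mu *: (xi *m g).
Proof.
move=> xg; have E : xi *m g *m X = 0.
  by rewrite -tangent_inverse !mulmxA xg !mul0mx.
have {E} : xi = mu^-1 *: (xi *m H *m G).
  apply/eqP; rewrite -subr_eq0 -[X in X - _]mulmx1 -gG; apply/eqP.
  rewrite -[RHS]E /X /N mulmxBr -scalemxAr !mulmxA.
  by rewrite -[xi *m g *m G](mulmxA) gG mulmx1.
move=> E; rewrite [in RHS]E -scalemxAl scalerA mulfV // scale1r -mulmxA.
by rewrite (mulmx1C gG) mulmx1.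
Qed.

End Tangent.

Lemma mxtrace_mulE m p (A : 'M[R]_(m, p)) (B : 'M[R]_(p, m)) :
  \tr (A *m B) = \sum_i \sum_j A i j * B j i.
Proof. by rewrite /mxtrace; apply: eq_bigr => i _; rewrite mxE. Qed.

(** * Contraction of the cubic identity along a normal vector *)

Section Contraction.
Variables (g G H : 'M[R]_n) (gd Gd T : 'I_n -> 'M[R]_n) (mu : R) (xi : 'rV[R]_n).
Hypotheses (gG : g *m G = 1%:M) (GT : G^T = G) (HT : H^T = H).
Hypotheses (mu0 : mu != 0) (HGH : H *m G *m H = mu *: H).
Hypotheses (Hxi : xi *m H = mu *: (xi *m g)).
Hypothesis GdE : forall a, Gd a = - (G *m gd a *m G).
Hypothesis T12 : forall a b c, T a b c = T b a c.
Hypothesis T23 : forall a b c, T a b c = T a c b.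

Let along (M : 'I_n -> 'M[R]_n) := \sum_c xi 0 c *: M c.
Let N := mu^-1 *: (G *m H *m G).
(* [K] a b = <d_a g (xi, d_b)>, and [C] lowers the Christoffel symbols along xi *)
Let K : 'M[R]_n := \matrix_(a, b) (xi *m gd a) 0 b.
Let C := 2^-1 *: (K + K^T - along gd).

Hypothesis cubic : forall a b c,
  (H *m Gd c *m H) a b + (H *m Gd c *m H) b a +
  2 * ((H *m Gd a *m H) c b + (T a *m G *m H) c b + (H *m Gd b *m H) c a
       + (T b *m G *m H) c a + \sum_j (H *m G) c j * T j a b) = 2 * mu * T a b c.

Lemma trace_along_Gd : \tr (along Gd *m H) = - mu * \tr (along gd *m N).
Proof.
have -> : along Gd = - (G *m along gd *m G).
  rewrite /along mulmx_sumr mulmx_suml -sumrN; apply: eq_bigr => a _.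
  by rewrite GdE scalerN -scalemxAr -scalemxAl.
rewrite mulNmx linearN /= mulNr; congr (- _).
rewrite /N -scalemxAr mxtraceZ mulrA mulfV // mul1r.
by rewrite -!mulmxA mxtrace_mulC !mulmxA.
Qed.

(** Contract [cubic] with xi_c N_ab. On normal directions H G acts as mu, so with t = tr(N T_xi) the
    identity becomes - 2 mu^2 tr(g_xi N) - 4 mu^2 tr(K N) + 6 mu t = 2 mu t. *)
Lemma cubic_contraction :
  \tr (N *m along T) = mu * (2^-1 * \tr (along gd *m N) + \tr (K *m N)).
Proof.
have xiG : xi *m H *m G = mu *: xi.
  by rewrite Hxi -scalemxAl -mulmxA gG mulmx1.
have HN : H *m N = H *m G.
  by rewrite /N -scalemxAr !mulmxA HGH -scalemxAl scalerA mulVf // scale1r.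
have GHN : G *m H *m N = mu *: N.
  rewrite -mulmxA HN mulmxA /N scalerA mulfV // scale1r //.
have NT : N^T = N by rewrite /N linearZ /= !trmx_mul GT HT mulmxA.
have Nsym a b : N a b = N b a by rewrite -[in LHS]NT mxE.
(* [S] is the contraction with xi_c N_ab; as [N] is symmetric, a and b may be exchanged. *)
pose S (f : 'I_n -> 'I_n -> 'I_n -> R) :=
  \sum_c xi 0 c * \sum_a \sum_b N a b * f a b c.
have SD f f' : S (fun a b c => f a b c + f' a b c) = S f + S f'.
  rewrite /S -big_split; apply: eq_bigr => c _ /=; rewrite -mulrDr -big_split /=.
  congr (_ * _); apply: eq_bigr => a _; rewrite -big_split /=.
  by apply: eq_bigr => b _; rewrite mulrDr.
have SZ t f : S (fun a b c => t * f a b c) = t * S f.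
  rewrite /S mulr_sumr; apply: eq_bigr => c _ /=; rewrite [RHS]mulrCA.
  congr (_ * _); rewrite mulr_sumr; apply: eq_bigr => a _; rewrite mulr_sumr.
  by apply: eq_bigr => b _; rewrite mulrCA.
have Sswap f : S (fun a b c => f b a c) = S f.
  rewrite /S; apply: eq_bigr => c _; rewrite exchange_big; congr (_ * _).
  by apply: eq_bigr => a _; apply: eq_bigr => b _; rewrite Nsym.
have Sext f f' : (forall a b c, f a b c = f' a b c) -> S f = S f'.
  by move=> ff; rewrite /S; apply: eq_bigr => c _; congr (_ * _);
     apply: eq_bigr => a _; apply: eq_bigr => b _; rewrite ff.
have Str (M : 'I_n -> 'M[R]_n) : S (fun a b c => M c b a) = \tr (N *m along M).
  rewrite /along mulmx_sumr linear_sum /=; apply: eq_bigr => c _.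
  by rewrite -scalemxAr mxtraceZ mxtrace_mulE.
have Srow (M : 'I_n -> 'M[R]_n) : S (fun a b c => M a c b) =
    \sum_a (xi *m M a *m N) 0 a.
  rewrite /S; under eq_bigr => c _ do rewrite mulr_sumr.
  rewrite exchange_big; apply: eq_bigr => a _ /=.
  under eq_bigr => c _ do rewrite mulr_sumr.
  rewrite exchange_big mxE; apply: eq_bigr => b _ /=.
  by rewrite [(xi *m M a) 0 b]mxE mulr_suml; apply: eq_bigr => c _ /=; rewrite Nsym; ring.
have E : S (fun a b c => (H *m Gd c *m H) a b + (H *m Gd c *m H) b a +
  2 * ((H *m Gd a *m H) c b + (T a *m G *m H) c b + (H *m Gd b *m H) c a
       + (T b *m G *m H) c a + \sum_j (H *m G) c j * T j a b)) =
  S (fun a b c => 2 * mu * T a b c) by apply: Sext.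
pose t := \tr (N *m along T).
have St : S T = t.
  by rewrite /t -Str; apply: Sext => a b c; rewrite T23 T12 T23.
have E1 : S (fun a b c => (H *m Gd c *m H) b a) = - mu ^+ 2 * \tr (along gd *m N).
  rewrite (Str (fun c => H *m Gd c *m H)) expr2 -mulNr -mulrA mulNr -mulrN -mulNr -trace_along_Gd.
  have -> : along (fun c => H *m Gd c *m H) = H *m along Gd *m H.
    rewrite /along mulmx_sumr mulmx_suml; apply: eq_bigr => c _.
    by rewrite -scalemxAr -scalemxAl.
  rewrite !mulmxA mxtrace_mulC !mulmxA HN HGH -scalemxAl mxtraceZ mxtrace_mulC.
  by [].
have E2 : S (fun a b c => (H *m Gd a *m H) c b) = - mu ^+ 2 * \tr (K *m N).
  rewrite Srow /mxtrace mulr_sumr; apply: eq_bigr => a _.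
  have -> : xi *m (H *m Gd a *m H) *m N = - mu ^+ 2 *: (xi *m gd a *m N).
    have -> : xi *m (H *m Gd a *m H) *m N = xi *m H *m Gd a *m (H *m N).
      by rewrite !mulmxA.
    rewrite HN GdE mulmxN mulNmx !mulmxA xiG -!scalemxAl -!mulmxA.
    have -> : G *m (H *m G) = mu *: N.
      by rewrite /N scalerA mulfV // scale1r mulmxA.
    by rewrite -2!scalemxAr scalerA scaleNr expr2.
  rewrite mxE; congr (_ * _); rewrite !mxE; apply: eq_bigr => b _.
  by rewrite [K a b]mxE.
have E3 : S (fun a b c => (T a *m G *m H) c b) = mu * t.
  rewrite Srow -St (Sext T (fun a b c => T a c b)) // Srow mulr_sumr.
  apply: eq_bigr => a _.
  have -> : xi *m (T a *m G *m H) *m N = xi *m T a *m (G *m H *m N).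
    by rewrite !mulmxA.
  by rewrite GHN -scalemxAr mxE.
have E4 : S (fun a b c => \sum_j (H *m G) c j * T j a b) = mu * t.
  rewrite -St (Sext T (fun a b c => T c a b)); last by move=> a b c; rewrite T23 T12.
  rewrite /S mulr_sumr.
  transitivity (\sum_c \sum_j xi 0 c * (H *m G) c j * \sum_a \sum_b N a b * T j a b).
    apply: eq_bigr => c _; under [RHS]eq_bigr => j _ do rewrite -mulrA.
    rewrite -mulr_sumr; congr (_ * _).
    under [RHS]eq_bigr => j _ do rewrite mulr_sumr.
    rewrite [RHS]exchange_big; apply: eq_bigr => a _ /=.
    under [RHS]eq_bigr => j _ do rewrite mulr_sumr.
    rewrite [RHS]exchange_big; apply: eq_bigr => b _ /=; rewrite mulr_sumr.
    by apply: eq_bigr => j _; rewrite mulrCA.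
  rewrite exchange_big; apply: eq_bigr => j _ /=; rewrite -mulr_suml mulrA.
  congr (_ * _); have := xiG => /rowP /(_ j); rewrite -mulmxA !mxE => <-.
  by [].
move: E; rewrite SD SD SZ SZ SD SD SD SD.
rewrite (Sswap (fun a b c => (H *m Gd c *m H) b a)) E1.
rewrite (Sswap (fun a b c => (H *m Gd a *m H) c b)) E2.
rewrite (Sswap (fun a b c => (T a *m G *m H) c b)) E3 E4 St -/t => E.
apply: (mulfI mu0); lra.
Qed.

(** The first premise replaces tr(G T_xi) by tr(N T_xi), which [cubic_contraction] evaluates. The
    second then gives tr(G C) = tr(K N) - tr(g_xi N) / 2, which is tr(N C). *)
Lemma tangential_trace_eq0 :
  \tr ((G - N) *m along T) = 0 ->
  \tr (along Gd *m H) + \tr (G *m along T) - mu * \tr (G *m C) = 0 ->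
  \tr ((G - N) *m C) = 0.
Proof.
move=> tang lap.
have NT : N^T = N by rewrite /N linearZ /= !trmx_mul GT HT mulmxA.
have NC : \tr (N *m C) = \tr (K *m N) - 2^-1 * \tr (along gd *m N).
  have tD A B : \tr (N *m (A + B)) = \tr (N *m A) + \tr (N *m B).
    by rewrite mulmxDr mxtraceD.
  have tN A : \tr (N *m (- A)) = - \tr (N *m A) by rewrite mulmxN; exact: linearN.
  rewrite /C -scalemxAr mxtraceZ !tD tN.
  rewrite -[\tr (N *m K^T)]mxtrace_tr trmx_mul trmxK NT.
  by rewrite [\tr (N *m K)]mxtrace_mulC [\tr (N *m _)]mxtrace_mulC; field.
have GdH := trace_along_Gd.
have tB A : \tr ((G - N) *m A) = \tr (G *m A) - \tr (N *m A).
  by rewrite mulmxBl; exact: linearB.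
move: tang lap; rewrite (tB C) (tB (along T)) cubic_contraction NC GdH.
move=> /eqP; rewrite subr_eq0 => /eqP -> lap.
apply: (mulfI mu0); rewrite mulr0; lra.
Qed.
End Contraction.
End LinearAlgebra.

Section KernelCoordinates.
Context {F : fieldType} {n : nat}.

(** In the rank normal form of [Q], y Q = 0 means that the first \rank Q coordinates of y
    [col_ebase Q] vanish. *)
Lemma kernel_coordinates (Q : 'M[F]_n) : exists2 E : 'M[F]_n, E \in unitmx &
  forall y : 'rV[F]_n, y *m Q = 0 <->
    forall i : 'I_n, (n - \rank Q <= i)%N -> (y *m E) 0 i = 0.
Proof.
(* [S] reverses the order of the coordinates: in a slice chart it is the last ones that vanish. *)
pose S : 'M[F]_n := \matrix_(i, j) (j == rev_ord i)%:R.
have mulS (y : 'rV[F]_n) j : (y *m S) 0 j = y 0 (rev_ord j).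
  rewrite mxE (bigD1 (rev_ord j)) //= mxE rev_ordK eqxx mulr1 big1 ?addr0 // => i ij.
  rewrite mxE; case: eqP => [ji|_]; last by rewrite mulr0.
  by rewrite ji rev_ordK eqxx in ij.
have SS : S *m S = 1%:M.
  apply/row_matrixP => i; rewrite row_mul; apply/rowP => j.
  by rewrite mulS !mxE (inj_eq rev_ord_inj) eq_sym.
have pidE (v : 'rV[F]_n) j :
    (v *m pid_mx (\rank Q)) 0 j = if (j < \rank Q)%N then v 0 j else 0.
  rewrite mxE (bigD1 j) //= mxE eqxx /= big1 => [|i ij]; last first.
    by rewrite mxE (negbTE ij : (i == j :> nat) = false) mulr0.
  by rewrite addr0; case: ifP => _; rewrite (mulr1, mulr0).
exists (col_ebase Q *m S).
  by rewrite unitmx_mul col_ebase_unit; have [] := mulmx1_unit SS.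
move=> y; pose z := y *m col_ebase Q.
have -> : (y *m Q = 0) <-> z *m pid_mx (\rank Q) = 0 :> 'rV[F]_n.
  rewrite -{1}(mulmx_ebase Q) !mulmxA -/z; split=> [h|->]; last by rewrite mul0mx.
  by rewrite -(mulmxK (row_ebase_unit Q) (z *m _)) h mul0mx.
have zE j := pidE z j.
split=> [z0 i ni|H].
  rewrite mulmxA mulS -/z; have := zE (rev_ord i); rewrite z0 mxE.
  have -> : (rev_ord i < \rank Q)%N; last by move=> <-.
  by rewrite /=; have := ltn_ord i; have := rank_leq_row Q; lia.
apply/rowP => j; rewrite zE [RHS]mxE; case: ifP => // jr.
have jn : (n - \rank Q <= rev_ord j)%N by rewrite /=; have := ltn_ord j; lia.
by have := H _ jn; rewrite mulmxA mulS rev_ordK.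
Qed.

End KernelCoordinates.

(** * Smooth matrices and Taylor estimates *)

Section MatrixCalculus.
Context {R : realType} {n : nat}.
Implicit Types (F H : 'rV[R]_n -> R) (x : 'rV[R]_n).

Lemma eq_derive F H x v : F =1 H -> 'D_v F x = 'D_v H x.
Proof. by move=> /funext ->. Qed.

Variable U : set 'rV[R]_n.
Hypothesis oU : open U.

Lemma smoothD F H : smooth_on U F -> smooth_on U H -> smooth_on U (fun x => F x + H x).
Proof. by move=> sF sH k; exact: CkD. Qed.

Lemma smoothM F H : smooth_on U F -> smooth_on U H -> smooth_on U (fun x => F x * H x).
Proof. by move=> sF sH k; exact: CkM. Qed.

Lemma smooth_cst (c : R) : smooth_on U (fun _ : 'rV[R]_n => c).
Proof. by move=> k; exact: Ck_cst. Qed.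

Lemma smooth_sum (I : Type) (r : seq I) (P : pred I) (F : I -> 'rV[R]_n -> R) :
  (forall i, P i -> smooth_on U (F i)) -> smooth_on U (fun x => \sum_(i <- r | P i) F i x).
Proof. by move=> sF k; apply: Ck_sum => // i Pi; exact: sF. Qed.

Lemma smooth_ext F H : (forall x, U x -> F x = H x) -> smooth_on U F -> smooth_on U H.
Proof. by move=> FH sF k; exact: Ck_ext FH (sF k). Qed.

Lemma smooth_derivable F x i : smooth_on U F -> U x -> derivable F x 'e_i.
Proof. by move=> sF; exact: Ck_derivable (sF 1%N). Qed.

Lemma smooth_near F x (e : R) : smooth_on U F -> U x -> 0 < e ->
  \forall y \near x, `|F y - F x| <= e.
Proof.
move=> sF Ux e0; have /cvgrPdist_le /(_ _ e0) := Ck_continuous (sF 0%N) Ux.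
by apply: filterS => y; rewrite distrC.
Qed.

Definition mx_smooth m p (M : 'rV[R]_n -> 'M[R]_(m, p)) :=
  forall i j, smooth_on U (fun x => M x i j).

Definition Dmx m p (i : 'I_n) (M : 'rV[R]_n -> 'M[R]_(m, p)) x : 'M[R]_(m, p) :=
  \matrix_(a, b) 'D_'e_i (fun y => M y a b) x.

Lemma mx_smooth_mul m p q (A : 'rV[R]_n -> 'M[R]_(m, p)) (B : 'rV[R]_n -> 'M[R]_(p, q)) :
  mx_smooth A -> mx_smooth B -> mx_smooth (fun x => A x *m B x).
Proof.
move=> sA sB i j; apply: (@smooth_ext (fun x => \sum_k A x i k * B x k j)).
  by move=> x _; rewrite mxE.
by apply: smooth_sum => k _; exact: smoothM.
Qed.

Lemma mx_smooth_add m p (A B : 'rV[R]_n -> 'M[R]_(m, p)) :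
  mx_smooth A -> mx_smooth B -> mx_smooth (fun x => A x + B x).
Proof.
move=> sA sB i j; apply: (smooth_ext _ (smoothD (sA i j) (sB i j))) => x _.
by rewrite mxE.
Qed.

Lemma mx_smooth_scale m p (c : R) (A : 'rV[R]_n -> 'M[R]_(m, p)) :
  mx_smooth A -> mx_smooth (fun x => c *: A x).
Proof.
move=> sA i j; apply: (smooth_ext _ (smoothM (smooth_cst c) (sA i j))) => x _.
by rewrite mxE.
Qed.

Lemma mx_smooth_tr m p (A : 'rV[R]_n -> 'M[R]_(m, p)) :
  mx_smooth A -> mx_smooth (fun x => (A x)^T).
Proof. by move=> sA i j; apply: (smooth_ext _ (sA j i)) => x _; rewrite mxE. Qed.

Lemma mx_smooth_derive m p i (A : 'rV[R]_n -> 'M[R]_(m, p)) :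
  mx_smooth A -> mx_smooth (Dmx i A).
Proof.
by move=> sA a b; apply: (smooth_ext _ (smooth_derive i (sA a b))) => x _; rewrite mxE.
Qed.

Lemma mx_smooth_inv m (A : 'rV[R]_n -> 'M[R]_m) :
  (forall x, U x -> A x \in unitmx) -> mx_smooth A ->
  mx_smooth (fun x => invmx (A x)).
Proof. by move=> uA sA i j k; apply: Ck_invmx => // a b; exact: sA. Qed.

Lemma Dmx_ext m p i (A B : 'rV[R]_n -> 'M[R]_(m, p)) x :
  (forall y, U y -> A y = B y) -> U x -> Dmx i A x = Dmx i B x.
Proof.
move=> AB Ux; apply/matrixP => a b; rewrite !mxE; apply: near_eq_derive.
by near=> y; rewrite AB //; near: y; exact: near_open.
Unshelve. all: by end_near. Qed.

Lemma Dmx_add m p i (A B : 'rV[R]_n -> 'M[R]_(m, p)) x :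
  mx_smooth A -> mx_smooth B -> U x ->
  Dmx i (fun y => A y + B y) x = Dmx i A x + Dmx i B x.
Proof.
move=> sA sB Ux; apply/matrixP => a b; rewrite !mxE.
rewrite -(deriveD (smooth_derivable (i := i) (sA a b) Ux) (smooth_derivable (i := i) (sB a b) Ux)).
by apply: eq_derive => y; rewrite mxE.
Qed.

Lemma Dmx_scale m p i (c : R) (A : 'rV[R]_n -> 'M[R]_(m, p)) x :
  mx_smooth A -> U x -> Dmx i (fun y => c *: A y) x = c *: Dmx i A x.
Proof.
move=> sA Ux; apply/matrixP => a b; rewrite !mxE.
rewrite -[RHS](deriveZ c (smooth_derivable (i := i) (sA a b) Ux)).
by apply: eq_derive => y; rewrite mxE.
Qed.

Lemma Dmx_tr m p i (A : 'rV[R]_n -> 'M[R]_(m, p)) x :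
  Dmx i (fun y => (A y)^T) x = (Dmx i A x)^T.
Proof.
apply/matrixP => a b; rewrite !mxE.
by apply: eq_derive => y; rewrite mxE.
Qed.

Lemma Dmx_mul m p q i (A : 'rV[R]_n -> 'M[R]_(m, p)) (B : 'rV[R]_n -> 'M[R]_(p, q)) x :
  mx_smooth A -> mx_smooth B -> U x ->
  Dmx i (fun y => A y *m B y) x = Dmx i A x *m B x + A x *m Dmx i B x.
Proof.
move=> sA sB Ux; apply/matrixP => a b; rewrite !mxE -big_split /=.
have -> : (fun y => (A y *m B y) a b) =
   \sum_k ((fun y => A y a k) * (fun y => B y k b)).
  by apply: funext => y; rewrite mxE fct_sumE.
have dA k := smooth_derivable (i := i) (sA a k) Ux.
have dB k := smooth_derivable (i := i) (sB k b) Ux.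
rewrite derive_sum => [|k]; last exact: derivableM (dA k) (dB k).
apply: eq_bigr => k _; rewrite (deriveM (dA k) (dB k)) !mxE addrC.
by congr (_ + _); rewrite mulrC.
Qed.

Lemma Dmx_cst m p i (A : 'M[R]_(m, p)) x : Dmx i (fun=> A) x = 0.
Proof. by apply/matrixP => a b; rewrite !mxE derive_cst. Qed.

Lemma Dmx_inv m i (A : 'rV[R]_n -> 'M[R]_m) x :
  (forall x, U x -> A x \in unitmx) -> mx_smooth A -> U x ->
  Dmx i (fun y => invmx (A y)) x = - (invmx (A x) *m Dmx i A x *m invmx (A x)).
Proof.
move=> uA sA Ux; have sI := mx_smooth_inv uA sA.
have E : Dmx i (fun y => A y *m invmx (A y)) x = 0.
  rewrite -(Dmx_cst i 1%:M x); apply: Dmx_ext => // y /uA uAy.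
  exact: mulmxV.
move: E; rewrite Dmx_mul // => /eqP; rewrite addrC addr_eq0 => /eqP E.
by rewrite -[LHS](mulKmx (uA _ Ux)) E mulmxN mulmxA.
Qed.

(** The second derivatives of [A] are multiplied by B x = 0; this keeps the cubic identity free of
    them. *)
Lemma DDmx_mul_vanish m p q i j (A : 'rV[R]_n -> 'M[R]_(m, p))
    (B : 'rV[R]_n -> 'M[R]_(p, q)) x :
  mx_smooth A -> mx_smooth B -> U x -> B x = 0 ->
  Dmx i (Dmx j (fun y => A y *m B y)) x =
  Dmx i A x *m Dmx j B x + Dmx j A x *m Dmx i B x + A x *m Dmx i (Dmx j B) x.
Proof.
move=> sA sB Ux B0; have sdA := mx_smooth_derive j sA; have sdB := mx_smooth_derive j sB.
rewrite (@Dmx_ext _ _ _ _ (fun y => Dmx j A y *m B y + A y *m Dmx j B y)) //; last first.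
  by move=> y Uy; exact: Dmx_mul.
rewrite Dmx_add //; [|exact: mx_smooth_mul|exact: mx_smooth_mul].
have := Dmx_mul i sdA sB Ux; rewrite B0 mulmx0 add0r => ->.
rewrite (Dmx_mul i sA sdB Ux).
exact: etrans (addrCA _ _ _) (addrA _ _ _).
Qed.

Lemma DDmx_mul_vanish2 m p q i j (A : 'rV[R]_n -> 'M[R]_(m, p))
    (B : 'rV[R]_n -> 'M[R]_(p, q)) x :
  mx_smooth A -> mx_smooth B -> U x -> B x = 0 -> Dmx i A x = 0 -> Dmx j A x = 0 ->
  Dmx i (Dmx j (fun y => A y *m B y)) x = A x *m Dmx i (Dmx j B) x.
Proof.
move=> sA sB Ux B0 Ai Aj; rewrite (DDmx_mul_vanish i j sA sB Ux B0) Ai Aj.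
by rewrite !mul0mx !add0r.
Qed.

Lemma DDmx_comm m p i j (A : 'rV[R]_n -> 'M[R]_(m, p)) x : mx_smooth A -> U x ->
  Dmx i (Dmx j A) x = Dmx j (Dmx i A) x.
Proof.
move=> sA Ux; apply/matrixP => a b; rewrite [LHS]mxE [RHS]mxE.
transitivity ('D_'e_i ('D_'e_j (fun y => A y a b)) x).
  by apply: eq_derive => y; rewrite mxE.
rewrite (derive_comm i j oU (sA a b 2%N) Ux).
by apply: eq_derive => y; rewrite mxE.
Qed.

End MatrixCalculus.

(** * Taylor estimates along lines *)

Section TaylorEstimates.
Context {R : realType} {n : nat}.
Implicit Types (x v : 'rV[R]_n).

Lemma rV_norm_sqr_le v (e : R) : 0 <= e -> (forall i, v 0 i ^+ 2 <= e) -> `|v| ^+ 2 <= e.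
Proof.
move=> e0 H; rewrite -(sqr_sqrtr e0) ler_sqr ?nnegrE ?sqrtr_ge0 //.
apply: rV_norm_le => [|i]; first exact: sqrtr_ge0.
by rewrite -sqrtr_sqr ler_sqrt.
Qed.

Lemma quad_form_bound v (M : 'M[R]_n) :
  `|(v *m M *m v^T) 0 0| <= (\sum_i \sum_j `|M i j|) * `|v| ^+ 2.
Proof.
rewrite mxE exchange_big /= mulr_suml; apply: le_trans (ler_norm_sum _ _ _) _.
apply: ler_sum => j _; rewrite !mxE !mulr_suml; apply: le_trans (ler_norm_sum _ _ _) _.
apply: ler_sum => i _; rewrite !normrM mulrAC mulrC expr2 ler_wpM2l //.
by rewrite ler_pM // ler_coord_norm.
Qed.

Lemma row_mul_bound v (M : 'M[R]_n) :
  `|v *m M| <= (\sum_i \sum_j `|M i j|) * `|v|.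
Proof.
apply: rV_norm_le => [|j].
  by rewrite mulr_ge0 // sumr_ge0 // => i _; exact: sumr_ge0.
rewrite mxE mulr_suml; apply: le_trans (ler_norm_sum _ _ _) _.
apply: ler_sum => i _; rewrite normrM mulrC ler_pM ?ler_coord_norm //.
by rewrite (bigD1 j) //= lerDl sumr_ge0.
Qed.

Lemma mvt_bound (f df : R -> R) (t M : R) : f 0 = 0 ->
  (forall s : R, `|s| <= `|t| -> is_derive s 1 f (df s) /\ `|df s| <= M) ->
  `|f t| <= M * `|t|.
Proof.
move=> f0 H.
have cf (s : R) : `|s| <= `|t| -> {for s, continuous f}.
  move=> /H[[dfs _] _]; apply: differentiable_continuous.
  exact/derivable1_diffP.
suff [c ct E] : exists2 c : R, `|c| <= `|t| & f t = df c * t.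
  by rewrite E normrM ler_wpM2r //; have [] := H _ ct.
have [t0|t0] := leP 0 t.
  have tE (s : R) : s \in `[0, t] -> `|s| <= `|t|.
    by rewrite in_itv /= => /andP[s0 st]; rewrite !ger0_norm.
  have [||c ct E] := @MVT_segment R f df 0 t t0.
  - by move=> s /subset_itv_oo_cc /tE /H[].
  - by apply: continuous_in_subspaceT => s /set_mem /= /tE /cf.
  by exists c; [exact: tE|rewrite f0 !subr0 in E].
have tE (s : R) : s \in `[t, 0] -> `|s| <= `|t|.
  rewrite in_itv /= => /andP[ts s0].
  by rewrite ler0_norm // (ltr0_norm t0) lerN2.
have [||c ct E] := @MVT_segment R f df t 0 (ltW t0).
- by move=> s /subset_itv_oo_cc /tE /H[].
- by apply: continuous_in_subspaceT => s /set_mem /= /tE /cf.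
exists c; first exact: tE.
by move: E; rewrite f0 !sub0r mulrN => /oppr_inj.
Qed.

(** [mvt_bound] is applied to the derivative of the remainder, then to the remainder itself; this
    costs the factor 1/2 of the sharp bound. [q] is any number close to the second derivative along
    the segment. *)
Lemma taylor2 (U : set 'rV[R]_n) (u : 'rV[R]_n -> R) x v (q e t : R) :
  open U -> smooth_on U u -> 0 <= e ->
  (forall s : R, `|s| <= `|t| -> U (x + s *: v) /\
     `|\sum_j v 0 j * (\sum_i v 0 i * 'D_'e_j ('D_'e_i u) (x + s *: v)) - q| <= e) ->
  `|u (x + t *: v) - u x - t * (\sum_i v 0 i * 'D_'e_i u x) - q * t ^+ 2 / 2| <= e * t ^+ 2.
Proof.
move=> oU su e0 H.
pose p y := \sum_i v 0 i * 'D_'e_i u y.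
pose h y := \sum_j v 0 j * (\sum_i v 0 i * 'D_'e_j ('D_'e_i u) y).
have sp : smooth_on U p.
  by apply: smooth_sum => // i _; apply: smoothM => //; [exact: smooth_cst|exact: smooth_derive].
have du y : U y -> derivable u y v /\ 'D_v u y = p y.
  move=> Uy; split; first exact: (Ck1_derivable oU (su 1%N) Uy).
  exact: (derive_sumE v oU (su 1%N) Uy).
have dp y : U y -> derivable p y v /\ 'D_v p y = h y.
  move=> Uy; split; first exact: (Ck1_derivable oU (sp 1%N) Uy).
  rewrite (derive_sumE v oU (sp 1%N) Uy); apply: eq_bigr => j _; congr (_ * _).
  have -> : p = \sum_i (v 0 i \*: 'D_'e_i u).
    by apply: funext => z; rewrite fct_sumE.
  have dDu i : derivable ('D_'e_i u) y 'e_j.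
    exact: smooth_derivable (smooth_derive i su) Uy.
  rewrite derive_sum => [|i]; last exact: derivableZ.
  by apply: eq_bigr => i _; rewrite deriveZ.
pose f (s : R) := u (x + s *: v) - u x - s * p x - q * s ^+ 2 / 2.
pose f' (s : R) := p (x + s *: v) - p x - q * s.
have f0 : f 0 = 0 by rewrite /f scale0r addr0 subrr mul0r expr0n /= mulr0 mul0r !subr0.
have f'0 : f' 0 = 0 by rewrite /f' scale0r addr0 subrr mulr0 subr0.
have df (s : R) : `|s| <= `|t| -> is_derive s 1 f (f' s).
  move=> /H[Us _]; have [d1 d2] := du _ Us.
  have D1 : is_derive s 1 (fun s : R => u (x + s *: v)) (p (x + s *: v)).
    by rewrite -d2; exact: is_derive_line.
  have -> : f = (fun s : R => u (x + s *: v)) - cst (u x) - (p x \*: id) - ((q / 2) \*: (id ^+ 2)).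
    apply: funext => r; rewrite /f -[RHS]/(u (x + r *: v) - u x - p x * r - q / 2 * (r ^+ 2)).
    by rewrite [p x * r]mulrC mulrAC.
  apply: is_derive_eq; rewrite /f' subr0 [_ *: 1]mulr1 /GRing.scale /=.
  by rewrite expr1 mulr1 mulr2n; field.
have df' (s : R) : `|s| <= `|t| -> is_derive s 1 f' (h (x + s *: v) - q).
  move=> /H[Us _]; have [d1 d2] := dp _ Us.
  have D1 : is_derive s 1 (fun s : R => p (x + s *: v)) (h (x + s *: v)).
    by rewrite -d2; exact: is_derive_line.
  have -> : f' = (fun s : R => p (x + s *: v)) - cst (p x) - (q \*: id).
    by apply: funext.
  by apply: is_derive_eq; rewrite subr0 [_ *: 1]mulr1.
have B1 (s : R) : `|s| <= `|t| -> `|f' s| <= e * `|s|.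
  move=> st; apply: (mvt_bound f'0 (df := fun s : R => h (x + s *: v) - q)) => r rs.
  have rt := le_trans rs st.
  by split; [exact: df'|have [] := H _ rt].
apply: le_trans (mvt_bound f0 (df := f') (M := e * `|t|) _) _ => [s st|].
  split; first exact: df.
  by apply: le_trans (B1 _ st) _; rewrite ler_wpM2l.
by rewrite -mulrA -normrM -expr2 ger0_norm // sqr_ge0.
Qed.

(* Near a nondegenerate minimum of [u] along the line [x + R v], the points  *)
(* [x + t v] and [x - s v] at the same level satisfy [t / 2 <= s], so the    *)
(* first order term of a function of [u] has to vanish.                       *)
Lemma derive_level_eq0 (U : set 'rV[R]_n) (u F : 'rV[R]_n -> R) x v :
  open U -> smooth_on U u -> smooth_on U F -> U x ->
  (forall i, 'D_'e_i u x = 0) ->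
  0 < \sum_j v 0 j * (\sum_i v 0 i * 'D_'e_j ('D_'e_i u) x) ->
  (forall y z, U y -> U z -> u y = u z -> F y = F z) -> 'D_v F x = 0.
Proof.
move=> oU su sF Ux du0; set q := (X in 0 < X) => q0 uF.
pose h y := \sum_j v 0 j * (\sum_i v 0 i * 'D_'e_j ('D_'e_i u) y).
have sh : smooth_on U h.
  apply: smooth_sum => // j _; apply: smoothM => //; first exact: smooth_cst.
  apply: smooth_sum => // i _; apply: smoothM => //; first exact: smooth_cst.
  exact: smooth_derive (smooth_derive i su).
apply/eqP; apply/negPn/negP => D0; set D := 'D_v F x in D0.
(* The tolerance q / 20 is small enough for Taylor's formula to place u (x + t v) between u (x - (t
   / 2) v) and u (x - 2 t v), as the intermediate value theorem requires. *)
have [r r0 rP] : exists2 r : R, 0 < r & forall z, `|x - z| < r -> U z /\ `|h z - q| <= q / 20.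
  have q20 : 0 < q / 20 by rewrite divr_gt0.
  have [r1 r10 r1P] := open_norm_ball oU Ux.
  have /cvgrPdist_le /(_ _ q20) /near_norm_ball[r2 r20 r2P] := Ck_continuous (sh 0%N) Ux.
  exists (Num.min r1 r2); first by rewrite lt_min r10 r20.
  move=> z; rewrite lt_min => /andP[z1 z2]; split; first exact: r1P.
  rewrite distrC; exact: r2P z z2.
have D20 : 0 < `|D| / 2 by rewrite divr_gt0 // normr_gt0.
have [w w0 wP] : exists2 w : R, 0 < w & forall t : R, `|t| < w ->
    `|F (x + t *: v) - F x - t * D| <= `|D| / 2 * `|t|.
  have dF : derivable F x v by exact: (Ck1_derivable oU (sF 1%N) Ux).
  have /eqaddoP /(_ _ D20) /nbhs_ballP[w w0 wP] := derivable_nbhs dF.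
  exists w => // t tw; have := wP t; rewrite /ball /= sub0r normrN => /(_ tw).
  apply: le_trans; rewrite le_eqVlt; apply/orP; left; apply/eqP; congr `|_|.
  by rewrite -[RHS]/(F (t *: v + x) - (F x + t * D)) [_ + x]addrC opprD addrA.
pose rv := r / (1 + `|v|).
have rv0 : 0 < rv by rewrite divr_gt0 // ltr_pwDl.
have inB (s : R) : `|s| < rv -> `|x - (x + s *: v)| < r.
  move=> sr; rewrite opprD addrA subrr add0r normrN normrZ.
  apply: le_lt_trans (_ : `|s| * (1 + `|v|) < _).
    by rewrite ler_wpM2l // lerDr.
  by rewrite -ltr_pdivlMr // ltr_pwDl.
have tay (s : R) : `|s| < rv -> `|u (x + s *: v) - u x - q * s ^+ 2 / 2| <= q / 20 * s ^+ 2.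
  move=> sr; have := @taylor2 U u x v q (q / 20) s oU su.
  have -> : \sum_i v 0 i * 'D_'e_i u x = 0 by rewrite big1 // => i _; rewrite du0 mulr0.
  rewrite mulr0 subr0; apply; first by rewrite divr_ge0 // ltW.
  by move=> s' s's; have [] := rP _ (inB _ (le_lt_trans s's sr)).
pose m := Num.min rv w; have m0 : 0 < m by rewrite lt_min rv0 w0.
pose t := m / 4; have t0 : 0 < t by rewrite divr_gt0.
have small (s : R) : `|s| <= 2 * t -> `|s| < rv /\ `|s| < w.
  move=> st; have : `|s| < m by apply: le_lt_trans st _; rewrite /t; lra.
  by rewrite lt_min => /andP[].
have tt : `|t| <= 2 * t by rewrite gtr0_norm //; lra.
have [s sI us] : exists2 s : R, t / 2 <= s <= 2 * t & u (x + (- s) *: v) = u (x + t *: v).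
  pose f (s : R) := u (x + (- s) *: v).
  have le12 : t / 2 <= 2 * t by lra.
  have bnd (s : R) : s \in `[t / 2, 2 * t] -> `|- s| <= 2 * t.
    by rewrite in_itv /= normrN => /andP[s1 s2]; rewrite ger0_norm //; lra.
  have cf : {within `[t / 2, 2 * t], continuous f}.
    apply: continuous_in_subspaceT => s /set_mem /= sI.
    have [Us _] := rP _ (inB _ (small _ (bnd _ sI)).1).
    have fE : f = fun s : R => u (x + s *: (- v)).
      by apply: funext => s'; rewrite /f scaleNr scalerN.
    have Us' : U (x + s *: (- v)) by rewrite scalerN -scaleNr.
    have [d _] := is_derive_line (Ck1_derivable oU (su 1%N) Us' (v := - v)).
    by rewrite fE; apply: differentiable_continuous; exact/derivable1_diffP.
  have e1 : `|- (t / 2)| <= 2 * t by apply: bnd; rewrite in_itv /= lexx.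
  have e2 : `|- (2 * t)| <= 2 * t by apply: bnd; rewrite in_itv /= lexx andbT.
  have T0 := tay _ (small _ tt).1.
  have T1 := tay _ (small _ e1).1; have T2 := tay _ (small _ e2).1.
  have S : 0 < q * t ^+ 2 by rewrite mulr_gt0 // exprn_gt0.
  move: T0 T1 T2; rewrite !ler_norml => /andP[a1 a2] /andP[b1 b2] /andP[c1 c2].
  rewrite sqrrN in b1 b2; rewrite sqrrN in c1 c2.
  have h1 : f (t / 2) <= u (x + t *: v) by rewrite /f; nra.
  have h2 : u (x + t *: v) <= f (2 * t) by rewrite /f; nra.
  have [|s sI fs] := IVT le12 cf (v := u (x + t *: v)).
    by rewrite ge_min le_max h1 h2 orbT.
  by exists s => //; rewrite in_itv in sI.
have ts : `|- s| <= 2 * t.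
  by case/andP: sI => s1 s2; rewrite normrN ger0_norm //; lra.
have [Ut _] := rP _ (inB _ (small _ tt).1).
have [Us _] := rP _ (inB _ (small _ ts).1).
have E := uF _ _ Us Ut us.
have W1 := wP _ (small _ tt).2; have W2 := wP _ (small _ ts).2.
have s0 : 0 < s by case/andP: sI => s1 s2; lra.
rewrite E (gtr0_norm t0) normrN (gtr0_norm s0) in W1 W2.
(* The two points lie on opposite sides of [x]: equal values of [F] leave a linear discrepancy (t +
   s) |D|, above the total error (t + s) |D| / 2. *)
have := le_trans (ler_normB _ _) (lerD W1 W2).
have -> : F (x + t *: v) - F x - t * D - (F (x + t *: v) - F x - - s * D) = - ((t + s) * D).
  ring.
rewrite normrN normrM gtr0_norm ?addr_gt0 //.
have : 0 < (t + s) * `|D| by rewrite mulr_gt0 ?addr_gt0 // normr_gt0.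
nra.
Qed.

Lemma quadratic_remainder (W : set R) (b : R -> R) : open W -> W 0 ->
  (forall k t, W t -> derivable (derive1n k b) t 1) -> b 0 = 0 ->
  exists C d : R, [/\ 0 < C, 0 < d &
    forall t : R, `|t| < d -> `|b t - derive1 b 0 * t| <= C * t ^+ 2].
Proof.
move=> oW W0 db b0; set b1 := derive1 b 0.
have W2 : {for 0, continuous (derive1n 2 b)}.
  by apply: differentiable_continuous; exact/derivable1_diffP/db.
have near1 (p q : R) : `|p - q| < 1 -> `|q| <= `|p| + 1.
  move=> pq; have -> : q = p - (p - q) by ring.
  by apply: le_trans (ler_normB _ _) _; rewrite lerD2l ltW.
pose C := `|derive1n 2 b 0| + 1; have C0 : 0 < C by rewrite ltr_wpDl.
have [d d0 dP] : exists2 d : R, 0 < d & forall t : R, `|t| < d -> W t /\ `|derive1n 2 b t| <= C.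
  have H1 : \forall t \near (0 : R), W t by apply: open_nbhs_nbhs.
  have /cvgrPdist_lt /(_ _ ltr01) H2 := W2.
  have H3 : \forall t \near (0 : R), W t /\ `|derive1n 2 b 0 - derive1n 2 b t| < 1.
    by near=> t; split; near: t.
  have /nbhs_ballP[d d0 dP] := H3.
  exists d => // t td; have := dP t; rewrite /ball /= sub0r normrN => /(_ td)[Wt h].
  split=> //; exact: near1 h.
exists C, d; split=> // t td.
pose f (s : R) := b s - b1 * s; pose f' (s : R) := derive1 b s - b1.
have df (s : R) : `|s| <= `|t| -> is_derive s 1 f (f' s).
  move=> st; have [Ws _] := dP _ (le_lt_trans st td).
  have D : is_derive s 1 b (derive1 b s).
    by split; [exact: (db 0%N)|rewrite derive1E].
  have -> : f = b - (b1 \*: id) by apply: funext.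
  by apply: is_derive_eq; rewrite [_ *: 1]mulr1.
have df' (s : R) : `|s| <= `|t| -> is_derive s 1 f' (derive1n 2 b s).
  move=> st; have [Ws _] := dP _ (le_lt_trans st td).
  have D : is_derive s 1 (derive1 b) (derive1n 2 b s).
    by split; [exact: (db 1%N)|rewrite derive1nS derive1E].
  have -> : f' = derive1 b - cst b1 by apply: funext.
  by apply: is_derive_eq; rewrite subr0.
have f0 : f 0 = 0 by rewrite /f b0 mulr0 subr0.
have f'0 : f' 0 = 0 by rewrite /f' subrr.
have B1 (s : R) : `|s| <= `|t| -> `|f' s| <= C * `|s|.
  move=> st; apply: (mvt_bound f'0 (df := derive1n 2 b)) => r rs.
  have rt := le_trans rs st; split; first exact: df'.
  by have [] := dP _ (le_lt_trans rt td).
apply: le_trans (mvt_bound f0 (df := f') (M := C * `|t|) _) _ => [s st|].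
  split; first exact: df.
  by apply: le_trans (B1 _ st) _; rewrite ler_wpM2l // ltW.
by rewrite -mulrA -normrM -expr2 ger0_norm // sqr_ge0.
Unshelve. all: by end_near. Qed.

(** A Gronwall argument: at a maximum of [u] on a segment centred at [x0], the mean value theorem
    bounds the maximum by n K |v| times itself, and n K |v| < 1. *)
Lemma zero_near_of_gradient_bound (u : 'rV[R]_n -> R) x0 (K r : R) :
  0 <= K -> 0 < r -> u x0 = 0 ->
  (forall x, `|x0 - x| < r -> [/\ 0 <= u x, differentiable u x &
       forall i, `|'D_'e_i u x| <= K * u x]) ->
  \forall x \near x0, u x = 0.
Proof.
move=> K0 r0 ux0 H; pose e := Num.min r (1 + n%:R * K)^-1.
have nK : 0 < 1 + n%:R * K by rewrite ltr_pwDl // mulr_ge0.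
have e0 : 0 < e by rewrite lt_min r0 invr_gt0.
apply/near_norm_ball; exists e => // x; rewrite lt_min => /andP[xr xe].
pose v := x - x0; pose f (t : R) := u (x0 + t *: v).
have inB (t : R) : `|t| <= 1 -> `|x0 - (x0 + t *: v)| < r.
  move=> t1; rewrite opprD addrA subrr add0r normrN normrZ.
  by apply: le_lt_trans xr; rewrite distrC ler_piMl.
have tE (t : R) : t \in `[-1, 1] -> `|t| <= 1 by rewrite in_itv /= -ler_norml.
have cf : {within `[-1, 1], continuous f}.
  apply: continuous_in_subspaceT => t /set_mem /= /tE t1.
  have [_ du _] := H _ (inB _ t1).
  have [d _] := is_derive_line (diff_derivable (v := v) du).
  by apply: differentiable_continuous; exact/derivable1_diffP.
have m1 : (-1 : R) <= 1 by lra.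
have [t tI tmax] := EVT_max m1 cf; have t1 := tE _ tI.
have [|c ct E] := @MVT_line R n u x0 v t.
  by move=> s st; have [_ du _] := H _ (inB _ (le_trans st t1)); exact: diff_derivable.
have c1 := le_trans ct t1; have [uc du Du] := H _ (inB _ c1).
have cI : c \in `[-1, 1] by rewrite in_itv /= -ler_norml.
have Dv : `|'D_v u (x0 + c *: v)| <= n%:R * K * `|v| * f t.
  rewrite (differentiable_derive_sumE v du).
  apply: le_trans (ler_norm_sum _ _ _) _.
  apply: le_trans (_ : \sum_(i < n) `|v| * (K * f t) <= _).
    apply: ler_sum => i _; rewrite normrM ler_pM // ?ler_coord_norm //.
    by apply: le_trans (Du i) _; rewrite ler_wpM2l //; exact: tmax.
  by rewrite sumr_const card_ord -mulr_natl; rewrite le_eqVlt; apply/orP; left; apply/eqP; ring.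
have ft0 : 0 <= f t by apply: le_trans uc _; exact: tmax.
have vsmall : n%:R * K * `|v| < 1.
  have vx : `|v| < (1 + n%:R * K)^-1 by rewrite /v distrC.
  have nK0 : 0 <= n%:R * K by rewrite mulr_ge0.
  apply: le_lt_trans (_ : (1 + n%:R * K) * `|v| < 1).
    by rewrite ler_wpM2r // lerDr.
  by rewrite mulrC -ltr_pdivlMr // mul1r.
have ft : f t <= n%:R * K * `|v| * f t.
  have ftE : f t = t * 'D_v u (x0 + c *: v) by rewrite -E ux0 subr0.
  rewrite {1}ftE; apply: le_trans (ler_norm _) _; rewrite normrM.
  by apply: le_trans Dv; rewrite ler_piMl.
have f0 : f t = 0 by apply/eqP; rewrite eq_le ft0 andbT; nra.
have xE : x = x0 + 1 *: v by rewrite scale1r /v addrC subrK.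
have [u0 _ _] := H x xr; apply/eqP; rewrite eq_le u0 andbT.
by rewrite -f0 [in leLHS]xE; apply: tmax; rewrite in_itv /= lexx m1.
Qed.

End TaylorEstimates.

(** * Transnormal functions in a chart *)

Section LocalTransnormal.
Context {R : realType} {n : nat}.
Variables (U : set 'rV[R]_n) (g : 'rV[R]_n -> 'M[R]_n) (u : 'rV[R]_n -> R).
Variables (W : set R) (beta : R -> R).
Hypotheses (oU : open U) (gs : mx_smooth U g) (su : smooth_on U u).
Hypothesis gT : forall x, U x -> (g x)^T = g x.
Hypothesis gpos : forall x, U x -> forall v, v != 0 -> 0 < inner (g x) v v.
Hypothesis sbeta : forall k t, W t -> derivable (derive1n k beta) t 1.
Hypothesis uW : forall x, U x -> W (u x).
Hypothesis u_ge0 : forall x, U x -> 0 <= u x.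
Hypothesis eikonal : forall x, U x ->
  inner (g x) (gradient g u x) (gradient g u x) = beta (u x).

Let G x := invmx (g x).
Let P x : 'rV[R]_n := \row_i 'D_'e_i u x.

Lemma metric_unit x : U x -> g x \in unitmx.
Proof.
move=> Ux; rewrite -row_free_unit -kermx_eq0; apply/rowV0P => v /sub_kermxP vg.
apply/eqP; apply: contraT => /(gpos Ux); rewrite /inner vg mul0mx mxE ltxx //.
Qed.

Let sG : mx_smooth U G.
Proof. exact: (mx_smooth_inv oU metric_unit gs). Qed.

Let sP : mx_smooth U P.
Proof.
by move=> i j; apply: (smooth_ext oU _ (smooth_derive j su)) => x _; rewrite mxE.
Qed.

Lemma inv_metric_sym x : U x -> (G x)^T = G x.
Proof. by move=> Ux; rewrite /G trmx_inv gT. Qed.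

Lemma eikonal_covector x : U x -> (P x *m G x *m (P x)^T) 0 0 = beta (u x).
Proof.
move=> Ux; rewrite -(eikonal Ux) /inner /gradient -/(P x) -/(G x).
by rewrite trmx_mul inv_metric_sym // -!mulmxA [g x *m _]mulmxA mulmxV ?metric_unit // mul1mx.
Qed.

(** A zero of the nonnegative function [u] is a minimum along every line. *)
Lemma derive_at_zero x v : U x -> u x = 0 -> 'D_v u x = 0.
Proof.
move=> Ux ux0; have [r r0 rU] := open_norm_ball oU Ux.
pose s := r / (1 + `|v|).
have s0 : 0 < s by rewrite divr_gt0 // ltr_pwDl.
have inU t : t \in `](- s), s[ -> U (x + t *: v).
  rewrite in_itv /= -ltr_norml => ts; apply: rU.
  rewrite opprD addrA subrr add0r normrN normrZ.
  apply: le_lt_trans (_ : `|t| * (1 + `|v|) < _); first by rewrite ler_wpM2l // lerDr.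
  by rewrite -ltr_pdivlMr // ltr_pwDl.
have du t : t \in `](- s), s[ -> is_derive t 1 (fun t : R => u (x + t *: v)) ('D_v u (x + t *: v)).
  by move=> /inU Ut; apply: is_derive_line; exact: Ck1_derivable (su 1%N) Ut.
have s00 : 0 \in `](- s), s[ by rewrite in_itv /= oppr_lt0 s0.
have [||||_ E0] := @derive1_at_min _ (fun t : R => u (x + t *: v)) (- s) s 0.
- by rewrite ge0_cp // ltW.
- by move=> t /du[].
- by [].
- by move=> t /inU Ut; rewrite scale0r addr0 ux0; exact: u_ge0.
by have [_] := du _ s00; rewrite E0 scale0r addr0.
Qed.

Lemma covector_at_zero x : U x -> u x = 0 -> P x = 0.
Proof. by move=> Ux ux0; apply/rowP => i; rewrite !mxE derive_at_zero. Qed.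

Definition hess x : 'M[R]_n := \matrix_(i, j) 'D_'e_i ('D_'e_j u) x.

Lemma hess_row i x : Dmx i P x = row i (hess x).
Proof.
by apply/rowP => j; rewrite !mxE; apply: eq_derive => y; rewrite mxE.
Qed.

Lemma hess_form (z : 'rV[R]_n) x :
  \sum_j z 0 j * (\sum_i z 0 i * 'D_'e_j ('D_'e_i u) x) = (z *m hess x *m z^T) 0 0.
Proof.
rewrite quad_formE; apply: eq_bigr => j _; congr (_ * _).
by apply: eq_bigr => i _; rewrite [in RHS]mxE.
Qed.

Lemma hess_sym x : U x -> (hess x)^T = hess x.
Proof.
by move=> Ux; apply/matrixP => i j; rewrite !mxE (derive_comm _ _ oU (su 2%N) Ux).
Qed.

Let shess : mx_smooth U hess.
Proof.
move=> i j; apply: (smooth_ext oU _ (smooth_derive i (smooth_derive j su))) => x _.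
by rewrite mxE.
Qed.

(* The first order consequence of the eikonal equation is [Y c *m P^T = beta' * P c]. *)
Let Y c x := P x *m Dmx c G x + 2 *: (Dmx c P x *m G x).

Let sY c : mx_smooth U (Y c).
Proof.
apply: mx_smooth_add => //.
  by apply: mx_smooth_mul => //; exact: mx_smooth_derive.
apply: mx_smooth_scale => //; apply: mx_smooth_mul => //; exact: mx_smooth_derive.
Qed.

Let beta1 x : 'M[R]_1 := const_mx (derive1 beta (u x)).
Let Pc c x : 'M[R]_1 := const_mx ('D_'e_c u x).

Let sbeta1 : mx_smooth U beta1.
Proof.
move=> i j; have H : smooth_on U (derive1 beta \o u).
  apply: (smooth_comp1 oU _ uW su) => k t Wt.
  by have := @sbeta k.+1 t Wt; rewrite derive1Sn.
by apply: (smooth_ext oU _ H) => x _; rewrite mxE.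
Qed.

Let sPc c : mx_smooth U (Pc c).
Proof. by move=> i j; apply: (smooth_ext oU _ (smooth_derive c su)) => x _; rewrite mxE. Qed.

(** Symmetry of [G] merges the two terms in which [P] is differentiated, whence the factor 2 in
    [Y]. *)
Lemma eikonal_derive c x : U x -> Y c x *m (P x)^T = beta1 x *m Pc c x.
Proof.
move=> Ux; pose E x := P x *m G x *m (P x)^T.
have sPG : mx_smooth U (fun x => P x *m G x) by exact: mx_smooth_mul.
have sPT : mx_smooth U (fun x => (P x)^T) by exact: mx_smooth_tr.
have -> : Y c x *m (P x)^T = Dmx c E x.
  rewrite /E (Dmx_mul c sPG sPT Ux) (Dmx_mul c sP sG Ux) Dmx_tr.
  have -> : P x *m G x *m (Dmx c P x)^T = Dmx c P x *m G x *m (P x)^T.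
    exact: bilinear_sym (inv_metric_sym Ux).
  by rewrite /Y !mulmxDl -scalemxAl scaler_nat mulr2n addrA [X in X + _]addrC.
pose B x : 'M[R]_1 := const_mx (beta (u x)).
rewrite (@Dmx_ext _ _ U oU _ _ c E B) //; last first.
  by move=> y Uy; apply/matrixP => i j; rewrite !ord1 [RHS]mxE -eikonal_covector.
apply/matrixP => i j; rewrite !ord1 mxE.
have -> : (beta1 x *m Pc c x) 0 0 = derive1 beta (u x) * 'D_'e_c u x.
  by rewrite mxE big_ord1 !mxE.
have H := is_derive_comp1 (@sbeta 0%N _ (uW Ux)) (smooth_derivable (i := c) su Ux).
transitivity ('D_'e_c (beta \o u) x); last by case: H.
by apply: eq_derive => y; rewrite mxE.
Qed.

Variable x0 : 'rV[R]_n.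
Hypotheses (Ux0 : U x0) (ux0 : u x0 = 0).

Definition third (a : 'I_n) : 'M[R]_n := Dmx a hess x0.

Variable mu : R.
Hypothesis mu2 : 2 * mu = derive1 beta 0.

Let P0 : P x0 = 0. Proof. exact: covector_at_zero. Qed.

Let Y0 c : Y c x0 = 2 *: (row c (hess x0) *m G x0).
Proof. by rewrite /Y P0 mul0mx add0r hess_row. Qed.

(** Differentiate [eikonal_derive] at [x0]: as du vanishes there, only the terms in which the last
    factor is differentiated survive, and they read 2 H G H = beta'(0) H. *)
Lemma hess_projection : hess x0 *m G x0 *m hess x0 = mu *: hess x0.
Proof.
apply/matrixP => c b.
have E : Dmx b (fun y => Y c y *m (P y)^T) x0 = Dmx b (fun y => beta1 y *m Pc c y) x0.
  by apply: (Dmx_ext oU) => // y; exact: eikonal_derive.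
have sPT : mx_smooth U (fun x => (P x)^T) by exact: mx_smooth_tr.
move: E; rewrite (Dmx_mul b (@sY c) sPT Ux0) (Dmx_mul b sbeta1 (@sPc c) Ux0).
rewrite Dmx_tr P0 trmx0 mulmx0 add0r Y0 hess_row.
have -> : Pc c x0 = 0.
  by apply/matrixP => i j; rewrite !mxE derive_at_zero.
rewrite mulmx0 add0r => /matrixP /(_ 0 0).
have -> : (beta1 x0 *m Dmx b (Pc c) x0) 0 0 = derive1 beta 0 * hess x0 c b.
  rewrite mxE big_ord1 !mxE ux0; congr (_ * _).
  transitivity ('D_'e_b ('D_'e_c u) x0).
    by apply: eq_derive => y; rewrite mxE.
  exact: derive_comm oU (su 2%N) Ux0.
have -> : (2 *: (row c (hess x0) *m G x0) *m (row b (hess x0))^T) 0 0 =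
   2 * (hess x0 *m G x0 *m hess x0) c b.
  rewrite -scalemxAl mxE -row_mul row_mul_tr_row hess_sym //.
move=> E; rewrite [RHS]mxE; apply: (@mulfI _ 2); first by rewrite pnatr_eq0.
by rewrite E mulrA; congr (_ * _); exact: esym mu2.
Qed.

Lemma third_row a b : Dmx a (Dmx b P) x0 = row b (third a).
Proof.
rewrite (@Dmx_ext _ _ U oU _ _ a (Dmx b P) (fun y => row b (hess y))) //; last first.
  by move=> y Uy; exact: hess_row.
by apply/rowP => j; rewrite !mxE; apply: eq_derive => y; rewrite mxE.
Qed.

Lemma third_comm a b c : third a b c = third b a c.
Proof.
have rE (M : 'M[R]_n) i j : (row i M) 0 j = M i j by rewrite mxE.
have E := DDmx_comm oU a b sP Ux0; rewrite (third_row a b) (third_row b a) in E.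
transitivity ((row b (third a)) 0 c).
  exact: (esym (rE (third a) b c)).
rewrite E.
exact: (rE (third b) a c).
Qed.

Lemma third_sym a b c : third a b c = third a c b.
Proof.
have := @Dmx_ext _ _ U oU _ _ a (fun y => (hess y)^T) hess x0.
rewrite Dmx_tr => H; have {}H := H hess_sym Ux0.
by rewrite /third -[in LHS]H [LHS]mxE.
Qed.

Let DY a c : Dmx a (Y c) x0 = row a (hess x0) *m Dmx c G x0 +
  2 *: (row c (third a) *m G x0 + row c (hess x0) *m Dmx a G x0).
Proof.
have sDG : mx_smooth U (Dmx c G) by exact: mx_smooth_derive.
have sDP : mx_smooth U (Dmx c P) by exact: mx_smooth_derive.
have s1 : mx_smooth U (fun y => P y *m Dmx c G y) by exact: mx_smooth_mul.
have s2 : mx_smooth U (fun y => Dmx c P y *m G y) by exact: mx_smooth_mul.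
have s3 : mx_smooth U (fun y => 2 *: (Dmx c P y *m G y)) by exact: mx_smooth_scale.
rewrite /Y (Dmx_add a s1 s3 Ux0) (Dmx_scale a 2 s2 Ux0).
rewrite (Dmx_mul a sP sDG Ux0) (Dmx_mul a sDP sG Ux0) P0 mul0mx addr0.
by rewrite third_row !hess_row.
Qed.

(** [eikonal_derive] is differentiated twice more at [x0]. Terms in which a factor du is left
    undifferentiated vanish, so only first derivatives of the dual metric remain. *)
Lemma eikonal_cubic a b c (H := hess x0) (Gd := fun a => Dmx a G x0) (T := third) :
  (H *m Gd c *m H) a b + (H *m Gd c *m H) b a +
  2 * ((H *m Gd a *m H) c b + (T a *m G x0 *m H) c b + (H *m Gd b *m H) c a
       + (T b *m G x0 *m H) c a + \sum_j (H *m G x0) c j * T j a b)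
  = 2 * mu * T a b c.
Proof.
have E : Dmx a (Dmx b (fun y => Y c y *m (P y)^T)) x0 =
         Dmx a (Dmx b (fun y => beta1 y *m Pc c y)) x0.
  apply: (Dmx_ext oU) => // y Uy; apply: (Dmx_ext oU) => // z.
  exact: eikonal_derive.
have sPT : mx_smooth U (fun x => (P x)^T) by exact: mx_smooth_tr.
have PT0 : (P x0)^T = 0 by rewrite P0 trmx0.
have Pc0 : Pc c x0 = 0.
  by apply/matrixP => i j; rewrite !mxE derive_at_zero.
(* The derivative of beta'(u) is beta''(u) du, which is zero at [x0]. *)
have Db1 d : Dmx d beta1 x0 = 0.
  apply/matrixP => i j; rewrite !mxE.
  have db : derivable (derive1 beta) (u x0) 1.
    by have := @sbeta 1%N _ (uW Ux0); rewrite derive1n1.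
  have D := is_derive_comp1 db (smooth_derivable (i := d) su Ux0).
  transitivity ('D_'e_d (derive1 beta \o u) x0).
    by apply: eq_derive => y; rewrite mxE.
  by case: D => _ ->; rewrite (derive_at_zero _ Ux0 ux0) mulr0.
have EL := DDmx_mul_vanish oU a b (@sY c) sPT Ux0 PT0.
have ER := DDmx_mul_vanish2 oU sbeta1 (@sPc c) Ux0 Pc0 (Db1 a) (Db1 b).
have {EL ER}E := etrans (esym EL) (etrans E ER).
have {E} := congr1 (fun M : 'M[R]_1 => M 0 0) E.
have -> : (beta1 x0 *m Dmx a (Dmx b (Pc c)) x0) 0 0 = 2 * mu * T a b c.
  rewrite mxE big_ord1 !mxE ux0 mu2; congr (_ * _).
  apply: (near_eq_derive); near=> y.
  rewrite !mxE; apply: eq_derive => z.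
  by rewrite mxE.
have DPT d y : Dmx d (fun y => (P y)^T) y = (Dmx d P y)^T by exact: Dmx_tr.
have -> : Dmx a (Dmx b (fun y => (P y)^T)) x0 = (row b (third a))^T.
  have -> : Dmx b (fun y => (P y)^T) = fun y => (Dmx b P y)^T.
    by apply: funext => y; exact: DPT.
  by rewrite Dmx_tr (third_row a b).
rewrite !DPT !hess_row Y0 !DY.
move=> <-; apply: etrans (esym (third_order_entries _ _ _ _ _ _ _ _ _ (hess_sym Ux0))).
congr (_ + 2 * (_ + _)); apply: eq_bigr => j _; congr (_ * _).
exact: esym (etrans (third_sym a b j) (third_comm a j b)).
Unshelve. all: by end_near. Qed.


Lemma coord_le_dual_norm x (d : 'rV[R]_n) i : U x ->
  d 0 i ^+ 2 <= (d *m G x *m d^T) 0 0 * g x i i.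
Proof.
move=> Ux; apply: dual_norm_coord.
- by rewrite mulmxV // metric_unit.
- exact: gT.
- exact: inv_metric_sym.
- exact: gpos.
Qed.

Lemma metric_diag_ge0 x i : U x -> 0 <= g x i i.
Proof. by move=> Ux; apply: ltW; apply: posdef_diag_gt0; exact: gpos. Qed.

Lemma inv_metric_ge0 x (d : 'rV[R]_n) : U x -> 0 <= (d *m G x *m d^T) 0 0.
Proof.
move=> Ux; have [->|d0] := eqVneq d 0; first by rewrite !mul0mx mxE.
have GP : d *m G x != 0.
  apply: contraNneq d0 => PG; rewrite -[d]mulmx1 -(mulVmx (metric_unit Ux)).
  by rewrite mulmxA PG mul0mx.
have := gpos Ux GP; rewrite /inner trmx_mul inv_metric_sym // -mulmxA [g x *m _]mulmxA.
by rewrite mulmxV ?metric_unit // mul1mx => /ltW.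
Qed.

(** By Cauchy-Schwarz each partial derivative satisfies P_i^2 <= g_ii |du|^2 = g_ii beta(u), and the
    g_ii are bounded near [x0]. *)
Lemma gradient_bound_near : exists2 A : R, 0 < A &
  \forall x \near x0, U x /\ forall i, P x 0 i ^+ 2 <= A * beta (u x).
Proof.
pose A := 1 + \sum_i (g x0 i i + 1).
have sum_ge0 : 0 <= \sum_i (g x0 i i + 1).
  by apply: sumr_ge0 => i _; rewrite addr_ge0 // metric_diag_ge0.
exists A; first by rewrite ltr_pwDl.
have cg : \forall x \near x0, forall i, g x i i <= g x0 i i + 1.
  apply: near_forall_ord => i.
  have := smooth_near (gs i i) Ux0 ltr01; apply: filterS => x /(le_trans (ler_norm _)).
  by rewrite lerBlDl.
near=> x.
have Ux : U x by near: x; exact: near_open.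
split=> // i; apply: le_trans (coord_le_dual_norm (P x) i Ux) _.
have gxi : g x i i <= A.
  have gi : g x i i <= g x0 i i + 1 by move: i; near: x.
  apply: le_trans gi _; rewrite /A (bigD1 i) //= addrCA lerDl addr_ge0 //.
  by apply: sumr_ge0 => j _; rewrite addr_ge0 // metric_diag_ge0.
rewrite eikonal_covector // mulrC ler_wpM2r // -eikonal_covector //.
exact: inv_metric_ge0.
Unshelve. all: by end_near. Qed.

Hypothesis oW : open W.

Let W0 : W 0. Proof. by rewrite -ux0; exact: uW. Qed.

Let beta0 : beta 0 = 0.
Proof. by rewrite -ux0 -eikonal_covector // P0 !mul0mx mxE. Qed.

(** If mu <= 0, then beta(u) <= 2 mu u + C u^2 <= C u^2, so the partials of [u] are bounded by a
    multiple of [u]. *)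
Lemma zero_near_of_derive_le0 : mu <= 0 -> \forall x \near x0, u x = 0.
Proof.
move=> mu0; have [C [d [C0 d0 Cd]]] := quadratic_remainder oW W0 sbeta beta0.
have [A A0 HA] := gradient_bound_near.
(* Chosen so that K^2 >= A C, which avoids a square root. *)
pose K := A * C + 1; have K1 : 1 <= K by rewrite lerDr mulr_ge0 // ltW.
have H : \forall x \near x0, [/\ 0 <= u x, differentiable u x &
       forall i : 'I_n, `|'D_'e_i u x| <= K * u x].
  near=> x.
  have [Ux Px] : U x /\ forall i, P x 0 i ^+ 2 <= A * beta (u x) by near: x.
  have ud : `|u x| < d.
    have ud2 : `|u x - u x0| <= d / 2.
      by near: x; apply: smooth_near su Ux0 _; rewrite divr_gt0.
    by rewrite ux0 subr0 in ud2; apply: le_lt_trans ud2 _; lra.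
  split; [exact: u_ge0|exact: Ck1_differentiable oU (su 1%N) Ux|move=> i].
  have u0 := u_ge0 Ux; have := Px i; rewrite mxE => Pi.
  have Bu : beta (u x) <= C * u x ^+ 2.
    have := Cd _ ud; rewrite ler_norml => /andP[_].
    rewrite -mu2 => h; nra.
  have Ku : 0 <= K * u x by rewrite mulr_ge0 //; lra.
  rewrite -[leRHS]ger0_norm // -ler_sqr ?nnegrE ?normr_ge0 // !real_normK ?num_real //.
  apply: le_trans Pi _; apply: le_trans (_ : A * (C * u x ^+ 2) <= _).
    by rewrite ler_wpM2l // ltW.
  rewrite exprMn mulrA ler_wpM2r ?sqr_ge0 // expr2.
  have AC0 : 0 <= A * C by rewrite mulr_ge0 // ltW.
  rewrite /K; nra.
have [r r0 rP] := (near_norm_ball _ _).1 H.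
by apply: (zero_near_of_gradient_bound _ r0 ux0 rP); lra.
Unshelve. all: by end_near. Qed.

Hypothesis mu_gt0 : 0 < mu.

Let H0 := hess x0.
Let G0 := G x0.

Let G0u : G0 \in unitmx. Proof. by rewrite unitmx_inv metric_unit. Qed.

Lemma hessian_at_zero : hessian g u x0 = H0.
Proof.
apply/matrixP => i j; rewrite !mxE big1 ?subr0 // => l _.
by rewrite derive_at_zero // mulr0.
Qed.

Lemma rank_hess : (\rank H0)%:R * mu = laplacian g u x0.
Proof.
rewrite /laplacian hessian_at_zero.
have gG : g x0 *m G x0 = 1%:M by rewrite mulmxV // metric_unit.
by apply: (rank_projection gG _ hess_projection); rewrite gt_eqF.
Qed.

(* Along [z = d G0], which [H0] kills, [u] has almost no second derivative    *)
(* but first derivative at least [|d|^2 / A]; stepping from [x] along [- z]   *)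
(* would make [u] negative unless [d = 0].                                     *)
Lemma zero_of_degenerate_gradient :
  \forall x \near x0, P x *m G0 *m H0 = 0 -> u x = 0.
Proof.
have [C [d [C0 d0 Cd]]] := quadratic_remainder oW W0 sbeta beta0.
pose A := 1 + \sum_i g x0 i i.
have A0 : 0 < A by rewrite ltr_pwDl // sumr_ge0 // => i _; exact: metric_diag_ge0.
pose B := 1 + \sum_i \sum_j (`|G0 i j| + 1).
have B0 : 0 < B.
  by rewrite ltr_pwDl // sumr_ge0 // => i _; rewrite sumr_ge0 // => j _; rewrite addr_ge0.
have G_near : \forall x \near x0, forall i j, `|G x i j| <= `|G0 i j| + 1.
  apply: near_forall_ord => i; apply: near_forall_ord => j.
  have := smooth_near (sG i j) Ux0 ltr01; apply: filterS => x h.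
  rewrite -(subrK (G0 i j) (G x i j)) addrC.
  by apply: le_trans (ler_normD _ _) _; rewrite lerD2l.
(* Step length: the first order gain T q is at least 2 B m^2 / mu, twice the upper bound for u x. *)
pose T := 2 * A * B / mu; have T0 : 0 < T by rewrite divr_gt0 // !mulr_gt0.
have TE : T = 2 * A * B / mu by [].
clearbody T.
(* This makes the second order error M T^2 equal to B m^2 / (2 mu), too small to offset the gain: 1
   - 2 + 1/2 < 0. *)
pose e := B / mu / (2 * T ^+ 2 * (B * n.+1%:R) ^+ 2).
have e0 : 0 < e by rewrite !(divr_gt0, mulr_gt0, exprn_gt0).
have eE : e = B / mu / (2 * T ^+ 2 * (B * n.+1%:R) ^+ 2) by [].
clearbody e.
have H_near : \forall x \near x0, U x /\ forall i j, `|hess x i j - H0 i j| <= e.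
  near=> x; split; first by near: x; exact: near_open.
  near: x; apply: near_forall_ord => i; apply: near_forall_ord => j.
  exact: smooth_near (shess i j) Ux0 e0.
have [r r0 rP] := (near_norm_ball _ _).1 H_near.
have P_near : \forall x \near x0, `|P x| <= r / (4 * T * B).
  have s0 : 0 < r / (4 * T * B) by rewrite divr_gt0 // mulr_gt0 // mulr_gt0.
  near=> x; apply: rV_norm_le => [|i]; first exact: ltW.
  move: i; near: x; apply: near_forall_ord => i.
  have := smooth_near (sP 0 i) Ux0 s0; apply: filterS => x.
  have -> : P x0 0 i = 0 by rewrite P0 mxE.
  by rewrite subr0.
have dmu : 0 < Num.min (d / 2) (mu / C) by rewrite lt_min !divr_gt0.
near=> x => PGH.
have Ux : U x by near: x; exact: near_open.
have xr : `|x0 - x| < r / 2.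
  by near: x; apply/near_norm_ball; exists (r / 2) => //; rewrite divr_gt0.
set m := `|P x|; have m0 : 0 <= m by exact: normr_ge0.
have mr : m <= r / (4 * T * B) by rewrite /m; near: x.
have ux_ge0 := u_ge0 Ux.
have umin : `|u x| <= Num.min (d / 2) (mu / C).
  by rewrite -[u x]subr0 -ux0; near: x; exact: smooth_near su Ux0 dmu.
move: umin; rewrite (ger0_norm ux_ge0) le_min => /andP[ud uC].
have gx_near i j : `|G x i j| <= `|G0 i j| + 1 by move: i j; near: x.
have sumG : \sum_i \sum_j `|G x i j| <= B.
  apply: le_trans (_ : \sum_i \sum_j (`|G0 i j| + 1) <= _); last by rewrite lerDr.
  by apply: ler_sum => i _; apply: ler_sum => j _.
have sumG0 : \sum_i \sum_j `|G0 i j| <= B.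
  apply: le_trans (_ : \sum_i \sum_j (`|G0 i j| + 1) <= _); last by rewrite lerDr.
  by apply: ler_sum => i _; apply: ler_sum => j _; rewrite lerDl.
(* Where C u <= mu, one has beta(u) >= 2 mu u - C u^2 >= mu u. *)
have bu : mu * u x <= B * m ^+ 2.
  apply: le_trans (_ : beta (u x) <= _).
    have udd : `|u x| < d by rewrite ger0_norm //; lra.
    have := Cd _ udd; rewrite -mu2 ler_norml => /andP[h _].
    have : C * u x <= mu by rewrite mulrC -ler_pdivlMr.
    nra.
  rewrite -eikonal_covector //; apply: le_trans (ler_norm _) _.
  apply: le_trans (quad_form_bound (P x) (G x)) _.
  by rewrite ler_wpM2r // sqr_ge0.
set q := (P x *m G0 *m (P x)^T) 0 0.
have q0 : 0 <= q by exact: inv_metric_ge0.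
have mq : m ^+ 2 <= A * q.
  apply: rV_norm_sqr_le => [|i]; first by rewrite mulr_ge0 // ltW.
  apply: le_trans (coord_le_dual_norm (P x) i Ux0) _; rewrite mulrC ler_wpM2r //.
  rewrite /A (bigD1 i) //= addrCA lerDl addr_ge0 // sumr_ge0 // => l _.
  exact: metric_diag_ge0.
pose z := P x *m G0.
have zm : `|z| <= B * m.
  by apply: le_trans (row_mul_bound (P x) G0) _; rewrite ler_wpM2r.
pose M := e * (B * n.+1%:R) ^+ 2 * m ^+ 2.
have ME : M = e * (B * n.+1%:R) ^+ 2 * m ^+ 2 by [].
have M0 : 0 <= M by apply: mulr_ge0 (sqr_ge0 _); apply: mulr_ge0 (sqr_ge0 _); exact: ltW.
clearbody M.
have inB (s : R) : `|s| <= `|- T| -> U (x + s *: z) /\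
    `|\sum_j z 0 j * (\sum_i z 0 i * 'D_'e_j ('D_'e_i u) (x + s *: z)) - 0| <= M.
  rewrite normrN (gtr0_norm T0) => sT.
  have sz : `|s *: z| <= r / 4.
    rewrite normrZ; apply: le_trans (_ : T * (B * m) <= _); first by rewrite ler_pM.
    apply: le_trans (_ : T * (B * (r / (4 * T * B))) <= _).
      by rewrite !ler_wpM2l // ltW.
    by rewrite le_eqVlt; apply/orP; left; apply/eqP; field; rewrite !gt_eqF.
  have yr : `|x0 - (x + s *: z)| < r.
    rewrite opprD addrA; apply: le_lt_trans (ler_normB _ _) _; lra.
  have [Uy hy] := rP _ yr; split=> //; rewrite subr0.
  rewrite hess_form -(quad_form_sub (hess (x + s *: z)) PGH).
  apply: le_trans (quad_form_bound _ _) _.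
  apply: le_trans (_ : (\sum_(i < n) \sum_(j < n) e) * (B * m) ^+ 2 <= _).
    rewrite ler_pM ?sqr_ge0 //.
    - by rewrite sumr_ge0 // => i _; exact: sumr_ge0.
    - by apply: ler_sum => i _; apply: ler_sum => j _; rewrite mxBE.
    - by rewrite ler_sqr ?nnegrE ?normr_ge0 ?mulr_ge0 // ltW.
  rewrite sum_const2.
  have -> : M = n.+1%:R ^+ 2 * e * (B * m) ^+ 2 by rewrite ME; ring.
  rewrite ler_wpM2r ?sqr_ge0 // ler_wpM2r ?(ltW e0) //.
  by rewrite ler_sqr ?nnegrE ?ler0n // ler_nat.
have := taylor2 oU su M0 inB.
have -> : \sum_i z 0 i * 'D_'e_i u x = q.
  by rewrite /q mxE; apply: eq_bigr => i _; rewrite !mxE.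
rewrite 2!mul0r subr0 => tay.
have U1 : 0 <= u (x + - T *: z) by apply: u_ge0; have [] := inB (- T) (lexx _).
move: tay; rewrite sqrrN ler_norml => /andP[_ tay].
have MT : M * T ^+ 2 = B / mu * m ^+ 2 / 2.
  by rewrite ME eE; field; rewrite !gt_eqF.
have uB : u x <= B / mu * m ^+ 2.
  by rewrite mulrAC ler_pdivlMr // mulrC.
have Tq : 2 * (B / mu * m ^+ 2) <= T * q.
  have -> : 2 * (B / mu * m ^+ 2) = 2 * B / mu * m ^+ 2 by ring.
  have -> : T * q = 2 * B / mu * (A * q) by rewrite TE; ring.
  by rewrite ler_wpM2l // divr_ge0 ?mulr_ge0 // ltW.
have Bm : B / mu * m ^+ 2 <= 0 by lra.
have {}Bm : B / mu * m ^+ 2 = 0.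
  by apply/eqP; rewrite eq_le Bm /= mulr_ge0 ?sqr_ge0 // divr_ge0 // ltW.
by apply/eqP; rewrite eq_le ux_ge0 andbT -Bm.
Unshelve. all: by end_near. Qed.

(* [Pi] is the projection onto the nondegenerate directions of [H0]; the      *)
(* coordinates [x (1 - Pi) + mu^-1 (grad u) ...] have Jacobian 1 at [x0] and  *)
(* their [Pi] part vanishes exactly on the critical set.                       *)
Let Pi : 'M[R]_n := mu^-1 *: (H0 *m G0).

Let psi x : 'rV[R]_n := (x - x0) *m (1%:M - Pi) + mu^-1 *: (P x *m G0).

Let PiPi : Pi *m Pi = Pi.
Proof.
rewrite /Pi -scalemxAl -scalemxAr mulmxA hess_projection -scalemxAl; congr (_ *: _).
by rewrite scalerA mulVf ?gt_eqF // scale1r.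
Qed.

Let psi_Pi x : psi x *m Pi = mu^-1 *: (P x *m G0 *m Pi).
Proof.
have E : (1%:M - Pi) *m Pi = 0 by rewrite mulmxBl mul1mx PiPi subrr.
rewrite /psi mulmxDl -[(x - x0) *m _ *m _]mulmxA E mulmx0 add0r.
by rewrite -scalemxAl.
Qed.

Let psi_smooth : mx_smooth U psi.
Proof.
apply: (mx_smooth_add oU).
  apply: (@mx_smooth_mul _ _ _ oU _ _ _ (fun x => x - x0) (fun=> 1%:M - Pi)).
    move=> i j; apply: (@smooth_ext _ _ _ oU (fun x => x 0 j + - x0 0 j)).
      by move=> x _; rewrite !mxE ord1.
    apply: (smoothD oU); last exact: smooth_cst.
    by move=> k; exact: Ck_coord.
  by move=> i j; exact: smooth_cst.
apply: (mx_smooth_scale oU); apply: (mx_smooth_mul oU sP) => i j.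
exact: smooth_cst.
Qed.

Let psi_jacobian : partials_mx psi x0 = 1%:M.
Proof.
have sx : mx_smooth U (fun x : 'rV[R]_n => x - x0).
  move=> i j; apply: (@smooth_ext _ _ _ oU (fun x => x 0 j + - x0 0 j)).
    by move=> x _; rewrite !mxE ord1.
  by apply: (smoothD oU); [move=> k; exact: Ck_coord|exact: smooth_cst].
have sc (M : 'M[R]_n) : mx_smooth U (fun _ : 'rV[R]_n => M).
  by move=> i j; exact: smooth_cst.
apply/row_matrixP => i.
have -> : row i (partials_mx psi x0) = Dmx i psi x0.
  by apply/rowP => j; rewrite !mxE.
have s1 := mx_smooth_mul oU sx (sc (1%:M - Pi)).
have s2 := mx_smooth_mul oU sP (sc G0).
rewrite /psi (Dmx_add i s1 (mx_smooth_scale oU mu^-1 s2) Ux0).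
rewrite (Dmx_scale i mu^-1 s2 Ux0) (Dmx_mul i sx (sc _) Ux0) (Dmx_mul i sP (sc _) Ux0).
rewrite !Dmx_cst subrr mul0mx mulmx0 !addr0 hess_row.
have -> : Dmx i (fun x : 'rV[R]_n => x - x0) x0 = 'e_i.
  apply/rowP => j; rewrite mxE.
  have D := is_derive_coord x0 'e_i j.
  have E : (fun y : 'rV[R]_n => (y - x0) 0 j) = (fun y : 'rV[R]_n => y 0 j) - cst (x0 0 j).
    by apply: funext => y; rewrite !mxE.
  by rewrite E deriveB ?derive_cst ?subr0 //; case: D.
rewrite -rowE -row_mul -/H0 -linearZ /= -linearD /=.
by rewrite -/Pi subrK.
Qed.

(** [inverse_function] makes [psi] a coordinate system, and a linear change sends its [Pi] part to
    the last coordinates. That part vanishes iff P G0 H0 = 0: this holds at zeros, where du = 0, and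
    near [x0] it implies u = 0 by [zero_of_degenerate_gradient]. *)
Lemma straightening : exists (A V : set 'rV[R]_n) (Psi Phi : 'rV[R]_n -> 'rV[R]_n),
  [/\ [/\ open A, A x0, A `<=` U & open V],
      forall x, A x -> V (Psi x) /\ Phi (Psi x) = x,
      forall y, V y -> A (Phi y) /\ Psi (Phi y) = y,
      (forall j, smooth_on A (fun x => Psi x 0 j)) /\
      (forall j, smooth_on V (fun y => Phi y 0 j)) &
      forall x, A x -> (u x = 0 <->
        forall i : 'I_n, (n - \rank H0 <= i)%N -> Psi x 0 i = 0) ].
Proof.
have spsi j : smooth_on U (fun x => psi x 0 j) by exact: psi_smooth.
have [A [V [phi [[oA Ax0 AU oV] AV VA sphi]]]] :=
  inverse_function oU Ux0 spsi psi_jacobian.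
have [E uE kerE] := kernel_coordinates Pi.
have [r r0 rP] := (near_norm_ball _ _).1 zero_of_degenerate_gradient.
pose A' := [set x | A x /\ `|x0 - x| < r].
have oA' : open A' by apply: openI => //; exact: open_ball_norm.
pose V' := [set y | V (y *m invmx E) /\ A' (phi (y *m invmx E))].
have rankPi : \rank Pi = \rank H0.
  rewrite /Pi mxrank_scale_nz ?invr_eq0 ?gt_eqF //.
  by rewrite mxrankMfree // row_free_unit.
have smul (O : set 'rV[R]_n) (M : 'M[R]_n) (f : 'rV[R]_n -> 'rV[R]_n) : open O ->
    (forall j, smooth_on O (fun x => f x 0 j)) ->
    forall j, smooth_on O (fun x => (f x *m M) 0 j).
  move=> oO sf j; apply: (@smooth_ext _ _ _ oO (fun x => \sum_k f x 0 k * M k j)).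
    by move=> x _; rewrite mxE.
  by apply: smooth_sum => // k _; apply: smoothM => //; exact: smooth_cst.
have slin (O : set 'rV[R]_n) (M : 'M[R]_n) : open O ->
    forall j, smooth_on O (fun x => (x *m M) 0 j).
  by move=> oO; apply: (smul O M id oO) => j k; exact: Ck_coord.
have clin (M : 'M[R]_n) y : {for y, continuous (fun y : 'rV[R]_n => y *m M)}.
  apply: continuous_rV => j.
  exact: (Ck_continuous (slin setT M openT j 0%N)).
have oV' : open V'.
  rewrite openE => y [Vy Ay]; rewrite /interior; apply: filterI.
    exact: (clin (invmx E) y V (near_open oV Vy)).
  have cphi : {for y *m invmx E, continuous phi}.
    by apply: continuous_rV => j; exact: (Ck_continuous (sphi j 0%N)).
  have cc := @continuous_comp _ _ _ (fun y : 'rV[R]_n => y *m invmx E) phi y (clin _ y) cphi.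
  exact: (cc A' (near_open oA' Ay)).
exists A', V', (fun x => psi x *m E), (fun y => phi (y *m invmx E)); split.
- split=> //; last by move=> x [/AU].
  by split=> //; rewrite subrr normr0.
- move=> x [Ax xr]; have [Vx xE] := AV _ Ax.
  by rewrite mulmxK //; split=> //; split; rewrite mulmxK // xE.
- by move=> y [Vy Ay]; have [_ yE] := VA _ Vy; rewrite yE mulmxKV.
- split.
    apply: smul => // j k.
    by apply: Ck_subset (spsi j k) => x [/AU].
  move=> j k; apply: (@Ck_comp _ _ _ k V' V (fun y => phi y 0 j) (fun y => y *m invmx E)) => //.
  + by move=> y [].
  + by move=> l; exact: slin.
  + exact: sphi.
- move=> x [Ax xr]; rewrite -rankPi -kerE psi_Pi; split=> [ux|h].
    by rewrite covector_at_zero ?mul0mx ?scaler0 //; exact: AU.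
  apply: rP => //; move: h => /eqP; rewrite scaler_eq0 invr_eq0 gt_eqF //= => /eqP.
  rewrite /Pi -scalemxAr => /eqP; rewrite scaler_eq0 invr_eq0 gt_eqF //= mulmxA => /eqP h.
  by rewrite -[LHS](mulmxK G0u) h mul0mx.
Qed.


(** * Derivative of the Laplacian and trace of the shape operator in slice coordinates *)

Let Gam l x : 'M[R]_n := \matrix_(a, b) christoffel g x l a b.

Let sGam l : mx_smooth U (Gam l).
Proof.
move=> a b; have sDg i j m : smooth_on U ('D_'e_m (fun y => g y i j)).
  exact: smooth_derive (gs i j).
apply: (@smooth_ext _ _ _ oU (fun x => 2^-1 * \sum_m G x l m *
    ('D_'e_a (fun y => g y b m) x + 'D_'e_b (fun y => g y a m) x
     + -1 * 'D_'e_m (fun y => g y a b) x))).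
  by move=> x _; rewrite mxE; congr (_ * _); apply: eq_bigr => m _; rewrite mulN1r.
apply: (smoothM oU); first exact: smooth_cst.
apply: (smooth_sum oU) => m _; apply: (smoothM oU (sG l m)).
apply: (smoothD oU (smoothD oU _ _)) => //.
by apply: (smoothM oU) => //; exact: smooth_cst.
Qed.

Let trace_smooth (M : 'rV[R]_n -> 'M[R]_n) : mx_smooth U M ->
  smooth_on U (fun x => \tr (M x)).
Proof. by move=> sM; apply: (smooth_sum oU) => i _; exact: sM. Qed.

Let derive_trace (M : 'rV[R]_n -> 'M[R]_n) c x : mx_smooth U M -> U x ->
  'D_'e_c (fun y => \tr (M y)) x = \tr (Dmx c M x).
Proof.
move=> sM Ux; have -> : (fun y => \tr (M y)) = \sum_i (fun y => M y i i).
  by apply: funext => y; rewrite fct_sumE.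
rewrite derive_sum => [|i]; last exact: smooth_derivable (sM i i) Ux.
by apply: eq_bigr => i _; rewrite mxE.
Qed.

(** The Christoffel terms carry the coefficients D_l u, zero at [x0]; hence the derivative of the
    Laplacian at [x0] involves [Gam] only undifferentiated. *)
Lemma laplacianE x : laplacian g u x =
  \tr (G x *m hess x) + \sum_l (- 'D_'e_l u x) * \tr (G x *m Gam l x).
Proof.
have -> : \sum_l (- 'D_'e_l u x) * \tr (G x *m Gam l x) =
    \tr (G x *m \sum_l (- 'D_'e_l u x) *: Gam l x).
  rewrite mulmx_sumr raddf_sum; apply: eq_bigr => l _ /=.
  by rewrite -scalemxAr mxtraceZ.
rewrite -mxtraceD -mulmxDr; congr (\tr (_ *m _)).
apply/matrixP => a b; rewrite !mxE summxE -sumrN; congr (_ + _).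
by apply: eq_bigr => l _; rewrite !mxE mulNr mulrC.
Qed.

Let laplacian_smooth : smooth_on U (laplacian g u).
Proof.
apply: (@smooth_ext _ _ _ oU (fun x => \tr (G x *m hess x) +
    \sum_l (-1 * 'D_'e_l u x) * \tr (G x *m Gam l x))).
  by move=> x _; rewrite laplacianE; under eq_bigr => l _ do rewrite mulN1r.
apply: (smoothD oU); first by apply: trace_smooth; exact: mx_smooth_mul.
apply: (smooth_sum oU) => l _; apply: (smoothM oU).
  by apply: (smoothM oU); [exact: smooth_cst|exact: smooth_derive].
by apply: trace_smooth; exact: mx_smooth_mul.
Qed.

Let derive_laplacian c : 'D_'e_c (laplacian g u) x0 =
  \tr (Dmx c G x0 *m H0) + \tr (G0 *m third c)
  - \sum_l H0 c l * \tr (G0 *m Gam l x0).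
Proof.
have sGh : mx_smooth U (fun x => G x *m hess x) by exact: mx_smooth_mul.
have sGG l : mx_smooth U (fun x => G x *m Gam l x) by exact: mx_smooth_mul.
have d0 := smooth_derivable (i := c) (trace_smooth sGh) Ux0.
have d1 l := smooth_derivable (i := c) (trace_smooth (sGG l)) Ux0.
have d2 l := smooth_derivable (i := c) (smooth_derive l su) Ux0.
have -> : laplacian g u = (fun x => \tr (G x *m hess x)) +
    \sum_l ((- 'D_'e_l u) * (fun x => \tr (G x *m Gam l x))).
  by apply: funext => x; rewrite laplacianE fctE fct_sumE.
have d3 l : derivable ((- 'D_'e_l u) * (fun x => \tr (G x *m Gam l x))) x0 'e_c.
  exact: derivableM (derivableN (d2 l)) (d1 l).
have d4 : derivable (\sum_l ((- 'D_'e_l u) * (fun x => \tr (G x *m Gam l x)))) x0 'e_c.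
  exact: derivable_sum.
rewrite (deriveD d0 d4) derive_trace // (Dmx_mul c sG shess Ux0) mxtraceD.
congr (_ + _ + _); rewrite derive_sum // -sumrN; apply: eq_bigr => l _.
rewrite (deriveM (derivableN (d2 l)) (d1 l)) (deriveN (d2 l)).
have -> : (- 'D_'e_l u) x0 = 0 by rewrite -[LHS]/(- ('D_'e_l u x0)) derive_at_zero // oppr0.
rewrite scale0r add0r scalerN /H0 [hess x0 c l]mxE.
by congr (- _); exact: mulrC.
Qed.

Variable alpha : R -> R.
Hypothesis laplacian_level : forall x, U x -> laplacian g u x = alpha (u x).

Variables (k : nat) (kn : (k <= n)%N).
Hypothesis rank_slice : (\rank H0 + k = n)%N.
Hypothesis slice : forall x, U x ->
  (u x = 0 <-> forall i : 'I_n, (k <= i)%N -> x 0 i = 0).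

Let tgt (a : 'I_k) : 'I_n := widen_ord kn a.

(** Near [x], the line in a tangential direction stays in the slice, where [F] is zero. *)
Let derive_tangent_eq0 (F : 'rV[R]_n -> R) x a : U x -> u x = 0 ->
  (forall y, U y -> u y = 0 -> F y = 0) -> 'D_'e_(tgt a) F x = 0.
Proof.
move=> Ux uxE F0; rewrite derive_along_line.
have [r r0 rU] := open_norm_ball oU Ux.
transitivity ('D_1 (cst (0 : R)) (0 : R)); last exact: derive_cst.
apply: near_eq_derive.
apply/nbhs_ballP; exists r => // h; rewrite /ball /= sub0r normrN => hr.
have Uh : U (h *: 'e_(tgt a) + x).
  apply: rU; rewrite opprD addrCA subrr addr0 normrN normrZ.
  by apply: le_lt_trans hr; rewrite ler_piMr // norm_delta_le1.
apply: F0 => //; apply/(slice Uh) => i ki; rewrite !mxE.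
have -> : x 0 i = 0 by apply: (slice Ux).1.
have -> : (i == tgt a) = false.
  by apply/eqP => /(congr1 val) /= ia; move: ki; rewrite ia leqNgt ltn_ord.
by rewrite andbF mulr0 addr0.
Qed.

Let iota : 'M[R]_(k, n) := rowsub tgt 1%:M.

Let iotaE p (M : 'M[R]_(n, p)) a j : (iota *m M) a j = M (tgt a) j.
Proof. by rewrite -rowsubE mxE. Qed.

Let tgt_inj : injective tgt.
Proof. by move=> a b /(congr1 val) /= ab; exact: val_inj. Qed.

Let iota_free : row_free iota.
Proof.
apply/row_freeP; exists iota^T; apply/matrixP => a b.
by rewrite iotaE !mxE eq_sym (inj_eq tgt_inj).
Qed.

Let sandwichE (M : 'M[R]_n) a b : (iota *m M *m iota^T) a b = M (tgt a) (tgt b).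
Proof.
have -> : iota *m M *m iota^T = iota *m (M *m iota^T) by rewrite mulmxA.
rewrite iotaE; have -> : M *m iota^T = (iota *m M^T)^T by rewrite trmx_mul trmxK.
by rewrite mxE iotaE mxE.
Qed.

Let hess_tangent x a j : U x -> u x = 0 -> hess x (tgt a) j = 0.
Proof.
move=> Ux uxE; rewrite mxE; apply: derive_tangent_eq0 => // y Uy uy.
exact: derive_at_zero.
Qed.

Let iotaH : iota *m H0 = 0.
Proof.
apply/matrixP => a j; rewrite iotaE [RHS]mxE.
exact: hess_tangent Ux0 ux0.
Qed.

(** By symmetry this is a tangential derivative of a Hessian entry with a tangential index, and such
    entries vanish along the slice. *)
Let third_tangent a b c : third c (tgt a) (tgt b) = 0.
Proof.
rewrite third_comm third_sym [LHS]mxE.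
apply: derive_tangent_eq0 => // y Uy uy; exact: hess_tangent.
Qed.

(** The second form is iota C iota^T, and by [tangent_inverse] the inverse first form, extended to
    the ambient space, is G0 - N. The trace is thus tr((G0 - N) C), zero by
    [tangential_trace_eq0]. *)
Lemma slice_trace_eq0 (xi : 'rV[R]_n) :
  (forall a, inner (g x0) 'e_(tgt a) xi = 0) ->
  \tr ((\matrix_(a < k, b < k) inner (g x0) (nabla_coord g x0 (tgt a) (tgt b)) xi)
       *m invmx (\matrix_(a < k, b < k) g x0 (tgt a) (tgt b))) = 0.
Proof.
move=> xi_normal.
have gG : g x0 *m G0 = 1%:M by rewrite mulmxV // metric_unit.
have g0T : (g x0)^T = g x0 by exact: gT.
have G0T : G0^T = G0 by exact: inv_metric_sym.
have H0T : H0^T = H0 by exact: hess_sym.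
have mu0 : mu != 0 by rewrite gt_eqF.
have xig : xi *m g x0 *m iota^T = 0.
  apply: trmx_inj; rewrite !trmx_mul trmxK g0T trmx0 mulmxA.
  apply/matrixP => a b; rewrite !ord1 -mulmxA iotaE [RHS]mxE -[RHS](xi_normal a).
  by rewrite /inner -mulmxA -rowE [RHS]mxE.
have Hxi := normal_covector gG G0T H0T mu0 hess_projection iotaH iota_free rank_slice xig.
set F1 := \matrix_(a, b) g x0 (tgt a) (tgt b).
(* [derive_level_eq0] needs a positive second derivative of [u] along xi, so xi = 0 is set apart. *)
have [xiE|xi0] := eqVneq xi 0.
  have -> : \matrix_(a < k, b < k) inner (g x0) (nabla_coord g x0 (tgt a) (tgt b)) xi = 0.
    by apply/matrixP => a b; rewrite [LHS]mxE [RHS]mxE /inner xiE trmx0 mulmx0 mxE.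
  by rewrite mul0mx linear0.
pose along (M : 'I_n -> 'M[R]_n) := \sum_c xi 0 c *: M c.
have along_trl M A : \tr (along M *m A) = \sum_c xi 0 c * \tr (M c *m A).
  rewrite /along mulmx_suml raddf_sum; apply: eq_bigr => c _ /=.
  by rewrite -scalemxAl mxtraceZ.
have along_trr M A : \tr (A *m along M) = \sum_c xi 0 c * \tr (A *m M c).
  by rewrite mxtrace_mulC along_trl; apply: eq_bigr => c _; rewrite mxtrace_mulC.
have alongE M a b : along M a b = \sum_c xi 0 c * M c a b.
  by rewrite /along summxE; apply: eq_bigr => c _; rewrite [LHS]mxE.
pose gd a := Dmx a g x0; pose Gd a := Dmx a G x0.
have GdE a : Gd a = - (G0 *m gd a *m G0).
  exact: (Dmx_inv oU a metric_unit gs Ux0).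
have gdT a : (gd a)^T = gd a.
  by rewrite /gd -Dmx_tr; exact: (Dmx_ext oU).
have gdC c a b : gd c a b = gd c b a by rewrite -[in LHS]gdT [LHS]mxE.
have gdE a b c : gd c a b = 'D_'e_c (fun y => g y a b) x0 by exact: mxE.
clearbody gd.
pose K : 'M[R]_n := \matrix_a (xi *m gd a).
pose C := 2^-1 *: (K + K^T - along gd).
pose N := mu^-1 *: (G0 *m H0 *m G0).
have KE a b : K a b = \sum_m xi 0 m * gd a m b.
  by rewrite [LHS]mxE [LHS]mxE.
have xigG m : \sum_l (xi *m g x0) 0 l * G0 l m = xi 0 m.
  by rewrite -[in RHS](mulmx1 xi) -gG mulmxA [RHS]mxE.
(* The dual metric in the Christoffel symbols cancels the metric in xi g: [C] pairs nabla_a d_b with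
   xi. *)
have CE a b : C a b = \sum_l (xi *m g x0) 0 l * christoffel g x0 l a b.
  transitivity (2^-1 * \sum_m xi 0 m * (gd a b m + gd b a m - gd m a b)).
    rewrite [LHS]mxE; congr (_ * _); rewrite mxBE alongE [_ a b]mxE KE.
    rewrite [K^T a b]mxE KE -big_split -sumrB /=; apply: eq_bigr => m _.
    rewrite (gdC a b m) (gdC b a m).
    move: (gd a m b) (gd b m a) (gd m a b) => r1 r2 r3; ring.
  under [RHS]eq_bigr => l _ do rewrite /christoffel mulrCA mulr_sumr.
  rewrite -mulr_sumr exchange_big; congr (_ * _); apply: eq_bigr => m _ /=.
  under eq_bigr => l _ do rewrite mulrA.
  by rewrite -mulr_suml xigG; congr (_ * _); rewrite !gdE.
have tang : \tr ((G0 - N) *m along third) = 0.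
  rewrite -(tangent_inverse gG G0T H0T mu0 hess_projection iotaH iota_free rank_slice).
  rewrite -!mulmxA mxtrace_mulC -!mulmxA.
  have -> : iota *m (along third *m iota^T) = 0; last by rewrite mulmx0 linear0.
  rewrite mulmxA; apply/matrixP => a b; rewrite sandwichE alongE [RHS]mxE.
  by rewrite big1 // => c _; rewrite third_tangent mulr0.
pose t l := \tr (G0 *m Gam l x0).
have trC : \tr (G0 *m C) = \sum_l (xi *m g x0) 0 l * t l.
  have -> : C = \sum_l (xi *m g x0) 0 l *: Gam l x0.
    apply/matrixP => a b; rewrite CE summxE; apply: eq_bigr => l _.
    by rewrite [RHS]mxE [Gam l x0 a b]mxE.
  rewrite mulmx_sumr raddf_sum; apply: eq_bigr => l _ /=.
  by rewrite -scalemxAr mxtraceZ.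
have xiH_pos : 0 < \sum_j xi 0 j * (\sum_i xi 0 i * 'D_'e_j ('D_'e_i u) x0).
  rewrite hess_form -/H0 Hxi -scalemxAl [X in 0 < X]mxE mulr_gt0 //.
  exact: (gpos Ux0 xi0).
have level y z : U y -> U z -> u y = u z -> laplacian g u y = laplacian g u z.
  by move=> Uy Uz uyz; rewrite (laplacian_level Uy) (laplacian_level Uz) uyz.
have D0 := derive_level_eq0 oU su laplacian_smooth Ux0
  (fun i => derive_at_zero 'e_i Ux0 ux0) xiH_pos level.
(* The derivative of the Laplacian along xi, expanded with xi H0 = mu xi g. *)
have lap : \tr (along Gd *m H0) + \tr (G0 *m along third) - mu * \tr (G0 *m C) = 0.
  rewrite along_trl along_trr trC -big_split mulr_sumr /=.
  have -> : \sum_l mu * ((xi *m g x0) 0 l * t l) =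
            \sum_c xi 0 c * \sum_l H0 c l * t l.
    transitivity (\sum_l (xi *m H0) 0 l * t l).
      by apply: eq_bigr => l _; rewrite Hxi [X in _ = X * _]mxE mulrA.
    under [RHS]eq_bigr => c _ do rewrite mulr_sumr.
    rewrite exchange_big; apply: eq_bigr => l _ /=; rewrite [X in X * _ = _]mxE mulr_suml.
    by apply: eq_bigr => c _; rewrite mulrA.
  rewrite -sumrB.
  rewrite (derive_sumE xi oU (laplacian_smooth 1%N) Ux0) in D0; rewrite -[RHS]D0.
  apply: eq_bigr => c _; rewrite derive_laplacian.
  by rewrite -mulrDr -mulrBr.
have XC := tangential_trace_eq0 gG G0T H0T mu0 hess_projection Hxi GdE third_comm
  third_sym eikonal_cubic tang lap.
have -> : F1 = iota *m g x0 *m iota^T.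
  by apply/matrixP => a b; rewrite sandwichE [LHS]mxE.
have -> : \matrix_(a < k, b < k) inner (g x0) (nabla_coord g x0 (tgt a) (tgt b)) xi =
    iota *m C *m iota^T.
  apply/matrixP => a b; rewrite sandwichE [LHS]mxE CE /inner -mulmxA [LHS]mxE.
  apply: eq_bigr => l _; rewrite [X in X * _]mxE mulrC; congr (_ * _).
  have -> : g x0 *m xi^T = (xi *m g x0)^T by rewrite trmx_mul g0T.
  by rewrite [LHS]mxE.
rewrite -[iota *m C *m iota^T *m _]mulmxA mxtrace_mulC mulmxA.
rewrite (tangent_inverse gG G0T H0T mu0 hess_projection iotaH iota_free rank_slice).
exact: XC.
Qed.

End LocalTransnormal.

(** * Focal varieties *)

Section AffineChange.
Context {R : realType}.

Lemma derivable_affine (B : R -> R) (s m t : R) :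
  derivable B (s * t + m) 1 ->
  derivable (fun t => B (s * t + m)) t 1 /\
  derive1 (fun t => B (s * t + m)) t = s * derive1 B (s * t + m).
Proof.
move=> dB.
have da : is_derive t 1 (fun t : R => s * t + m) s.
  have -> : (fun t : R => s * t + m) = (s \*: id : R -> R) + cst m by [].
  by apply: is_derive_eq; rewrite addr0 /GRing.scale /= mulr1.
have dB' : is_derive (s * t + m) 1 B (derive1 B (s * t + m)).
  by split => //; rewrite derive1E.
have [? E] := @is_derive1_comp _ B (fun t => s * t + m) t _ _ dB' da.
by split => //; rewrite derive1E mulrC -E.
Qed.

Lemma derive1n_affine (B : R -> R) (s m : R) (V : set R) : open V ->
  (forall k t, V t -> derivable (derive1n k B) t 1) ->
  forall k t, V (s * t + m) -> derivable (derive1n k (fun t => B (s * t + m))) t 1.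
Proof.
move=> oV dB k.
have oW : open [set t : R | V (s * t + m)].
  apply: open_comp oV => t _; apply: continuousD; last exact: cst_continuous.
  by apply: continuousM; [exact: cst_continuous|exact: id].
suff H : forall t, V (s * t + m) -> derive1n k (fun t => B (s * t + m)) t =
    s ^+ k * derive1n k B (s * t + m).
  move=> t Vt; have [d _] := derivable_affine (dB k _ Vt).
  apply: near_eq_derivable (derivableZ (k := s ^+ k) d).
  by near=> z; rewrite H //; near: z; exact: open_nbhs_nbhs.
elim: k => [|k IH] t Vt; first by rewrite mul1r.
have [d E] := derivable_affine (dB k _ Vt).
rewrite exprSr -mulrA -E !derive1nS !derive1E -[RHS](deriveZ _ d).
apply: near_eq_derive; near=> z; apply: IH.
by near: z; exact: open_nbhs_nbhs.
Unshelve. all: by end_near. Qed.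

Context {n : nat}.
Variables (U : set 'rV[R]_n) (g : 'rV[R]_n -> 'M[R]_n) (F : 'rV[R]_n -> R).
Variables s m : R.
Hypotheses (oU : open U) (sF : smooth_on U F).
Let H := fun x => s * F x + m.

Lemma smooth_affine : smooth_on U H.
Proof. by apply: (smoothD oU); [apply: (smoothM oU)|]; try exact: smooth_cst. Qed.

Lemma derive_affine x i : U x -> 'D_'e_i H x = s * 'D_'e_i F x.
Proof.
move=> Ux; have d := smooth_derivable (i := i) sF Ux.
have -> : H = (s \*: F) + cst m by [].
by rewrite (deriveD (derivableZ d) (derivable_cst m x 'e_i)) derive_cst addr0 (deriveZ _ d).
Qed.

Lemma gradient_affine x : U x -> gradient g H x = s *: gradient g F x.
Proof.
move=> Ux; rewrite /gradient scalemxAl; congr (_ *m _).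
by apply/rowP => i; rewrite !mxE derive_affine.
Qed.

Lemma laplacian_affine x : U x -> laplacian g H x = s * laplacian g F x.
Proof.
move=> Ux; rewrite /laplacian -mxtraceZ scalemxAr; congr (\tr (_ *m _)).
apply/matrixP => i j; rewrite !mxE mulrBr mulr_sumr; congr (_ - _); last first.
  by apply: eq_bigr => l _; rewrite derive_affine // mulrCA.
have d := smooth_derivable (i := i) (smooth_derive j sF) Ux.
rewrite -[RHS](deriveZ _ d); apply: near_eq_derive.
by near=> z; apply: derive_affine; near: z; exact: near_open.
Unshelve. all: by end_near. Qed.

End AffineChange.

Lemma open_setI_preimage (X Y : topologicalType) (h : X -> Y) (D : set X) (A : set Y) :
  open D -> open A -> (forall p, D p -> {for p, continuous h}) ->
  open (D `&` h @^-1` A).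
Proof.
move=> oD oA ch; rewrite openE => p [Dp Ap]; apply: filterI.
  exact: open_nbhs_nbhs.
by apply: (ch p Dp); exact: open_nbhs_nbhs.
Qed.

(** * Composing a chart with a local diffeomorphism *)

Section ChangeOfChart.
Context {R : realType} {n : nat}.

Lemma chart_overlap_open (T : topologicalType) (c : chart R n T) (D : set T) :
  is_chart c -> open D -> open (cmap c @` (cdom c `&` D)).
Proof.
move=> [od oi cK _ ci] oD.
suff -> : cmap c @` (cdom c `&` D) = cimage c `&` cinv c @^-1` D.
  exact: open_setI_preimage.
apply/seteqP; split => [_ [p [cp Dp] <-]|_ [[p cp <-]]] /=.
  by split; [exists p|rewrite /= cK].
by rewrite cK // => Dp; exists p.
Qed.

Variables (N : smoothManifold R n) (c : chart R n N).
Variables (A V : set 'rV[R]_n) (Psi Phi : 'rV[R]_n -> 'rV[R]_n).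
Hypotheses (ac : atlas c) (oA : open A) (oV : open V) (Ac : A `<=` cimage c).
Hypothesis PsiK : forall x, A x -> V (Psi x) /\ Phi (Psi x) = x.
Hypothesis PhiK : forall y, V y -> A (Phi y) /\ Psi (Phi y) = y.
Hypothesis sPsi : forall j, smooth_on A (fun x => Psi x 0 j).
Hypothesis sPhi : forall j, smooth_on V (fun y => Phi y 0 j).

Definition change_chart : chart R n N :=
  Chart (cdom c `&` cmap c @^-1` A) (Psi \o cmap c) (cinv c \o Phi).

Let cimage_change : cimage change_chart = V.
Proof.
have [_ _ cK _ _] := atlas_is_chart ac.
apply/seteqP; split => [_ [p [_ Ap] <-]|y Vy]; first by have [] := PsiK Ap.
have [APy PPy] := PhiK Vy; have [p cp pE] := Ac APy.
by exists p => /=; [split => //=; rewrite pE|rewrite pE].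
Qed.

Lemma change_chart_is_chart : is_chart change_chart.
Proof.
have [od oi cK cc ci] := atlas_is_chart ac.
split.
- exact: open_setI_preimage.
- by rewrite cimage_change.
- by move=> p [cp Ap] /=; have [_ ->] := PsiK Ap; exact: cK.
- move=> p [cp Ap]; apply: continuous_comp; first exact: cc.
  by apply: continuous_rV => j; exact: Ck_continuous (sPsi j 0%N) Ap.
- rewrite cimage_change => y Vy; apply: continuous_comp.
    by apply: continuous_rV => j; exact: Ck_continuous (sPhi j 0%N) Vy.
  by apply: ci; apply: Ac; have [] := PhiK Vy.
Qed.

(** By maximality of the atlas compatibility suffices, and the transitions with [d] are those of [c]
    composed with [Phi] or [Psi]. *)
Lemma change_chart_atlas : atlas change_chart.
Proof.
apply: atlas_maximal; first exact: change_chart_is_chart.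
move=> d ad i.
have [od oi cK cc ci] := atlas_is_chart ac.
have [od' oi' cK' cc' ci'] := atlas_is_chart ad.
have oc := chart_overlap_open (atlas_is_chart ac) od'.
have och := chart_overlap_open change_chart_is_chart od'.
have odh : open (cmap d @` (cdom change_chart `&` cdom d)).
  rewrite setIC; apply: chart_overlap_open; first exact: atlas_is_chart.
  by have [] := change_chart_is_chart.
split => k.
- apply: (@Ck_comp _ _ _ k _ (cmap c @` (cdom c `&` cdom d))
      (fun x => transition c d x 0 i) Phi och oc).
  + move=> _ [p [[cp Ap] dp] <-] /=; have [_ ->] := PsiK Ap.
    by exists p.
  + move=> j; apply: Ck_subset (sPhi j k) => _ [p [[cp Ap] dp] <-] /=.
    by have [] := PsiK Ap.
  + exact: (atlas_compatible ac ad i).1.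
- apply: (@Ck_comp _ _ _ k _ A (fun x => Psi x 0 i) (transition d c) odh oA).
  + by move=> _ [p [[cp Ap] dp] <-] /=; rewrite /transition /= cK'.
  + move=> j; apply: Ck_subset ((atlas_compatible ac ad j).2 k).
    by move=> _ [p [[cp Ap] dp] <-]; exists p.
  + exact: sPsi.
Qed.

End ChangeOfChart.

(** * The zero set of a nonnegative isoparametric function *)

Section ZeroSet.
Context {R : realType} {n : nat}.
Variables (N : riemannianManifold R n) (h : N -> R).
Variables (W : set R) (beta alpha : R -> R).
Hypotheses (conN : connected [set: N]) (sh : smooth_function h).
Hypotheses (oW : open W) (hW : forall p, W (h p)).
Hypothesis sbeta : forall k t, W t -> derivable (derive1n k beta) t 1.
Hypotheses (h_ge0 : forall p, 0 <= h p) (h_neq0 : exists p, h p <> 0).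
Hypothesis eikonal : forall c, atlas c -> forall p, cdom c p ->
  let grad := gradient (metric c) (h \o cinv c) (cmap c p) in
  inner (metric c (cmap c p)) grad grad = beta (h p).
Hypothesis level : forall c, atlas c -> forall p, cdom c p ->
  laplacian (metric c) (h \o cinv c) (cmap c p) = alpha (h p).

Let S := [set p | h p = 0].
Let mu := derive1 beta 0 / 2.

Let mu2 : 2 * mu = derive1 beta 0.
Proof. by rewrite /mu mulrCA divff ?mulr1 // pnatr_eq0. Qed.

Section InChart.
Variable c : chart R n N.
Hypothesis ac : atlas c.
Let U := cimage c.
Let g := metric c.
Let u := h \o cinv c.

Let uE p : cdom c p -> u (cmap c p) = h p.
Proof. by move=> cp; have [_ _ cK _ _] := atlas_is_chart ac; rewrite /u /= cK. Qed.

Let oU : open U. Proof. by have [] := atlas_is_chart ac. Qed.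
Let gs : mx_smooth U g. Proof. exact: metric_smooth ac. Qed.
Let su : smooth_on U u. Proof. exact: sh ac. Qed.
Let gT x : U x -> (g x)^T = g x. Proof. exact: (@Defs.metric_sym _ _ N _ ac). Qed.
Let gpos x : U x -> forall v, v != 0 -> 0 < inner (g x) v v.
Proof. exact: (metric_posdef ac). Qed.
Let uW x : U x -> W (u x). Proof. by move=> _; exact: hW. Qed.
Let u_ge0 x : U x -> 0 <= u x. Proof. by move=> _; exact: h_ge0. Qed.
Let eik x : U x -> inner (g x) (gradient g u x) (gradient g u x) = beta (u x).
Proof. by move=> [p cp <-]; rewrite (uE cp); exact: eikonal. Qed.
Let lap x : U x -> laplacian g u x = alpha (u x).
Proof. by move=> [p cp <-]; rewrite (uE cp); exact: level. Qed.

Variable p : N.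
Hypotheses (cp : cdom c p) (Sp : S p).
Let x0 := cmap c p.
Let Ux0 : U x0. Proof. by exists p. Qed.
Let ux0 : u x0 = 0. Proof. by rewrite (uE cp). Qed.

Lemma zero_set_nbhs : mu <= 0 -> nbhs p S.
Proof.
move=> mu0; have [od _ cK cc _] := atlas_is_chart ac.
have Z := zero_near_of_derive_le0 oU gs su gT gpos sbeta uW u_ge0 eik Ux0 ux0 mu2 oW mu0.
have Z' : \forall q \near p, u (cmap c q) = 0 by exact: (cc p cp) Z.
near=> q; rewrite /S /= -uE; first by near: q; exact: Z'.
by near: q; exact: open_nbhs_nbhs.
Unshelve. all: by end_near. Qed.

Hypothesis mu_gt0 : 0 < mu.

(** The value depends neither on the zero nor on the chart, so the zero set has a single
    dimension. *)
Lemma rank_zero_set : (\rank (hess u x0))%:R = alpha 0 / mu.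
Proof.
apply: (mulIf (lt0r_neq0 mu_gt0)); rewrite mulfVK ?lt0r_neq0 //.
by rewrite (rank_hess oU gs su gT gpos sbeta uW u_ge0 eik Ux0 ux0 mu2 mu_gt0) lap // ux0.
Qed.

Lemma zero_set_slice_chart :
  exists2 d, slice_chart (n - \rank (hess u x0)) S d & cdom d p.
Proof.
have [A [V [Psi [Phi [[oA Ax0 AU oV] PsiK PhiK [sPsi sPhi] Z]]]]] :=
  straightening oU gs su gT gpos sbeta uW u_ge0 eik Ux0 ux0 mu2 oW mu_gt0.
exists (change_chart c A Psi Phi); last by [].
split; first exact: (change_chart_atlas ac oA oV AU PsiK PhiK sPsi sPhi).
by move=> q [cq Aq]; rewrite /S /= -(uE cq); exact: Z.
Qed.

Lemma shape_operator_trace0 k (kn : (k <= n)%N) xi :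
  (\rank (hess u x0) + k = n)%N -> slice_chart k S c ->
  normal_vector kn c x0 xi -> \tr (shape_operator kn c x0 xi) = 0.
Proof.
move=> rk [_ sl]; apply: (slice_trace_eq0 oU gs su gT gpos sbeta uW u_ge0 eik
  Ux0 ux0 mu2 mu_gt0 lap rk).
by move=> _ [q cq <-]; rewrite (uE cq); exact: sl.
Qed.

End InChart.

(** Otherwise the zero set would be open by [zero_set_nbhs], closed by continuity and nonempty,
    hence all of the connected [N]. *)
Lemma zero_set_derive_gt0 : S !=set0 -> 0 < mu.
Proof.
move=> S0; rewrite ltNge; apply/negP => mu0; have [q hq] := h_neq0; apply: hq.
suff : S = setT by move/seteqP => [_ /(_ q I)].
have oS : open S.
  rewrite openE => p Sp; have [c ac cp] := atlas_cover p.
  exact: (zero_set_nbhs ac cp Sp mu0).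
apply: conN => //; first by exists S => //; rewrite setTI.
exists S; last by rewrite setTI.
have -> : S = h @^-1` [set 0] by [].
apply: closed_comp => [p _|]; last exact: closed_eq.
have [c ac cp] := atlas_cover p; have [od _ cK cc _] := atlas_is_chart ac.
have cu : {for cmap c p, continuous (h \o cinv c)}.
  by apply: Ck_continuous (sh ac 0%N) _; exists p.
have hp : h \o cinv c \o cmap c @ p --> h p.
  by rewrite -[in X in _ --> X](cK p cp); exact: continuous_comp (cc p cp) cu.
apply: cvg_trans hp; apply: near_eq_cvg.
by near=> z; rewrite /= cK //; near: z; exact: open_nbhs_nbhs.
Unshelve. all: by end_near. Qed.

Lemma zero_set_minimal : S !=set0 ->
  exists (k : nat) (kn : (k <= n)%N), minimal_submanifold kn S.
Proof.
move=> S0; have mu_gt0 := zero_set_derive_gt0 S0.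
have [p0 Sp0] := S0; have [c0 ac0 cp0] := atlas_cover p0.
(* The rank is read off at one zero in one chart; [rank_zero_set] carries it to all others. *)
pose r := \rank (hess (h \o cinv c0) (cmap c0 p0)).
have rE c p : atlas c -> cdom c p -> S p -> \rank (hess (h \o cinv c) (cmap c p)) = r.
  move=> ac cp Sp; apply/eqP; rewrite -(eqr_nat R); apply/eqP.
  exact: etrans (rank_zero_set ac cp Sp mu_gt0) (esym (rank_zero_set ac0 cp0 Sp0 mu_gt0)).
exists (n - r)%N, (leq_subr r n); split => [p Sp|c sc p cp Sp xi].
  have [c ac cp] := atlas_cover p; rewrite -(rE c p ac cp Sp).
  exact: (zero_set_slice_chart ac cp Sp mu_gt0).
apply: (shape_operator_trace0 sc.1 cp Sp mu_gt0) => //.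
by rewrite (rE _ _ sc.1 cp Sp) subnKC // rank_leq_row.
Qed.

End ZeroSet.

(* Meant for [s = 1] at the minimum [- m] and [s = - 1] at the maximum [m]. *)
Lemma level_set_minimal {R : realType} {n : nat} (N : riemannianManifold R n)
    (f : N -> R) (s m : R) :
  connected [set: N] -> isoparametric f -> s * s = 1 ->
  (forall p, 0 <= s * f p + m) -> [set p | s * f p + m = 0] !=set0 ->
  exists (k : nat) (kn : (k <= n)%N),
    minimal_submanifold kn [set p | s * f p + m = 0].
Proof.
move=> conN [[sf [p [q fpq]] [b [V [B [oV fV sB bB]]] eik]] [a _ lap]] ss h_ge0.
(* As s is its own inverse, this recovers f from s f + m. *)
have sK x : s * (s * x + m) + - (s * m) = x by rewrite mulrDr mulrA ss mul1r addrK.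
(* The smooth extension [B] is used instead of b, since derivatives are needed at the end point of
   the range. *)
pose beta t := B (s * t + - (s * m)).
apply: (@zero_set_minimal _ _ N _ [set t | V (s * t + - (s * m))] beta
  (fun t => s * a (s * t + - (s * m)))) => //.
- by move=> c ac; apply: (smooth_affine s m _ (sf c ac)); have [] := atlas_is_chart ac.
- apply: open_comp oV => t _; apply: continuousD; last exact: cst_continuous.
  by apply: continuousM; [exact: cst_continuous|exact: id].
- by move=> r /=; rewrite sK; apply: fV; exists r.
- by move=> k t; exact: derive1n_affine.
- have [E|] := eqVneq (s * f p + m) 0; last by move=> /eqP; exists p.
  exists q => E'; apply: fpq; rewrite -[f p]sK -[f q]sK E E' //.
- move=> c ac r cr /=; have [_ oi cK _ _] := atlas_is_chart ac.
  have Ur : cimage c (cmap c r) by exists r.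
  rewrite (gradient_affine (metric c) s m (sf c ac) Ur).
  rewrite /inner linearZ /= -!scalemxAl -scalemxAr scalerA ss scale1r.
  by rewrite /beta sK -bB; [exact: eik|exists r].
- move=> c ac r cr /=; have [_ oi _ _ _] := atlas_is_chart ac.
  have Ur : cimage c (cmap c r) by exists r.
  by rewrite (laplacian_affine (metric c) s m oi (sf c ac) Ur) lap // sK.
Qed.

Theorem theorem1p1 (R : realType) (n : nat) (N : riemannianManifold R n)
    (f : N -> R) :
  connected [set: N] -> complete_manifold N -> isoparametric f ->
  (focal_plus f !=set0 ->
     exists (k : nat) (kn : (k <= n)%N), minimal_submanifold kn (focal_plus f)) /\
  (focal_minus f !=set0 ->
     exists (k : nat) (kn : (k <= n)%N), minimal_submanifold kn (focal_minus f)).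
Proof.
move=> conN _ isof; split=> -[p0 max_p0].
(* The maximum set is the zero set of max f - f; below, the minimum set is that of f - min f. *)
- have E : focal_plus f = [set p | -1 * f p + f p0 = 0].
    apply/seteqP; split => p /=; rewrite mulN1r addrC.
      by move=> max_p; apply/eqP; rewrite subr_eq0 eq_le max_p max_p0.
    by move=> /eqP; rewrite subr_eq0 => /eqP pE q; rewrite -pE.
  rewrite E; apply: level_set_minimal => //; first by rewrite mulN1r opprK.
    by move=> p; rewrite mulN1r addrC subr_ge0.
  by exists p0; rewrite /= mulN1r addNr.
- have E : focal_minus f = [set p | 1 * f p + - f p0 = 0].
    apply/seteqP; split => p /=; rewrite mul1r.
      by move=> min_p; apply/eqP; rewrite subr_eq0 eq_le min_p max_p0.
    by move=> /eqP; rewrite subr_eq0 => /eqP pE q; rewrite pE.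
  rewrite E; apply: level_set_minimal => //; first by rewrite mulr1.
    by move=> p; rewrite mul1r subr_ge0.
  by exists p0; rewrite /= mul1r subrr.
Qed.
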